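(* Let $0<q<1$, $\mathcal{U}=\mathcal{U}_q(su_2)$, $\mathcal{A}=\mathcal{O}(SU_q(2))$. Let $\mathcal{H}$ be the Hilbert space with orthonormal basis $\{\eta_{nkl}: n,k\in\mathbb{N}_0,\ l\in\mathbb{Z}\}$, and let $E,F,K^{\pm1}$ (with domain $\mathcal{D}_0=\mathrm{Lin}\{\eta_{nkl}\}$) and $a,b,c,d$ (bounded on $\mathcal{H}$) be the operators of the representation $(I)_{1,1}$ of $\mathcal{U}\ltimes\mathcal{A}$ given in the context. Put $v_0=\sum_{n=0}^\infty(-q)^n\eta_{n,n,-n}\in\mathcal{H}$. Then $\mathcal{D}=\mathcal{O}(SU_q(2))v_0$ is dense in $\mathcal{H}$, and there is a unique $*$-representation $\pi$ of $\mathcal{U}_q(su_2)\ltimes\mathcal{O}(SU_q(2))$ on the domain $\mathcal{D}$ such that $$\pi(E)\subseteq\overline{E},\quad \pi(F)\subseteq\overline{F},\quad \pi(K^{\pm1})\subseteq\overline{K^{\pm1}}$$ and $\pi(x)=x$ (restricted to $\mathcal{D}$) for $x\in\mathcal{O}(SU_q(2))$. The closure of this representation $\pi$ is unitarily equivalent to the Heisenberg representation $\pi_h$ of $\mathcal{U}_q(su_2)\ltimes\mathcal{O}(SU_q(2))$.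
   Context: Fix $0<q<1$, $\lambda=q-q^{-1}$, $\lambda_n=(1-q^{2n})^{1/2}$. **Algebras.** $\mathcal{U}_q(su_2)$ is the Hopf $*$-algebra with generators $E,F,K,K^{-1}$ and relations $KK^{-1}=K^{-1}K=1$, $KEK^{-1}=qE$, $KFK^{-1}=q^{-1}F$, $EF-FE=\lambda^{-1}(K^2-K^{-2})$; $\Delta(E)=E\otimes K+K^{-1}\otimes E$, $\Delta(F)=F\otimes K+K^{-1}\otimes F$, $\Delta(K)=K\otimes K$; $\varepsilon(E)=\varepsilon(F)=0$, $\varepsilon(K)=1$; $S(E)=-qE$, $S(F)=-q^{-1}F$, $S(K)=K^{-1}$; $E^*=F$, $K^*=K$. $\mathcal{O}(SU_q(2))$ is the unital $*$-algebra with generators $a,b,c,d$, relations $ab=qba$, $ac=qca$, $bd=qdb$, $cd=qdc$, $bc=cb$, $ad-da=\lambda bc$, $ad-qbc=1$, and involution $a^*=d$, $b^*=-qc$. $\mathcal{A}=\mathcal{O}(SU_q(2))$ is a right $\mathcal{U}$-module $*$-algebra: the right action $\triangleleft$ satisfies $(xy)\triangleleft f=(x\triangleleft f_{(1)})(y\triangleleft f_{(2)})$ and $1\triangleleft f=\varepsilon(f)1$, and is determined by $a\triangleleft E=b\triangleleft E=0$, $c\triangleleft E=a$, $d\triangleleft E=b$; $a\triangleleft F=c$, $b\triangleleft F=d$, $c\triangleleft F=d\triangleleft F=0$; $a\triangleleft K=q^{-1/2}a$, $b\triangleleft K=q^{-1/2}b$, $c\triangleleft K=q^{1/2}c$, $d\triangleleft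 K=q^{1/2}d$. The right cross product $*$-algebra $\mathcal{U}\ltimes\mathcal{A}$ is the vector space $\mathcal{U}\otimes\mathcal{A}$ with product $(g\otimes x)(f\otimes y)=gf_{(1)}\otimes(x\triangleleft f_{(2)})y$ and involution $(f\otimes x)^*=f^*_{(1)}\otimes(x^*\triangleleft f^*_{(2)})$; it is generated by its $*$-subalgebras $\mathcal{U}$, $\mathcal{A}$ with cross relations $xf=f_{(1)}(x\triangleleft f_{(2)})$. **The representation $(I)_{1,1}$** is given on $\mathcal{D}_0=\mathrm{Lin}\{\eta_{nkl}:n,k\in\mathbb{N}_0,l\in\mathbb{Z}\}$ by (vectors with index $n=-1$ or $k=-1$ are $0$) $$E\eta_{nkl}=q^{-(n-l+1)/2}\lambda_{k+1}\lambda^{-1}\eta_{n,k+1,l}+q^{-(n+2k+l+1)/2}\lambda_n\lambda^{-1}\eta_{n-1,k,l+1},$$ $$F\eta_{nkl}=q^{-(n-l+1)/2}\lambda_k\lambda^{-1}\eta_{n,k-1,l}+q^{-(n+2k+l+1)/2}\lambda_{n+1}\lambda^{-1}\eta_{n+1,k,l-1},$$ $$K\eta_{nkl}=q^{(-n+2k+l)/2}\eta_{nkl},$$ $$a\eta_{nkl}=\lambda_n\eta_{n-1,k,l},\quad d\eta_{nkl}=\lambda_{n+1}\eta_{n+1,k,l},\quad b\eta_{nkl}=q^{n+1}\eta_{n,k,l+1},\quad c\eta_{nkl}=-q^n\eta_{n,k,l-1}.$$ The operators of $\mathcal{O}(SU_q(2))$ are bounded and extended to $\mathcal{H}$; $\overline{T}$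 denotes the closure of $T$. **Representations.** A $*$-representation of a $*$-algebra $\mathcal{X}$ on a dense linear subspace $\mathcal{D}$ of a Hilbert space is a homomorphism $\pi$ into the algebra of linear operators mapping $\mathcal{D}$ into itself with $\langle\pi(x)\eta,\xi\rangle=\langle\eta,\pi(x^* )\xi\rangle$; its closure is $x\mapsto\overline{\pi(x)}$ restricted to $\bigcap_x\mathcal{D}(\overline{\pi(x)})$. **Heisenberg representation.** There is a unique linear functional $h$ on $\mathcal{A}$ with $h(1)=1$ and $h(x\triangleleft f)=\varepsilon(f)h(x)$ for all $x\in\mathcal{A}$, $f\in\mathcal{U}$; it is a state. Let $\pi_h$ be its GNS representation on $\mathcal{D}_h=\pi_h(\mathcal{A})v_h$, $h(x)=\langle\pi_h(x)v_h,v_h\rangle$. There is a well-defined $*$-representation $\tilde\pi_h$ of $\mathcal{U}\ltimes\mathcal{A}$ on $\mathcal{D}_h$ with $\tilde\pi_h(x)=\pi_h(x)$ for $x\in\mathcal{A}$ and $\tilde\pi_h(f)\pi_h(x)v_h=\pi_h(x\triangleleft S^{-1}(f))v_h$ for $f\in\mathcal{U}$. Its closure, again denoted $\pi_h$, is the Heisenberg representation. *)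

(* Defs.v *)
From HB Require Import structures.
From mathcomp Require Import all_boot all_order all_algebra.
From mathcomp Require Import generic_quotient complex.
From mathcomp Require Import all_classical all_reals all_analysis.
From mathcomp Require Import ring.
Set Implicit Arguments.
Unset Strict Implicit.
Unset Printing Implicit Defensive.
Import Order.TTheory GRing.Theory Num.Theory.
Local Open Scope ring_scope.
Local Open Scope quotient_scope.

Inductive fterm (C G : Type) : Type :=
| FGen of G
| FZero
| FOne
| FAdd of fterm C G & fterm C G
| FMul of fterm C G & fterm C G
| FScale of C & fterm C G.
Arguments FGen {C G}.
Arguments FZero {C G}.
Arguments FOne {C G}.

HB.instance Definition _ (C G : Type) := gen_eqMixin (fterm C G).
HB.instance Definition _ (C G : Type) := gen_choiceMixin (fterm C G).

Declare Scope fterm_scope.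
Delimit Scope fterm_scope with F.
Bind Scope fterm_scope with fterm.
Notation "0" := FZero : fterm_scope.
Notation "1" := FOne : fterm_scope.
Notation "s + t" := (FAdd s t) : fterm_scope.
Notation "s * t" := (FMul s t) : fterm_scope.
Notation "c *: t" := (FScale c t) : fterm_scope.

Fixpoint feval (C : pzRingType) (G : Type) (B : algType C) (g : G -> B)
    (t : fterm C G) : B :=
  match t with
  | FGen x => g x
  | FZero => 0
  | FOne => 1
  | FAdd s t => feval g s + feval g t
  | FMul s t => feval g s * feval g t
  | FScale c t => c *: feval g t
  end.

(* [pr_aug] is a character of the presented algebra; it only serves to ensure
   that the quotient is not the zero ring, as required by [algType]. *)
Record presentation (C : comNzRingType) := Presentation {
  pr_gen : Type;
  pr_rel : fterm C pr_gen -> fterm C pr_gen -> Prop;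
  pr_aug : pr_gen -> C;
  pr_augP : forall s t, pr_rel s t ->
    feval (pr_aug : pr_gen -> C^o) s = feval (pr_aug : pr_gen -> C^o) t
}.

Arguments pr_gen {C}.
Arguments pr_rel {C}.
Arguments pr_aug {C}.
Arguments pr_augP {C}.

Section Presented.
Variables (C : comNzRingType) (P : presentation C).
Local Notation G := (pr_gen P).
Local Notation T := (fterm C G).

(* The least congruence that contains the relations and the axioms of unital
   associative C-algebras. *)
Inductive fcong : T -> T -> Prop :=
| fcong_rel s t of pr_rel P s t : fcong s t
| fcong_refl s : fcong s s
| fcong_sym s t of fcong s t : fcong t s
| fcong_trans s t u of fcong s t & fcong t u : fcong s u
| fcong_add s s' t t' of fcong s s' & fcong t t' : fcong (s + t) (s' + t')
| fcong_mul s s' t t' of fcong s s' & fcong t t' : fcong (s * t) (s' * t')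
| fcong_scale c s s' of fcong s s' : fcong (c *: s) (c *: s')
| fcong_addA s t u : fcong (s + (t + u)) ((s + t) + u)
| fcong_addC s t : fcong (s + t) (t + s)
| fcong_add0 s : fcong (0 + s) s
| fcong_addN s : fcong ((-1)%R *: s + s) 0
| fcong_scaleA a b s : fcong (a *: (b *: s)) ((a * b)%R *: s)
| fcong_scale1 s : fcong (1%R *: s) s
| fcong_scaleDr a s t : fcong (a *: (s + t)) (a *: s + a *: t)
| fcong_scaleDl a b s : fcong ((a + b)%R *: s) (a *: s + b *: s)
| fcong_mulA s t u : fcong (s * (t * u)) ((s * t) * u)
| fcong_mul1l s : fcong (1 * s) s
| fcong_mul1r s : fcong (s * 1) s
| fcong_mulDl s t u : fcong ((s + t) * u) (s * u + t * u)
| fcong_mulDr s t u : fcong (s * (t + u)) (s * t + s * u)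
| fcong_scaleAl a s t : fcong (a *: (s * t)) ((a *: s) * t)
| fcong_scaleAr a s t : fcong (a *: (s * t)) (s * (a *: t)).

Lemma fcong_equiv : equiv_class_of (fun s t : T => `[< fcong s t >]).
Proof.
split=> [s|s t|t s u].
- by apply/asboolP; apply: fcong_refl.
- by apply/asboolP/asboolP; apply: fcong_sym.
- by move=> /asboolP st /asboolP tu; apply/asboolP; apply: fcong_trans st tu.
Qed.
Canonical fcong_equivRel := EquivRelPack fcong_equiv.

Definition presAlg : Type := {eq_quot fcong_equivRel}.

HB.instance Definition _ := Choice.on presAlg.
HB.instance Definition _ := EqQuotient.on presAlg.

Definition pcls (t : T) : presAlg := \pi_presAlg t.

Lemma pclsP s t : pcls s = pcls t <-> fcong s t.
Proof. by split=> [/eqmodP/asboolP|st]; [|apply/eqmodP/asboolP]. Qed.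

Lemma pclsK x : pcls (repr x) = x. Proof. exact: reprK. Qed.
Lemma reprcong t : fcong (repr (pcls t)) t. Proof. by apply/pclsP; rewrite pclsK. Qed.
Lemma pclsW (Q : presAlg -> Prop) : (forall t, Q (pcls t)) -> forall x, Q x.
Proof. by move=> H x; rewrite -[x]pclsK. Qed.

Definition padd (x y : presAlg) := pcls (repr x + repr y).
Definition pmul (x y : presAlg) := pcls (repr x * repr y).
Definition pscale c (x : presAlg) := pcls (c *: repr x).

Lemma paddE s t : padd (pcls s) (pcls t) = pcls (s + t).
Proof. by apply/pclsP; apply: fcong_add; apply: reprcong. Qed.
Lemma pmulE s t : pmul (pcls s) (pcls t) = pcls (s * t).
Proof. by apply/pclsP; apply: fcong_mul; apply: reprcong. Qed.
Lemma pscaleE c t : pscale c (pcls t) = pcls (c *: t).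
Proof. by apply/pclsP; apply: fcong_scale; apply: reprcong. Qed.

Lemma presAlg_addA : associative padd.
Proof.
elim/pclsW=> x; elim/pclsW=> y; elim/pclsW=> z.
by rewrite !paddE; apply/pclsP; apply: fcong_addA.
Qed.
Lemma presAlg_addC : commutative padd.
Proof.
by elim/pclsW=> x; elim/pclsW=> y; rewrite !paddE; apply/pclsP; apply: fcong_addC.
Qed.
Lemma presAlg_add0 : left_id (pcls 0) padd.
Proof. by elim/pclsW=> x; rewrite !paddE; apply/pclsP; apply: fcong_add0. Qed.
Lemma presAlg_addN : left_inverse (pcls 0) (pscale (-1)) padd.
Proof.
by elim/pclsW=> x; rewrite pscaleE paddE; apply/pclsP; apply: fcong_addN.
Qed.
HB.instance Definition _ := GRing.isZmodule.Build presAlg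
  presAlg_addA presAlg_addC presAlg_add0 presAlg_addN.

Lemma presAlg_scaleA a b v : pscale a (pscale b v) = pscale (a * b) v.
Proof. by elim/pclsW: v => v; rewrite !pscaleE; apply/pclsP; apply: fcong_scaleA. Qed.
Lemma presAlg_scale1 : left_id 1 pscale.
Proof. by elim/pclsW=> v; rewrite !pscaleE; apply/pclsP; apply: fcong_scale1. Qed.
Lemma presAlg_scaleDr : right_distributive pscale padd.
Proof.
move=> a; elim/pclsW=> x; elim/pclsW=> y.
by rewrite !(pscaleE, paddE); apply/pclsP; apply: fcong_scaleDr.
Qed.
Lemma presAlg_scaleDl v a b : pscale (a + b) v = padd (pscale a v) (pscale b v).
Proof.
elim/pclsW: v => v.
by rewrite !(pscaleE, paddE); apply/pclsP; apply: fcong_scaleDl.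
Qed.
HB.instance Definition _ := GRing.Zmodule_isLmodule.Build C presAlg
  presAlg_scaleA presAlg_scale1 presAlg_scaleDr presAlg_scaleDl.

Lemma presAlg_mulA : associative pmul.
Proof.
elim/pclsW=> x; elim/pclsW=> y; elim/pclsW=> z.
by rewrite !pmulE; apply/pclsP; apply: fcong_mulA.
Qed.
Lemma presAlg_mul1l : left_id (pcls 1) pmul.
Proof. by elim/pclsW=> x; rewrite !pmulE; apply/pclsP; apply: fcong_mul1l. Qed.
Lemma presAlg_mul1r : right_id (pcls 1) pmul.
Proof. by elim/pclsW=> x; rewrite !pmulE; apply/pclsP; apply: fcong_mul1r. Qed.
Lemma presAlg_mulDl : left_distributive pmul padd.
Proof.
elim/pclsW=> x; elim/pclsW=> y; elim/pclsW=> z.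
by rewrite !(paddE, pmulE); apply/pclsP; apply: fcong_mulDl.
Qed.
Lemma presAlg_mulDr : right_distributive pmul padd.
Proof.
elim/pclsW=> x; elim/pclsW=> y; elim/pclsW=> z.
by rewrite !(paddE, pmulE); apply/pclsP; apply: fcong_mulDr.
Qed.

Lemma feval_cong (B : algType C) (g : G -> B) :
  (forall s t, pr_rel P s t -> feval g s = feval g t) ->
  forall s t, fcong s t -> feval g s = feval g t.
Proof.
move=> gP s t; elim=> {s t} //=.
- by move=> s t u _ -> _ ->.
- by move=> s s' t t' _ -> _ ->.
- by move=> s s' t t' _ -> _ ->.
- by move=> c s s' _ ->.
- by move=> *; rewrite addrA.
- by move=> *; rewrite addrC.
- by move=> *; rewrite add0r.
- by move=> *; rewrite scaleN1r addNr.
- by move=> *; rewrite scalerA.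
- by move=> *; rewrite scale1r.
- by move=> *; rewrite scalerDr.
- by move=> *; rewrite scalerDl.
- by move=> *; rewrite mulrA.
- by move=> *; rewrite mul1r.
- by move=> *; rewrite mulr1.
- by move=> *; rewrite mulrDl.
- by move=> *; rewrite mulrDr.
- by move=> *; rewrite scalerAl.
- by move=> *; rewrite scalerAr.
Qed.

Lemma presAlg_1neq0 : pcls 1 != 0 :> presAlg.
Proof.
apply/eqP => /pclsP /(feval_cong (pr_augP P)) /eqP /=.
by rewrite oner_eq0.
Qed.
HB.instance Definition _ := GRing.Zmodule_isNzRing.Build presAlg
  presAlg_mulA presAlg_mul1l presAlg_mul1r presAlg_mulDl presAlg_mulDr
  presAlg_1neq0.

Lemma presAlg_scaleAl a x y : pscale a (pmul x y) = pmul (pscale a x) y.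
Proof.
elim/pclsW: x => x; elim/pclsW: y => y.
by rewrite !(pscaleE, pmulE); apply/pclsP; apply: fcong_scaleAl.
Qed.
HB.instance Definition _ := GRing.Lmodule_isLalgebra.Build C presAlg presAlg_scaleAl.
Lemma presAlg_scaleAr a x y : pscale a (pmul x y) = pmul x (pscale a y).
Proof.
elim/pclsW: x => x; elim/pclsW: y => y.
by rewrite !(pscaleE, pmulE); apply/pclsP; apply: fcong_scaleAr.
Qed.
HB.instance Definition _ := GRing.Lalgebra_isAlgebra.Build C presAlg presAlg_scaleAr.

Definition pgen (x : G) : presAlg := pcls (FGen x).

Lemma pclsD s t : pcls (s + t) = pcls s + pcls t.
Proof. by rewrite -paddE. Qed.
Lemma pclsM s t : pcls (s * t) = pcls s * pcls t.
Proof. by rewrite -pmulE. Qed.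
Lemma pclsZ c t : pcls (c *: t) = c *: pcls t.
Proof. by rewrite -pscaleE. Qed.

Lemma feval_pgen t : feval pgen t = pcls t.
Proof.
elim: t => //= [s -> t ->|s -> t ->|c t ->].
- by rewrite pclsD.
- by rewrite pclsM.
- by rewrite pclsZ.
Qed.

Lemma pgen_rel s t : pr_rel P s t -> feval pgen s = feval pgen t.
Proof. by move=> st; rewrite !feval_pgen; apply/pclsP/fcong_rel. Qed.

Lemma presAlg_ind (Q : presAlg -> Prop) :
  (forall x, Q (pgen x)) -> Q 1 -> (forall x y, Q x -> Q y -> Q (x + y)) ->
  (forall x y, Q x -> Q y -> Q (x * y)) -> (forall c x, Q x -> Q (c *: x)) ->
  forall x, Q x.
Proof.
move=> Qg Q1 QD QM QZ x; rewrite -[x]pclsK -feval_pgen.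
elim: (repr x) => //= [|s Hs t Ht|s Hs t Ht|c t Ht]; [|exact: QD|exact: QM|exact: QZ].
by rewrite -(scale0r 1); apply: QZ.
Qed.

(* The algebra morphism from the presented algebra determined by the images
   [g] of the generators; a morphism when [g] satisfies the relations. *)
Definition plift (B : algType C) (g : G -> B) (x : presAlg) : B :=
  feval g (repr x).

Section Lift.
Variables (B : algType C) (g : G -> B).
Hypothesis gP : forall s t, pr_rel P s t -> feval g s = feval g t.

Lemma plift_cls t : plift g (pcls t) = feval g t.
Proof. by apply: feval_cong => //; apply: reprcong. Qed.
Lemma plift_gen x : plift g (pgen x) = g x.
Proof. by rewrite plift_cls. Qed.
Lemma plift1 : plift g 1 = 1. Proof. exact: (plift_cls 1). Qed.
Lemma pliftD : {morph plift g : x y / x + y}.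
Proof. by elim/pclsW=> x; elim/pclsW=> y; rewrite -pclsD !plift_cls. Qed.
Lemma pliftM : {morph plift g : x y / x * y}.
Proof. by elim/pclsW=> x; elim/pclsW=> y; rewrite -pclsM !plift_cls. Qed.
Lemma pliftZ c : {morph plift g : x / c *: x}.
Proof. by elim/pclsW=> x; rewrite -pclsZ !plift_cls. Qed.

End Lift.
End Presented.
Arguments pgen {C P}.

Section Tensor.
Variables (C : comNzRingType) (V W : lmodType C).

(* The list [:: (v1, w1); ...; (vn, wn)] stands for the sum of the elementary
   tensors of its entries. *)
Inductive tcong : seq (V * W) -> seq (V * W) -> Prop :=
| tcong_refl s : tcong s s
| tcong_sym s t of tcong s t : tcong t s
| tcong_trans s t u of tcong s t & tcong t u : tcong s u
| tcong_cat s s' t t' of tcong s s' & tcong t t' : tcong (s ++ t) (s' ++ t')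
| tcong_catC s t : tcong (s ++ t) (t ++ s)
| tcong_addl v v' w : tcong [:: (v + v', w)] [:: (v, w); (v', w)]
| tcong_addr v w w' : tcong [:: (v, w + w')] [:: (v, w); (v, w')]
| tcong_mid c v w : tcong [:: (c *: v, w)] [:: (v, c *: w)]
| tcong_0 w : tcong [:: (0, w)] [::].

Lemma tcong_equiv : equiv_class_of (fun s t : seq (V * W) => `[< tcong s t >]).
Proof.
split=> [s|s t|t s u].
- by apply/asboolP; apply: tcong_refl.
- by apply/asboolP/asboolP; apply: tcong_sym.
- by move=> /asboolP st /asboolP tu; apply/asboolP; apply: tcong_trans st tu.
Qed.
Canonical tcong_equivRel := EquivRelPack tcong_equiv.

Definition tensor : Type := {eq_quot tcong_equivRel}.
HB.instance Definition _ := Choice.on tensor.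
HB.instance Definition _ := EqQuotient.on tensor.

Definition tcls (s : seq (V * W)) : tensor := \pi_tensor s.
(* A decomposition of a tensor as a sum of elementary tensors. *)
Definition tseq (t : tensor) : seq (V * W) := repr t.
Definition pure (v : V) (w : W) : tensor := tcls [:: (v, w)].

Lemma tclsP s t : tcls s = tcls t <-> tcong s t.
Proof. by split=> [/eqmodP/asboolP|st]; [|apply/eqmodP/asboolP]. Qed.
Lemma tclsK x : tcls (tseq x) = x. Proof. exact: reprK. Qed.
Lemma tseqcong s : tcong (tseq (tcls s)) s. Proof. by apply/tclsP; rewrite tclsK. Qed.
Lemma tclsW (Q : tensor -> Prop) : (forall t, Q (tcls t)) -> forall x, Q x.
Proof. by move=> H x; rewrite -[x]tclsK. Qed.

Definition zmap c (s : seq (V * W)) := [seq (c *: p.1, p.2) | p <- s].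

Lemma zmap_cong c s t : tcong s t -> tcong (zmap c s) (zmap c t).
Proof.
rewrite /zmap; elim=> {s t}.
- by move=> *; apply: tcong_refl.
- by move=> *; apply: tcong_sym.
- by move=> s t u _ st _ tu; apply: tcong_trans st tu.
- by move=> *; rewrite !map_cat; apply: tcong_cat.
- by move=> *; rewrite !map_cat; apply: tcong_catC.
- by move=> v v' w /=; rewrite scalerDr; apply: tcong_addl.
- by move=> v v' w /=; apply: tcong_addr.
- by move=> a v w /=; rewrite scalerA mulrC -scalerA; apply: tcong_mid.
- by move=> w /=; rewrite scaler0; apply: tcong_0.
Qed.

Definition tadd x y := tcls (tseq x ++ tseq y).
Definition tscale c x := tcls (zmap c (tseq x)).

Lemma taddE s t : tadd (tcls s) (tcls t) = tcls (s ++ t).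
Proof. by apply/tclsP; apply: tcong_cat; apply: tseqcong. Qed.
Lemma tscaleE c s : tscale c (tcls s) = tcls (zmap c s).
Proof. by apply/tclsP; apply: zmap_cong; apply: tseqcong. Qed.

Lemma tensor_addA : associative tadd.
Proof.
by elim/tclsW=> x; elim/tclsW=> y; elim/tclsW=> z; rewrite !taddE catA.
Qed.
Lemma tensor_addC : commutative tadd.
Proof.
by elim/tclsW=> x; elim/tclsW=> y; rewrite !taddE; apply/tclsP/tcong_catC.
Qed.
Lemma tensor_add0 : left_id (tcls [::]) tadd.
Proof. by elim/tclsW=> x; rewrite taddE. Qed.
Lemma tcons p s : tcls (p :: s) = tadd (tcls [:: p]) (tcls s).
Proof. by rewrite taddE. Qed.
Lemma tensor_scaleDl x a b : tscale (a + b) x = tadd (tscale a x) (tscale b x).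
Proof.
elim/tclsW: x => x; rewrite !tscaleE.
elim: x => [|[v w] x IH] /=; first by rewrite taddE.
rewrite tcons IH ![tcls (_ :: zmap _ _)]tcons scalerDl.
have -> : tcls [:: (a *: v + b *: v, w)] =
    tadd (tcls [:: (a *: v, w)]) (tcls [:: (b *: v, w)]).
  by rewrite taddE; apply/tclsP/tcong_addl.
by rewrite !tensor_addA; congr tadd; rewrite -!tensor_addA; congr tadd;
   exact: tensor_addC.
Qed.
Lemma tensor_scale0 x : tscale 0 x = tcls [::].
Proof.
elim/tclsW: x => x; rewrite tscaleE.
elim: x => [|[v w] x IH] //=.
by rewrite tcons IH tensor_addC tensor_add0 scale0r; apply/tclsP/tcong_0.
Qed.
Lemma tensor_scale1 : left_id 1 tscale.
Proof.
elim/tclsW=> x; rewrite tscaleE; congr tcls.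
by rewrite /zmap -[RHS]map_id; apply: eq_map => -[v w]; rewrite scale1r.
Qed.
Lemma tensor_addN : left_inverse (tcls [::]) (tscale (-1)) tadd.
Proof.
by move=> x; rewrite -[X in tadd _ X]tensor_scale1 -tensor_scaleDl addNr tensor_scale0.
Qed.
HB.instance Definition _ := GRing.isZmodule.Build tensor
  tensor_addA tensor_addC tensor_add0 tensor_addN.

Lemma tensor_scaleA a b v : tscale a (tscale b v) = tscale (a * b) v.
Proof.
elim/tclsW: v => v; rewrite !tscaleE /zmap -map_comp; congr tcls.
by apply: eq_map => -[x w] /=; rewrite scalerA.
Qed.
Lemma tensor_scaleDr : right_distributive tscale tadd.
Proof.
by move=> a; elim/tclsW=> x; elim/tclsW=> y; rewrite !(tscaleE,taddE) /zmap map_cat.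
Qed.
HB.instance Definition _ := GRing.Zmodule_isLmodule.Build C tensor
  tensor_scaleA tensor_scale1 tensor_scaleDr (fun v a b => tensor_scaleDl v a b).

Lemma pureDl v v' w : pure (v + v') w = pure v w + pure v' w.
Proof. by rewrite [RHS]taddE; apply/tclsP/tcong_addl. Qed.
Lemma pureDr v w w' : pure v (w + w') = pure v w + pure v w'.
Proof. by rewrite [RHS]taddE; apply/tclsP/tcong_addr. Qed.
Lemma pureZl c v w : pure (c *: v) w = c *: pure v w.
Proof. by rewrite [RHS]tscaleE. Qed.
Lemma pureZr c v w : pure v (c *: w) = c *: pure v w.
Proof. by rewrite -pureZl; apply/tclsP/tcong_sym/tcong_mid. Qed.

Lemma pureBl v v' w : pure (v - v') w = pure v w - pure v' w.
Proof. by rewrite pureDl -scaleN1r pureZl scaleN1r. Qed.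
Lemma pureBr v w w' : pure v (w - w') = pure v w - pure v w'.
Proof. by rewrite pureDr -scaleN1r pureZr scaleN1r. Qed.

Lemma pure0r v : pure v 0 = 0.
Proof. by rewrite -[X in pure v X](scale0r 0) pureZr scale0r. Qed.

Lemma tclsE s : tcls s = \sum_(p <- s) pure p.1 p.2.
Proof.
elim: s => [|[v w] s IH]; first by rewrite big_nil.
by rewrite big_cons -IH tcons.
Qed.
Lemma tseqE t : t = \sum_(p <- tseq t) pure p.1 p.2.
Proof. by rewrite -tclsE tclsK. Qed.

Lemma tensor_ind (Q : tensor -> Prop) :
  (forall v w, Q (pure v w)) -> Q 0 -> (forall x y, Q x -> Q y -> Q (x + y)) ->
  forall x, Q x.
Proof.
move=> Qp Q0 QD x; rewrite [x]tseqE; elim: (tseq x) => [|p s IH].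
  by rewrite big_nil.
by rewrite big_cons; apply: QD.
Qed.

(* Sweedler-type sums: the value at [t] of the map induced by [b]. *)
Definition tlift (Z : zmodType) (b : V -> W -> Z) (t : tensor) : Z :=
  \sum_(p <- tseq t) b p.1 p.2.

Record balanced (Z : zmodType) (b : V -> W -> Z) : Prop := Balanced {
  bal_Dl : forall v v' w, b (v + v') w = b v w + b v' w;
  bal_Dr : forall v w w', b v (w + w') = b v w + b v w';
  bal_Z : forall c v w, b (c *: v) w = b v (c *: w) }.

Section Lift.
Variables (Z : zmodType) (b : V -> W -> Z).
Hypothesis bP : balanced b.

Lemma bal_0l w : b 0 w = 0.
Proof. by apply: (addrI (b 0 w)); rewrite -(bal_Dl bP) !addr0. Qed.

Lemma tlift_cls s : tlift b (tcls s) = \sum_(p <- s) b p.1 p.2.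
Proof.
have := tseqcong s; rewrite /tlift; move: (tseq _) => t.
elim=> {s t} //.
- by move=> s t u _ -> _ ->.
- by move=> s s' t t' _ ss' _ tt'; rewrite !big_cat /= ss' tt'.
- by move=> s t; rewrite !big_cat /= addrC.
- by move=> v v' w; rewrite !big_cons !big_nil /= (bal_Dl bP) !addr0.
- by move=> v w w'; rewrite !big_cons !big_nil /= (bal_Dr bP) !addr0.
- by move=> c v w; rewrite !big_cons !big_nil /= (bal_Z bP).
- by move=> w; rewrite !big_cons !big_nil /= bal_0l addr0.
Qed.
Lemma tlift_pure v w : tlift b (pure v w) = b v w.
Proof. by rewrite tlift_cls big_cons big_nil addr0. Qed.
Lemma tlift0 : tlift b 0 = 0.
Proof. by rewrite (tlift_cls [::]) big_nil. Qed.
Lemma tliftD x y : tlift b (x + y) = tlift b x + tlift b y.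
Proof.
elim/tclsW: x => x; elim/tclsW: y => y.
have -> : tcls x + tcls y = tcls (x ++ y) by rewrite -taddE.
by rewrite !tlift_cls big_cat.
Qed.
End Lift.

Lemma tliftZ (Z : lmodType C) (b : V -> W -> Z) (c : C) x : balanced b ->
  (forall v w, b (c *: v) w = c *: b v w) -> tlift b (c *: x) = c *: tlift b x.
Proof.
move=> bP bZ; elim/tclsW: x => x.
have -> : c *: tcls x = tcls (zmap c x) by rewrite -tscaleE.
rewrite !tlift_cls // big_map scaler_sumr.
by apply: eq_bigr => p _ /=; rewrite bZ.
Qed.

End Tensor.

(* Bilinear products on a tensor product:
   (v (x) w)(v' (x) w') = m v w v' w'. *)
Section TensorMul.
Variables (C : comNzRingType) (V W : lmodType C).
Variable m : V -> W -> V -> W -> tensor V W.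

Definition tmul (x y : tensor V W) : tensor V W :=
  tlift (fun v w => tlift (m v w) y) x.

Hypothesis mP : forall v w, balanced (m v w).
Hypothesis mP' : forall v' w', balanced (fun v w => m v w v' w').
Hypothesis mZ : forall c v w v' w', m v w (c *: v') w' = c *: m v w v' w'.
Hypothesis mZ' : forall c v w v' w', m (c *: v) w v' w' = c *: m v w v' w'.

Lemma tmul_bal y : balanced (fun v w => tlift (m v w) y).
Proof.
split=> *.
- rewrite -big_split /=; apply: eq_bigr => p _; exact: (bal_Dl (mP' _ _)).
- rewrite -big_split /=; apply: eq_bigr => p _; exact: (bal_Dr (mP' _ _)).
- apply: eq_bigr => p _; exact: (bal_Z (mP' _ _)).
Qed.

Lemma tmul_pure v w v' w' : tmul (pure v w) (pure v' w') = m v w v' w'.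
Proof. by rewrite /tmul tlift_pure ?tlift_pure//; apply: tmul_bal. Qed.
Lemma tmul_purel v w y : tmul (pure v w) y = tlift (m v w) y.
Proof. by rewrite /tmul tlift_pure //; apply: tmul_bal. Qed.
Lemma tmulDl x y z : tmul (x + y) z = tmul x z + tmul y z.
Proof. by rewrite /tmul tliftD //; apply: tmul_bal. Qed.
Lemma tmulDr x y z : tmul x (y + z) = tmul x y + tmul x z.
Proof.
by rewrite /tmul -big_split /=; apply: eq_bigr => p _; apply: tliftD.
Qed.
Lemma tmul0l x : tmul 0 x = 0.
Proof. by rewrite /tmul tlift0 //; apply: tmul_bal. Qed.
Lemma tmul0r x : tmul x 0 = 0.
Proof. by apply: (addrI (tmul x 0)); rewrite -tmulDr !addr0. Qed.
Lemma tmulZl c x y : tmul (c *: x) y = c *: tmul x y.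
Proof.
rewrite /tmul tliftZ //; first exact: tmul_bal.
by move=> v w; rewrite /tlift scaler_sumr; apply: eq_bigr => p _.
Qed.
Lemma tmulZr c x y : tmul x (c *: y) = c *: tmul x y.
Proof.
rewrite /tmul {2}/tlift scaler_sumr; apply: eq_bigr => p _.
exact: tliftZ.
Qed.
End TensorMul.

Section TensorAlgebra.
Variables (C : comNzRingType) (P Q : presentation C).
Local Notation B := (presAlg P).
Local Notation D := (presAlg Q).

Definition tensAlg : Type := tensor B D.
HB.instance Definition _ := GRing.Lmodule.on tensAlg.

Definition tensm (b : B) (d : D) (b' : B) (d' : D) : tensor B D :=
  pure (b * b') (d * d').
Definition tensMul : tensAlg -> tensAlg -> tensAlg := tmul tensm.

Lemma tensm_bal b d : balanced (tensm b d).
Proof.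
split=> *; rewrite /tensm ?mulrDr ?pureDl ?pureDr //.
by rewrite -!scalerAr pureZl pureZr.
Qed.
Lemma tensm_bal' b' d' : balanced (fun b d => tensm b d b' d').
Proof.
split=> *; rewrite /tensm ?mulrDl ?pureDl ?pureDr //.
by rewrite -!scalerAl pureZl pureZr.
Qed.
Lemma tensmZ c b d b' d' : tensm b d (c *: b') d' = c *: tensm b d b' d'.
Proof. by rewrite /tensm -scalerAr pureZl. Qed.
Lemma tensmZ' c b d b' d' : tensm (c *: b) d b' d' = c *: tensm b d b' d'.
Proof. by rewrite /tensm -scalerAl pureZl. Qed.

Lemma tensMul_pure b d b' d' :
  tensMul (pure b d) (pure b' d') = pure (b * b') (d * d').
Proof. by rewrite /tensMul tmul_pure//; [exact: tensm_bal|exact: tensm_bal']. Qed.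
Lemma tensMulDl : left_distributive tensMul +%R.
Proof. by move=> x y z; apply: tmulDl; exact: tensm_bal'. Qed.
Lemma tensMulDr : right_distributive tensMul +%R.
Proof. by move=> x y z; apply: tmulDr; exact: tensm_bal. Qed.
Lemma tensMul0l x : tensMul 0 x = 0.
Proof. by apply: tmul0l; exact: tensm_bal'. Qed.
Lemma tensMul0r x : tensMul x 0 = 0.
Proof. by apply: tmul0r; exact: tensm_bal. Qed.

Lemma tensMulA : associative tensMul.
Proof.
move=> x y z.
elim/tensor_ind: x => [b d||x x' Hx Hx']; last 2 first.
- by rewrite !tensMul0l.
- by rewrite !tensMulDl Hx Hx'.
elim/tensor_ind: y => [b' d'||x x' Hx Hx']; last 2 first.
- by rewrite tensMul0l !tensMul0r tensMul0l.
- by rewrite !tensMulDl !tensMulDr tensMulDl Hx Hx'.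
elim/tensor_ind: z => [b'' d''||x x' Hx Hx']; last 2 first.
- by rewrite !tensMul0r.
- by rewrite !tensMulDr Hx Hx'.
by rewrite !tensMul_pure !mulrA.
Qed.
Lemma tensMul1l : left_id (pure 1 1) tensMul.
Proof.
elim/tensor_ind=> [b d||x y Hx Hy]; first by rewrite tensMul_pure !mul1r.
  exact: tensMul0r.
by rewrite tensMulDr Hx Hy.
Qed.
Lemma tensMul1r : right_id (pure 1 1) tensMul.
Proof.
elim/tensor_ind=> [b d||x y Hx Hy]; first by rewrite tensMul_pure !mulr1.
  exact: tensMul0l.
by rewrite tensMulDl Hx Hy.
Qed.

Lemma pure11_neq0 : pure 1 1 != 0 :> tensor B D.
Proof.
pose f := plift (pr_aug P : _ -> C^o); pose g := plift (pr_aug Q : _ -> C^o).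
have fP := pr_augP P; have gP := pr_augP Q.
have fgP : balanced (fun b d => f b * g d : C^o).
  split=> *; rewrite /f /g ?pliftD ?mulrDl ?mulrDr //.
  by rewrite !pliftZ // -scalerAl -scalerAr.
apply/eqP => /(congr1 (tlift (fun b d => f b * g d : C^o))).
rewrite tlift_pure // tlift0 // /f /g !plift1 // mulr1.
by apply/eqP/oner_neq0.
Qed.

HB.instance Definition _ := GRing.Zmodule_isNzRing.Build tensAlg
  tensMulA tensMul1l tensMul1r tensMulDl tensMulDr pure11_neq0.
Lemma tensMulZl a (x y : tensAlg) : a *: (x * y) = a *: x * y.
Proof. by symmetry; apply: tmulZl; [exact: tensm_bal'|exact: tensmZ']. Qed.
HB.instance Definition _ := GRing.Lmodule_isLalgebra.Build C tensAlg tensMulZl.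
Lemma tensMulZr a (x y : tensAlg) : a *: (x * y) = x * (a *: y).
Proof. by symmetry; apply: tmulZr; [exact: tensm_bal|exact: tensmZ]. Qed.
HB.instance Definition _ := GRing.Lalgebra_isAlgebra.Build C tensAlg tensMulZr.

Definition tpure (b : B) (d : D) : tensAlg := pure b d.
Lemma tpureM b d b' d' : tpure b d * tpure b' d' = tpure (b * b') (d * d').
Proof. exact: tensMul_pure. Qed.
End TensorAlgebra.

Section Twop.
Variables (C : comNzRingType) (sigma : {rmorphism C -> C}) (B : algType C).

Definition twop : Type := let _ := sigma in B.
HB.instance Definition _ := GRing.NzRing.copy twop B^c.

Definition twscale (c : C) (x : twop) : twop := sigma c *: (x : B).
Lemma twscaleA a b v : twscale a (twscale b v) = twscale (a * b) v.
Proof. by rewrite /twscale scalerA rmorphM. Qed.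
Lemma twscale1 : left_id 1 twscale.
Proof. by move=> v; rewrite /twscale rmorph1 scale1r. Qed.
Lemma twscaleDr : right_distributive twscale +%R.
Proof. by move=> a x y; apply: scalerDr. Qed.
Lemma twscaleDl v : {morph twscale^~ v : a b / a + b}.
Proof. by move=> a b; rewrite /twscale rmorphD; apply: scalerDl. Qed.
HB.instance Definition _ := GRing.Zmodule_isLmodule.Build C twop
  twscaleA twscale1 twscaleDr twscaleDl.
Lemma twscaleAl a (x y : twop) : a *: (x * y) = a *: x * y.
Proof. exact: (@scalerAr _ B). Qed.
HB.instance Definition _ := GRing.Lmodule_isLalgebra.Build C twop twscaleAl.
Lemma twscaleAr a (x y : twop) : a *: (x * y) = x * (a *: y).
Proof. exact: (@scalerAl _ B). Qed.
HB.instance Definition _ := GRing.Lalgebra_isAlgebra.Build C twop twscaleAr.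
End Twop.

Section Endo.
Variables (C : comNzRingType) (V : lmodType C) (v0 : V) (v0P : v0 != 0).

Record endo := Endo { efun :> V -> V; efunP : linear efun }.

Lemma endoP (f g : endo) : efun f =1 efun g -> f = g.
Proof.
case: f g => [f fP] [g gP] /= /funext fg; case: g / fg in gP *.
by congr Endo; apply: Prop_irrelevance.
Qed.
Lemma efunD (f : endo) x y : f (x + y) = f x + f y.
Proof. by rewrite -[x]scale1r (efunP f) !scale1r. Qed.
Lemma efun0 (f : endo) : f 0 = 0.
Proof. by apply: (addrI (f 0)); rewrite -efunD !addr0. Qed.
Lemma efunZ (f : endo) c x : f (c *: x) = c *: f x.
Proof. by rewrite -[c *: x]addr0 (efunP f) efun0 addr0. Qed.

HB.instance Definition _ := gen_eqMixin endo.
HB.instance Definition _ := gen_choiceMixin endo.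

Fact eadd_subproof (f g : endo) : linear (fun x => f x + g x).
Proof. by move=> a x y; rewrite !efunP scalerDr addrACA. Qed.
Definition eadd f g := Endo (eadd_subproof f g).
Fact ezero_subproof : linear (fun _ : V => 0 : V).
Proof. by move=> a x y; rewrite scaler0 addr0. Qed.
Definition ezero := Endo ezero_subproof.
Fact escale_subproof c (f : endo) : linear (fun x => c *: f x).
Proof. by move=> a x y; rewrite efunP scalerDr !scalerA mulrC. Qed.
Definition escale c f := Endo (escale_subproof c f).
Fact ecomp_subproof (f g : endo) : linear (fun x => f (g x)).
Proof. by move=> a x y; rewrite !efunP. Qed.
Definition ecomp f g := Endo (ecomp_subproof f g).
Fact eone_subproof : linear (fun x : V => x).
Proof. by []. Qed.
Definition eone := Endo eone_subproof.

Lemma eaddA : associative eadd.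
Proof. by move=> f g h; apply: endoP => x /=; rewrite addrA. Qed.
Lemma eaddC : commutative eadd.
Proof. by move=> f g; apply: endoP => x /=; rewrite addrC. Qed.
Lemma eadd0 : left_id ezero eadd.
Proof. by move=> f; apply: endoP => x /=; rewrite add0r. Qed.
Lemma eaddN : left_inverse ezero (escale (-1)) eadd.
Proof. by move=> f; apply: endoP => x /=; rewrite scaleN1r addNr. Qed.
HB.instance Definition _ := GRing.isZmodule.Build endo eaddA eaddC eadd0 eaddN.

Lemma escaleA a b v : escale a (escale b v) = escale (a * b) v.
Proof. by apply: endoP => x /=; rewrite scalerA. Qed.
Lemma escale1 : left_id 1 escale.
Proof. by move=> v; apply: endoP => x /=; rewrite scale1r. Qed.
Lemma escaleDr : right_distributive escale +%R.
Proof. by move=> a f g; apply: endoP => x /=; rewrite scalerDr. Qed.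
Lemma escaleDl v : {morph escale^~ v : a b / a + b}.
Proof. by move=> a b; apply: endoP => x /=; rewrite scalerDl. Qed.
HB.instance Definition _ := GRing.Zmodule_isLmodule.Build C endo
  escaleA escale1 escaleDr escaleDl.

Definition endoAlg : Type := let _ := v0P in endo.
HB.instance Definition _ := GRing.Lmodule.copy endoAlg endo.

Lemma ecompA : associative ecomp. Proof. by move=> f g h; apply: endoP. Qed.
Lemma ecomp1l : left_id eone ecomp. Proof. by move=> f; apply: endoP. Qed.
Lemma ecomp1r : right_id eone ecomp. Proof. by move=> f; apply: endoP. Qed.
Lemma ecompDl : left_distributive ecomp eadd.
Proof. by move=> f g h; apply: endoP. Qed.
Lemma ecompDr : right_distributive ecomp eadd.
Proof. by move=> f g h; apply: endoP => x /=; rewrite efunD. Qed.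
Lemma eone_neq0 : eone != ezero.
Proof.
by apply/eqP => /(congr1 (fun f : endo => f v0)) /= /eqP; rewrite (negPf v0P).
Qed.
HB.instance Definition _ := GRing.Zmodule_isNzRing.Build endoAlg
  ecompA ecomp1l ecomp1r ecompDl ecompDr eone_neq0.
Lemma ecompZl a (x y : endoAlg) : a *: (x * y) = a *: x * y.
Proof. exact: endoP. Qed.
HB.instance Definition _ := GRing.Lmodule_isLalgebra.Build C endoAlg ecompZl.
Lemma ecompZr a (x y : endoAlg) : a *: (x * y) = x * (a *: y).
Proof. by apply: endoP => v; apply/esym; apply: (efunZ x). Qed.
HB.instance Definition _ := GRing.Lalgebra_isAlgebra.Build C endoAlg ecompZr.
End Endo.

HB.mixin Record Algebra_isStar (C : numClosedFieldType) B of GRing.Algebra C B := {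
  star : B -> B;
  starK : involutive star;
  starD : {morph star : x y / x + y};
  starZ : forall c x, star (c *: x) = c^* *: star x;
  starM : forall x y, star (x * y) = star y * star x
}.
#[short(type="starAlgType")]
HB.structure Definition StarAlgebra (C : numClosedFieldType) :=
  {B of GRing.Algebra C B & Algebra_isStar C B}.

Record qparam (R : rcfType) := QParam {
  qval :> R;
  qval_gt0 : 0 < qval;
  qval_lt1 : qval < 1
}.

Fact sum4B (V : zmodType) (x1 x2 y1 y2 z t : V) :
  (x1 + z) + (t + x2) - ((y1 + t) + (z + y2)) = (x1 - y1) + (x2 - y2).
Proof.
rewrite -{1}[x1](subrK y1) -{1}[x2](subrK y2).
move: (x1 - y1) (x2 - y2) => u v.
apply/eqP; rewrite subr_eq; apply/eqP.
by rewrite !addrA [LHS](ACl (1*5*2*4*3*6)).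
Qed.

Section Constants.
Variables (R : rcfType) (q : qparam R).
Local Notation C := R[i].

Definition qC : C := (qval q)%:C%C.
Definition qhalf : C := (Num.sqrt (qval q))%:C%C.
Definition lam : C := qC - qC^-1.

Lemma qhalf2 : qhalf * qhalf = qC.
Proof. by rewrite /qhalf /qC -rmorphM -expr2 sqr_sqrtr // ltW // qval_gt0. Qed.
Lemma qC_neq0 : qC != 0.
Proof. by rewrite /qC fmorph_eq0 gt_eqF // qval_gt0. Qed.
Lemma qhalf_neq0 : qhalf != 0.
Proof. by rewrite /qhalf fmorph_eq0 gt_eqF // sqrtr_gt0 qval_gt0. Qed.
Lemma lam_neq0 : lam != 0.
Proof.
rewrite /lam subr_eq0; apply/eqP => /(congr1 ( *%R^~ qC)).
rewrite mulVf ?qC_neq0 // -expr2 /qC -rmorphXn -(rmorph1 (real_complex R)).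
move=> /complexI q2; have := exprn_ilt1 2 (ltW (qval_gt0 q)) (qval_lt1 q).
by rewrite q2 ltxx.
Qed.
Lemma real_conj (x : R) : (x%:C%C : C)^* = x%:C%C.
Proof. by apply/eqP; rewrite eq_complex /= oppr0 !eqxx. Qed.
Lemma qC_conj : qC^* = qC. Proof. exact: real_conj. Qed.
Lemma qhalf_conj : qhalf^* = qhalf. Proof. exact: real_conj. Qed.
Lemma conjVC (x : C) : (x^-1)^* = (x^*)^-1. Proof. exact: fmorphV. Qed.
Lemma lam_conj : lam^* = lam.
Proof.
have E : (qC - qC^-1)^* = qC^* - (qC^*)^-1.
  by rewrite -conjVC; exact: rmorphB.
by rewrite /lam E qC_conj.
Qed.
End Constants.

Variant Ugen := gE | gF | gK | gKi.

Section Uq.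
Variables (R : rcfType) (q : qparam R).
Local Notation C := R[i].
Local Notation qC := (qC q).
Local Notation lam := (lam q).

Section Relations.
Local Open Scope fterm_scope.
Local Notation "s - t" := (s + (-1)%R *: t)%F.
Local Notation E := (FGen gE).
Local Notation F := (FGen gF).
Local Notation K := (FGen gK).
Local Notation Ki := (FGen gKi).

Variant Uq_rel : fterm C Ugen -> fterm C Ugen -> Prop :=
| Uq_KKi : Uq_rel (K * Ki) 1
| Uq_KiK : Uq_rel (Ki * K) 1
| Uq_KE : Uq_rel (K * E * Ki) (qC *: E)
| Uq_KF : Uq_rel (K * F * Ki) ((qC^-1)%R *: F)
| Uq_EF : Uq_rel (E * F - F * E) ((lam^-1)%R *: (K * K - Ki * Ki)).
End Relations.

Record isUq (B : algType C) (e f k l : B) : Prop := IsUq {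
  isUq_kl : k * l = 1;
  isUq_lk : l * k = 1;
  isUq_ke : k * e * l = qC *: e;
  isUq_kf : k * f * l = qC^-1 *: f;
  isUq_ef : e * f - f * e = lam^-1 *: (k * k - l * l) }.

Definition ufun (B : Type) (e f k l : B) (g : Ugen) : B :=
  match g with gE => e | gF => f | gK => k | gKi => l end.

Lemma ufunP (B : algType C) (e f k l : B) : isUq e f k l ->
  forall s t, Uq_rel s t -> feval (ufun e f k l) s = feval (ufun e f k l) t.
Proof. by case=> h1 h2 h3 h4 h5 s t [] //=; rewrite !scaleN1r. Qed.

Definition ueps : Ugen -> C := ufun 0 0 1 1.

Lemma isUq_eps : isUq (0 : C^o) 0 1 1.
Proof. by split; rewrite ?(mul1r, mulr1, mul0r, mulr0, subrr, scaler0). Qed.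

Definition Uq_pres : presentation C :=
  Presentation (pr_aug := ueps) (ufunP isUq_eps).

Definition Uq : Type := presAlg Uq_pres.
HB.instance Definition _ := GRing.Algebra.on Uq.

Definition uE : Uq := pgen (gE : pr_gen Uq_pres).
Definition uF : Uq := pgen (gF : pr_gen Uq_pres).
Definition uK : Uq := pgen (gK : pr_gen Uq_pres).
Definition uKi : Uq := pgen (gKi : pr_gen Uq_pres).

Lemma uP : isUq uE uF uK uKi.
Proof.
have H s t : Uq_rel s t -> feval (@pgen _ Uq_pres) s = feval (@pgen _ Uq_pres) t.
  exact: (@pgen_rel _ Uq_pres).
split.
- exact: (H _ _ Uq_KKi).
- exact: (H _ _ Uq_KiK).
- exact: (H _ _ Uq_KE).
- exact: (H _ _ Uq_KF).
- by have := H _ _ Uq_EF; rewrite /= !scaleN1r.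
Qed.

Section Commutation.
Variables (B : algType C) (e f k l : B).
Hypothesis h : isUq e f k l.
Lemma isUq_KE : k * e = qC *: (e * k).
Proof. by rewrite scalerAl -(isUq_ke h) -[_ * l * k]mulrA (isUq_lk h) mulr1. Qed.
Lemma isUq_KF : k * f = qC^-1 *: (f * k).
Proof. by rewrite scalerAl -(isUq_kf h) -[_ * l * k]mulrA (isUq_lk h) mulr1. Qed.
Lemma isUq_EL : e * l = qC *: (l * e).
Proof.
by rewrite scalerAr -(isUq_ke h) !mulrA (isUq_lk h) mul1r.
Qed.
Lemma isUq_FL : f * l = qC^-1 *: (l * f).
Proof. by rewrite scalerAr -(isUq_kf h) !mulrA (isUq_lk h) mul1r. Qed.
End Commutation.

Lemma Uq_ind (Q : Uq -> Prop) :
  Q uE -> Q uF -> Q uK -> Q uKi -> Q 1 ->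
  (forall x y, Q x -> Q y -> Q (x + y)) ->
  (forall x y, Q x -> Q y -> Q (x * y)) -> (forall c x, Q x -> Q (c *: x)) ->
  forall x, Q x.
Proof. by move=> QE QF QK QKi *; apply: presAlg_ind => //; case. Qed.

(* The algebra morphism of U_q(su_2) given by the images of E, F, K, K^-1. *)
Definition ulift (B : algType C) (e f k l : B) : Uq -> B :=
  @plift _ Uq_pres B (ufun e f k l).

Section Ulift.
Variables (B : algType C) (e f k l : B).
Hypothesis h : isUq e f k l.
Local Notation phi := (ulift e f k l).
Lemma uliftE : phi uE = e. Proof. exact: (@plift_gen _ Uq_pres _ _ (ufunP h) gE). Qed.
Lemma uliftF : phi uF = f. Proof. exact: (@plift_gen _ Uq_pres _ _ (ufunP h) gF). Qed.
Lemma uliftK : phi uK = k. Proof. exact: (@plift_gen _ Uq_pres _ _ (ufunP h) gK). Qed.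
Lemma uliftKi : phi uKi = l. Proof. exact: (@plift_gen _ Uq_pres _ _ (ufunP h) gKi). Qed.
Lemma ulift1 : phi 1 = 1. Proof. exact: (@plift1 _ Uq_pres _ _ (ufunP h)). Qed.
Lemma uliftD : {morph phi : x y / x + y}. Proof. exact: (@pliftD _ Uq_pres _ _ (ufunP h)). Qed.
Lemma uliftM : {morph phi : x y / x * y}. Proof. exact: (@pliftM _ Uq_pres _ _ (ufunP h)). Qed.
Lemma uliftZ c : {morph phi : x / c *: x}. Proof. exact: (@pliftZ _ Uq_pres _ _ (ufunP h)). Qed.
End Ulift.

Local Notation UU := (tensAlg Uq_pres Uq_pres).
Local Notation "x ⊗ y" := (@tpure _ Uq_pres Uq_pres x y) (at level 40).

Lemma isUq_Delta :
  isUq (uE ⊗ uK + uKi ⊗ uE) (uF ⊗ uK + uKi ⊗ uF) (uK ⊗ uK) (uKi ⊗ uKi).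
Proof.
have h := uP; have [kl lk ke kf ef] := h.
have kkl : uK * uK * uKi = uK by rewrite -mulrA kl mulr1.
split.
- by rewrite tpureM kl.
- by rewrite tpureM lk.
- rewrite mulrDr mulrDl !tpureM kl mul1r ke kkl scalerDr.
  by congr (_ + _); [exact: pureZl|exact: pureZr].
- rewrite mulrDr mulrDl !tpureM kl mul1r kf kkl scalerDr.
  by congr (_ + _); [exact: pureZl|exact: pureZr].
- rewrite !mulrDr !mulrDl !tpureM.
  rewrite (isUq_EL h) (isUq_FL h) (isUq_KE h) (isUq_KF h).
  rewrite /tpure !(pureZl, pureZr) !scalerA mulVf ?mulfV ?qC_neq0 // !scale1r.
  rewrite [LHS]sum4B.
  rewrite -pureBl -pureBr ef pureZl pureZr -scalerDr; congr (_ *: _).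
  by rewrite pureBl pureBr addrA subrK.
Qed.

Definition Delta : Uq -> UU :=
  @ulift UU (uE ⊗ uK + uKi ⊗ uE) (uF ⊗ uK + uKi ⊗ uF) (uK ⊗ uK) (uKi ⊗ uKi).
Definition eps : Uq -> C := @ulift C^o 0 0 1 1.

Lemma isUq_antipode (c d : C) : c * d = 1 ->
  @isUq (twop idfun Uq) (c *: uE) (d *: uF) uKi uK.
Proof.
move=> cd; have h := uP; have [kl lk ke kf ef] := h.
split.
- exact: kl.
- exact: lk.
- rewrite -mulrA; change (uK * (c *: uE) * uKi = qC *: (c *: uE)).
  by rewrite -scalerAr -scalerAl ke !scalerA mulrC.
- rewrite -mulrA; change (uK * (d *: uF) * uKi = qC^-1 *: (d *: uF)).
  by rewrite -scalerAr -scalerAl kf !scalerA mulrC.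
- change ((d *: uF) * (c *: uE) - (c *: uE) * (d *: uF) =
    lam^-1 *: (uKi * uKi - uK * uK)).
  rewrite -!scalerAl -!scalerAr !scalerA mulrC cd !scale1r.
  by apply: oppr_inj; rewrite -scalerN !opprB.
Qed.

(* The antipode and its inverse are algebra morphisms to the opposite algebra. *)
Definition antipode : Uq -> Uq :=
  @ulift (twop idfun Uq) ((- qC) *: uE) ((- qC^-1) *: uF) uKi uK.
Definition antipodeV : Uq -> Uq :=
  @ulift (twop idfun Uq) ((- qC^-1) *: uE) ((- qC) *: uF) uKi uK.

Fact qqV : (- qC) * (- qC^-1) = 1. Proof. by rewrite mulrNN mulfV ?qC_neq0. Qed.
Fact qVq : (- qC^-1) * (- qC) = 1. Proof. by rewrite mulrC qqV. Qed.

Lemma antipodeM x y : antipode (x * y) = antipode y * antipode x.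
Proof. exact: (uliftM (isUq_antipode qqV)). Qed.
Lemma antipodeD x y : antipode (x + y) = antipode x + antipode y.
Proof. exact: (uliftD (isUq_antipode qqV)). Qed.
Lemma antipodeZ c x : antipode (c *: x) = c *: antipode x.
Proof. exact: (uliftZ (isUq_antipode qqV)). Qed.
Lemma antipode1 : antipode 1 = 1.
Proof. exact: (ulift1 (isUq_antipode qqV)). Qed.
Lemma antipodeVM x y : antipodeV (x * y) = antipodeV y * antipodeV x.
Proof. exact: (uliftM (isUq_antipode qVq)). Qed.
Lemma antipodeVD x y : antipodeV (x + y) = antipodeV x + antipodeV y.
Proof. exact: (uliftD (isUq_antipode qVq)). Qed.
Lemma antipodeVZ c x : antipodeV (c *: x) = c *: antipodeV x.
Proof. exact: (uliftZ (isUq_antipode qVq)). Qed.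
Lemma antipodeV1 : antipodeV 1 = 1.
Proof. exact: (ulift1 (isUq_antipode qVq)). Qed.

Lemma antipodeK : cancel antipode antipodeV.
Proof.
have h := isUq_antipode qqV; have h' := isUq_antipode qVq.
elim/Uq_ind => [||||||x y Hx Hy|c x Hx].
- rewrite [antipode _](uliftE h) antipodeVZ [antipodeV _](uliftE h').
  by rewrite scalerA qqV scale1r.
- rewrite [antipode _](uliftF h) antipodeVZ [antipodeV _](uliftF h').
  by rewrite scalerA qVq scale1r.
- by rewrite [antipode _](uliftK h) [antipodeV _](uliftKi h').
- by rewrite [antipode _](uliftKi h) [antipodeV _](uliftK h').
- by rewrite antipode1 antipodeV1.
- by move=> x y Hx Hy; rewrite antipodeD antipodeVD Hx Hy.
- by rewrite antipodeM antipodeVM Hx Hy.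
- by rewrite antipodeZ antipodeVZ Hx.
Qed.

Lemma antipodeVK : cancel antipodeV antipode.
Proof.
have h := isUq_antipode qqV; have h' := isUq_antipode qVq.
elim/Uq_ind => [||||||x y Hx Hy|c x Hx].
- rewrite [antipodeV _](uliftE h') antipodeZ [antipode _](uliftE h).
  by rewrite scalerA qVq scale1r.
- rewrite [antipodeV _](uliftF h') antipodeZ [antipode _](uliftF h).
  by rewrite scalerA qqV scale1r.
- by rewrite [antipodeV _](uliftK h') [antipode _](uliftKi h).
- by rewrite [antipodeV _](uliftKi h') [antipode _](uliftK h).
- by rewrite antipodeV1 antipode1.
- by move=> x y Hx Hy; rewrite antipodeVD antipodeD Hx Hy.
- by rewrite antipodeVM antipodeM Hx Hy.
- by rewrite antipodeVZ antipodeZ Hx.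
Qed.

(* The involution is an algebra morphism to the conjugate opposite algebra. *)
Lemma isUq_star : @isUq (twop (@Num.conj_op C) Uq) uF uE uK uKi.
Proof.
have h := uP; have [kl lk ke kf ef] := h.
have Q0 := qC_neq0 q.
split.
- exact: lk.
- exact: kl.
- rewrite -mulrA; change (uKi * uF * uK = qC^* *: uF).
  rewrite qC_conj -[uKi * uF]scale1r -(mulfV Q0) -scalerA -(isUq_FL h).
  by rewrite -scalerAl -mulrA lk mulr1.
- rewrite -mulrA; change (uKi * uE * uK = (qC^-1)^* *: uE).
  rewrite conjVC qC_conj -[uKi * uE]scale1r -(mulVf Q0) -scalerA -(isUq_EL h).
  by rewrite -scalerAl -mulrA lk mulr1.
- change (uE * uF - uF * uE = (lam^-1)^* *: (uK * uK - uKi * uKi)).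
  by rewrite conjVC lam_conj.
Qed.

Definition ustar : Uq -> Uq := @ulift (twop (@Num.conj_op C) Uq) uF uE uK uKi.

Lemma ustarE : ustar uE = uF. Proof. exact: (uliftE isUq_star). Qed.
Lemma ustarF : ustar uF = uE. Proof. exact: (uliftF isUq_star). Qed.
Lemma ustarK : ustar uK = uK. Proof. exact: (uliftK isUq_star). Qed.
Lemma ustarKi : ustar uKi = uKi. Proof. exact: (uliftKi isUq_star). Qed.
Lemma ustar1 : ustar 1 = 1. Proof. exact: (ulift1 isUq_star). Qed.
Lemma ustarD : {morph ustar : x y / x + y}.
Proof. exact: (uliftD isUq_star). Qed.
Lemma ustarM x y : ustar (x * y) = ustar y * ustar x.
Proof. exact: (uliftM isUq_star). Qed.
Lemma ustarZ c x : ustar (c *: x) = c^* *: ustar x.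
Proof. exact: (uliftZ isUq_star). Qed.
Lemma ustar_invol : involutive ustar.
Proof.
elim/Uq_ind => [||||||x y Hx Hy|c x Hx].
- by rewrite ustarE ustarF.
- by rewrite ustarF ustarE.
- by rewrite !ustarK.
- by rewrite !ustarKi.
- by rewrite !ustar1.
- by move=> x y Hx Hy; rewrite !ustarD Hx Hy.
- by rewrite !ustarM Hx Hy.
- by rewrite !ustarZ conjCK Hx.
Qed.
HB.instance Definition _ := Algebra_isStar.Build C Uq
  ustar_invol ustarD ustarZ ustarM.
End Uq.

Variant Ogen := ga | gb | gc | gd.

Section Oq.
Variables (R : rcfType) (q : qparam R).
Local Notation C := R[i].
Local Notation qC := (qC q).
Local Notation qh := (qhalf q).
Local Notation lam := (lam q).

Section Relations.
Local Open Scope fterm_scope.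
Local Notation "s - t" := (s + (-1)%R *: t)%F.
Local Notation a := (FGen ga).
Local Notation b := (FGen gb).
Local Notation c := (FGen gc).
Local Notation d := (FGen gd).

Variant Oq_rel : fterm C Ogen -> fterm C Ogen -> Prop :=
| Oq_ab : Oq_rel (a * b) (qC *: (b * a))
| Oq_ac : Oq_rel (a * c) (qC *: (c * a))
| Oq_bd : Oq_rel (b * d) (qC *: (d * b))
| Oq_cd : Oq_rel (c * d) (qC *: (d * c))
| Oq_bc : Oq_rel (b * c) (c * b)
| Oq_ad_da : Oq_rel (a * d - d * a) (lam *: (b * c))
| Oq_det : Oq_rel (a * d - qC *: (b * c)) 1.
End Relations.

Record isOq (B : algType C) (a b c d : B) : Prop := IsOq {
  isOq_ab : a * b = qC *: (b * a);
  isOq_ac : a * c = qC *: (c * a);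
  isOq_bd : b * d = qC *: (d * b);
  isOq_cd : c * d = qC *: (d * c);
  isOq_bc : b * c = c * b;
  isOq_ad_da : a * d - d * a = lam *: (b * c);
  isOq_det : a * d - qC *: (b * c) = 1 }.

Definition ofun (B : Type) (a b c d : B) (g : Ogen) : B :=
  match g with ga => a | gb => b | gc => c | gd => d end.

Lemma ofunP (B : algType C) (a b c d : B) : isOq a b c d ->
  forall s t, Oq_rel s t -> feval (ofun a b c d) s = feval (ofun a b c d) t.
Proof. by case=> h1 h2 h3 h4 h5 h6 h7 s t [] //=; rewrite !scaleN1r. Qed.

Definition oaug : Ogen -> C := ofun 1 0 0 1.

Lemma isOq_aug : isOq (1 : C^o) 0 0 1.
Proof.
by split; rewrite ?(mul1r, mulr1, mul0r, mulr0, subrr, scaler0, subr0).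
Qed.

Definition Oq_pres : presentation C :=
  Presentation (pr_aug := oaug) (ofunP isOq_aug).

Definition Oq : Type := presAlg Oq_pres.
HB.instance Definition _ := GRing.Algebra.on Oq.

Definition oa : Oq := pgen (ga : pr_gen Oq_pres).
Definition ob : Oq := pgen (gb : pr_gen Oq_pres).
Definition oc : Oq := pgen (gc : pr_gen Oq_pres).
Definition od : Oq := pgen (gd : pr_gen Oq_pres).

Lemma oP : isOq oa ob oc od.
Proof.
have H s t : Oq_rel s t -> feval (@pgen _ Oq_pres) s = feval (@pgen _ Oq_pres) t.
  exact: (@pgen_rel _ Oq_pres).
split.
- exact: (H _ _ Oq_ab).
- exact: (H _ _ Oq_ac).
- exact: (H _ _ Oq_bd).
- exact: (H _ _ Oq_cd).
- exact: (H _ _ Oq_bc).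
- by have := H _ _ Oq_ad_da; rewrite /= !scaleN1r.
- by have := H _ _ Oq_det; rewrite /= !scaleN1r.
Qed.

Lemma Oq_ind (Q : Oq -> Prop) :
  Q oa -> Q ob -> Q oc -> Q od -> Q 1 ->
  (forall x y, Q x -> Q y -> Q (x + y)) ->
  (forall x y, Q x -> Q y -> Q (x * y)) -> (forall c x, Q x -> Q (c *: x)) ->
  forall x, Q x.
Proof. by move=> Qa Qb Qc Qd *; apply: presAlg_ind => //; case. Qed.

(* The algebra morphism of O(SU_q(2)) given by the images of a, b, c, d. *)
Definition olift (B : algType C) (a b c d : B) : Oq -> B :=
  @plift _ Oq_pres B (ofun a b c d).

Section Olift.
Variables (B : algType C) (a b c d : B).
Hypothesis h : isOq a b c d.
Local Notation phi := (olift a b c d).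
Lemma olifta : phi oa = a. Proof. exact: (@plift_gen _ Oq_pres _ _ (ofunP h) ga). Qed.
Lemma oliftb : phi ob = b. Proof. exact: (@plift_gen _ Oq_pres _ _ (ofunP h) gb). Qed.
Lemma oliftc : phi oc = c. Proof. exact: (@plift_gen _ Oq_pres _ _ (ofunP h) gc). Qed.
Lemma oliftd : phi od = d. Proof. exact: (@plift_gen _ Oq_pres _ _ (ofunP h) gd). Qed.
Lemma olift1 : phi 1 = 1. Proof. exact: (@plift1 _ Oq_pres _ _ (ofunP h)). Qed.
Lemma oliftD : {morph phi : x y / x + y}.
Proof. exact: (@pliftD _ Oq_pres _ _ (ofunP h)). Qed.
Lemma oliftM : {morph phi : x y / x * y}.
Proof. exact: (@pliftM _ Oq_pres _ _ (ofunP h)). Qed.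
Lemma oliftZ c' : {morph phi : x / c' *: x}.
Proof. exact: (@pliftZ _ Oq_pres _ _ (ofunP h)). Qed.
End Olift.

Lemma isOq_star : @isOq (twop (@Num.conj_op C) Oq)
  od ((- qC) *: oc) ((- qC^-1) *: ob) oa.
Proof.
have [ab ac bd cd bc adda det] := oP; have Q0 := qC_neq0 q.
have cbE : ((- qC^-1) *: ob) * ((- qC) *: oc) = ob * oc :> Oq.
  by rewrite -scalerAl -scalerAr scalerA mulrNN mulVf // scale1r.
split.
- change (((- qC) *: oc) * od = qC^* *: (od * ((- qC) *: oc))).
  by rewrite qC_conj -scalerAl -scalerAr cd !scalerA mulrC.
- change (((- qC^-1) *: ob) * od = qC^* *: (od * ((- qC^-1) *: ob))).
  by rewrite qC_conj -scalerAl -scalerAr bd !scalerA mulrC.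
- change (oa * ((- qC) *: oc) = qC^* *: (((- qC) *: oc) * oa)).
  by rewrite qC_conj -scalerAl -scalerAr ac !scalerA mulrC.
- change (oa * ((- qC^-1) *: ob) = qC^* *: (((- qC^-1) *: ob) * oa)).
  by rewrite qC_conj -scalerAl -scalerAr ab !scalerA mulrC.
- change (((- qC^-1) *: ob) * ((- qC) *: oc) = ((- qC) *: oc) * ((- qC^-1) *: ob)).
  rewrite cbE -scalerAl -scalerAr scalerA mulrNN mulfV // scale1r.
  exact: bc.
- change (oa * od - od * oa = lam^* *: (((- qC^-1) *: ob) * ((- qC) *: oc))).
  by rewrite cbE lam_conj.
- change (oa * od - qC^* *: (((- qC^-1) *: ob) * ((- qC) *: oc)) = 1).
  by rewrite cbE qC_conj.
Qed.

Definition ostar : Oq -> Oq :=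
  @olift (twop (@Num.conj_op C) Oq) od ((- qC) *: oc) ((- qC^-1) *: ob) oa.

Lemma ostara : ostar oa = od. Proof. exact: (olifta isOq_star). Qed.
Lemma ostarb : ostar ob = (- qC) *: oc. Proof. exact: (oliftb isOq_star). Qed.
Lemma ostarc : ostar oc = (- qC^-1) *: ob. Proof. exact: (oliftc isOq_star). Qed.
Lemma ostard : ostar od = oa. Proof. exact: (oliftd isOq_star). Qed.
Lemma ostar1 : ostar 1 = 1. Proof. exact: (olift1 isOq_star). Qed.
Lemma ostarD : {morph ostar : x y / x + y}.
Proof. exact: (oliftD isOq_star). Qed.
Lemma ostarM x y : ostar (x * y) = ostar y * ostar x.
Proof. exact: (oliftM isOq_star). Qed.
Lemma ostarZ c x : ostar (c *: x) = c^* *: ostar x.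
Proof. exact: (oliftZ isOq_star). Qed.
Lemma ostar0 : ostar 0 = 0.
Proof. by have := ostarZ 0 0; rewrite conjC0 !scale0r. Qed.
Fact conjNqC : (- qC)^* = - qC.
Proof. by rewrite -[in RHS]qC_conj; exact: rmorphN. Qed.
Fact conjNqCV : (- qC^-1)^* = - qC^-1.
Proof. by rewrite -[in RHS]qC_conj -conjVC; exact: rmorphN. Qed.
Lemma ostar_invol : involutive ostar.
Proof.
elim/Oq_ind => [||||||x y Hx Hy|c x Hx].
- by rewrite ostara ostard.
- by rewrite ostarb ostarZ ostarc scalerA conjNqC qqV scale1r.
- by rewrite ostarc ostarZ ostarb scalerA conjNqCV qVq scale1r.
- by rewrite ostard ostara.
- by rewrite !ostar1.
- by move=> x y Hx Hy; rewrite !ostarD Hx Hy.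
- by rewrite !ostarM Hx Hy.
- by rewrite !ostarZ conjCK Hx.
Qed.
HB.instance Definition _ := Algebra_isStar.Build C Oq
  ostar_invol ostarD ostarZ ostarM.

Lemma isOq_scale (s t : C) : s * t = 1 ->
  isOq (s *: oa) (s *: ob) (t *: oc) (t *: od).
Proof.
move=> st; have [ab ac bd cd bc adda det] := oP.
have N x y (u v : Oq) : (x *: u) * (y *: v) = (x * y) *: (u * v).
  by rewrite -scalerAl -scalerAr scalerA.
have ts : t * s = 1 by rewrite mulrC.
split; rewrite !N ?st ?ts ?scale1r //.
- by rewrite ab !scalerA; congr (_ *: _); ring.
- by rewrite cd !scalerA; congr (_ *: _); ring.
Qed.

Fact hVh : qh^-1 * qh = 1. Proof. by rewrite mulVf ?qhalf_neq0. Qed.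
Fact hhV : qh * qh^-1 = 1. Proof. by rewrite mulfV ?qhalf_neq0. Qed.

Fact isOqK : isOq (qh^-1 *: oa) (qh^-1 *: ob) (qh *: oc) (qh *: od).
Proof. exact: isOq_scale hVh. Qed.
Fact isOqKi : isOq (qh *: oa) (qh *: ob) (qh^-1 *: oc) (qh^-1 *: od).
Proof. exact: isOq_scale hhV. Qed.

Definition actK : Oq -> Oq := olift (qh^-1 *: oa) (qh^-1 *: ob) (qh *: oc) (qh *: od).
Definition actKi : Oq -> Oq := olift (qh *: oa) (qh *: ob) (qh^-1 *: oc) (qh^-1 *: od).

(* The maps x |-> x <| E and x |-> x <| F are read off the upper triangular
   "matrices" [[x <| K^-1, x <| E], [0, x <| K]], which depend multiplicatively
   on x because of Delta E = E (x) K + K^-1 (x) E; the matrices are realized as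
   endomorphisms of O x O. *)
Fact v01 : (0, 1) != 0 :> (Oq * Oq)%type.
Proof. by apply/eqP => -[] /eqP; rewrite oner_eq0. Qed.
Local Notation M2 := (endoAlg v01).

Fact tri_subproof (p e k : Oq) :
  linear (fun u : (Oq * Oq)%type => (p * u.1 + e * u.2, k * u.2) : (Oq * Oq)%type).
Proof.
move=> c [u1 u2] [v1 v2] /=; congr (_, _); rewrite /= !mulrDr -!scalerAr //.
by rewrite scalerDr addrACA.
Qed.
Definition tri p e k : M2 := Endo (@tri_subproof p e k).

Lemma triM p e k p' e' k' :
  tri p e k * tri p' e' k' = tri (p * p') (p * e' + e * k') (k * k').
Proof.
apply: endoP => -[u1 u2] /=; congr (_, _) => /=; last by rewrite mulrA.
by rewrite mulrDr mulrDl !mulrA addrA.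
Qed.
Lemma triD p e k p' e' k' :
  tri p e k + tri p' e' k' = tri (p + p') (e + e') (k + k').
Proof.
apply: endoP => -[u1 u2] /=; congr (_, _) => /=; last by rewrite mulrDl.
by rewrite !mulrDl addrACA.
Qed.
Lemma triZ c p e k : c *: tri p e k = tri (c *: p) (c *: e) (c *: k).
Proof.
apply: endoP => -[u1 u2] /=; congr (_, _) => /=; last by rewrite scalerAl.
by rewrite scalerDr !scalerAl.
Qed.
Lemma triN p e k : - tri p e k = tri (- p) (- e) (- k).
Proof. by rewrite -scaleN1r triZ !scaleN1r. Qed.
Lemma tri1 : 1 = tri 1 0 1.
Proof.
apply: endoP => -[u1 u2] /=; congr (_, _) => /=; last by rewrite mul1r.
by rewrite mul1r mul0r addr0.
Qed.

Lemma isOq_tri (pa pb pc pd ea eb ec ed ka kb kc kd : Oq) :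
  isOq pa pb pc pd -> isOq ka kb kc kd ->
  pa * eb + ea * kb = qC *: (pb * ea + eb * ka) ->
  pa * ec + ea * kc = qC *: (pc * ea + ec * ka) ->
  pb * ed + eb * kd = qC *: (pd * eb + ed * kb) ->
  pc * ed + ec * kd = qC *: (pd * ec + ed * kc) ->
  pb * ec + eb * kc = pc * eb + ec * kb ->
  pa * ed + ea * kd - (pd * ea + ed * ka) = lam *: (pb * ec + eb * kc) ->
  pa * ed + ea * kd - qC *: (pb * ec + eb * kc) = 0 ->
  isOq (tri pa ea ka) (tri pb eb kb) (tri pc ec kc) (tri pd ed kd).
Proof.
case=> p1 p2 p3 p4 p5 p6 p7 [k1 k2 k3 k4 k5 k6 k7] e1 e2 e3 e4 e5 e6 e7.
split; rewrite ?tri1 !(triM, triZ, triN, triD); by congr tri.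
Qed.

Fact isOq_E : isOq (tri (qh *: oa) 0 (qh^-1 *: oa)) (tri (qh *: ob) 0 (qh^-1 *: ob))
  (tri (qh^-1 *: oc) oa (qh *: oc)) (tri (qh^-1 *: od) ob (qh *: od)).
Proof.
have [ab ac bd cd bc adda det] := oP.
have H0 := qhalf_neq0 q; have Q0 := qC_neq0 q.
have qE : qC = qh * qh by rewrite qhalf2.
have da : od * oa = oa * od - lam *: (ob * oc) by rewrite -adda subKr.
apply: (isOq_tri isOqKi isOqK); rewrite ?(mul0r, mulr0, addr0, add0r, scaler0) //.
- by rewrite -scalerAl -scalerAr scalerA qE -mulrA mulfV // mulr1.
- by rewrite -scalerAl -scalerAr scalerA qE -mulrA mulfV // mulr1.
- rewrite -!scalerAl -!scalerAr da !(scalerDr, scalerN, scalerA) -bc.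
  rewrite [qC * _]mulrC qE mulrA mulVf // mul1r.
  rewrite -[LHS]addrC -[RHS]addrA; congr (_ + _).
  rewrite -scaleNr -scalerDl; congr (_ *: _).
  by rewrite /Defs.lam qE; field.
- by rewrite -scalerAl -scalerAr ab scalerA qE mulrA mulVf // mul1r.
- rewrite -!scalerAl -!scalerAr ab !scalerA -scalerBl; congr (_ *: _).
  by rewrite /Defs.lam qE; field.
- by rewrite -!scalerAl ab !scalerA mulrC subrr.
Qed.

Fact isOq_F : isOq (tri (qh *: oa) oc (qh^-1 *: oa)) (tri (qh *: ob) od (qh^-1 *: ob))
  (tri (qh^-1 *: oc) 0 (qh *: oc)) (tri (qh^-1 *: od) 0 (qh *: od)).
Proof.
have [ab ac bd cd bc adda det] := oP.
have H0 := qhalf_neq0 q; have Q0 := qC_neq0 q.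
have qE : qC = qh * qh by rewrite qhalf2.
have da : od * oa = oa * od - lam *: (ob * oc) by rewrite -adda subKr.
apply: (isOq_tri isOqKi isOqK); rewrite ?(mul0r, mulr0, addr0, add0r, scaler0) //.
- rewrite -!scalerAl -!scalerAr da !(scalerDr, scalerN, scalerA) -bc.
  have -> : qC * qh^-1 = qh by rewrite qE -mulrA mulfV // mulr1.
  rewrite [RHS]addrCA; congr (_ + _).
  rewrite -scaleNr -scalerDl; congr (_ *: _).
  by rewrite /Defs.lam qE; field.
- by rewrite -scalerAl -scalerAr scalerA qE -mulrA mulfV // mulr1.
- by rewrite -scalerAl -scalerAr scalerA qE -mulrA mulfV // mulr1.
- by rewrite -scalerAl -scalerAr cd scalerA qE mulrA mulVf // mul1r.
- rewrite -!scalerAl -!scalerAr cd !scalerA -scalerBl; congr (_ *: _).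
  by rewrite /Defs.lam qE; field.
- by rewrite -!scalerAr cd !scalerA mulrC subrr.
Qed.

Definition triE : Oq -> M2 := olift
  (tri (qh *: oa) 0 (qh^-1 *: oa)) (tri (qh *: ob) 0 (qh^-1 *: ob))
  (tri (qh^-1 *: oc) oa (qh *: oc)) (tri (qh^-1 *: od) ob (qh *: od)).
Definition triF : Oq -> M2 := olift
  (tri (qh *: oa) oc (qh^-1 *: oa)) (tri (qh *: ob) od (qh^-1 *: ob))
  (tri (qh^-1 *: oc) 0 (qh *: oc)) (tri (qh^-1 *: od) 0 (qh *: od)).
Definition actE (x : Oq) : Oq := (efun (triE x) (0, 1)).1.
Definition actF (x : Oq) : Oq := (efun (triF x) (0, 1)).1.

Lemma actKa : actK oa = qh^-1 *: oa. Proof. exact: (olifta isOqK). Qed.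
Lemma actKb : actK ob = qh^-1 *: ob. Proof. exact: (oliftb isOqK). Qed.
Lemma actKc : actK oc = qh *: oc. Proof. exact: (oliftc isOqK). Qed.
Lemma actKd : actK od = qh *: od. Proof. exact: (oliftd isOqK). Qed.
Lemma actK1 : actK 1 = 1. Proof. exact: (olift1 isOqK). Qed.
Lemma actKD x y : actK (x + y) = actK x + actK y. Proof. exact: (oliftD isOqK). Qed.
Lemma actKM x y : actK (x * y) = actK x * actK y. Proof. exact: (oliftM isOqK). Qed.
Lemma actKZ c x : actK (c *: x) = c *: actK x. Proof. exact: (oliftZ isOqK). Qed.
Lemma actKia : actKi oa = qh *: oa. Proof. exact: (olifta isOqKi). Qed.
Lemma actKib : actKi ob = qh *: ob. Proof. exact: (oliftb isOqKi). Qed.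
Lemma actKic : actKi oc = qh^-1 *: oc. Proof. exact: (oliftc isOqKi). Qed.
Lemma actKid : actKi od = qh^-1 *: od. Proof. exact: (oliftd isOqKi). Qed.
Lemma actKi1 : actKi 1 = 1. Proof. exact: (olift1 isOqKi). Qed.
Lemma actKiD x y : actKi (x + y) = actKi x + actKi y.
Proof. exact: (oliftD isOqKi). Qed.
Lemma actKiM x y : actKi (x * y) = actKi x * actKi y.
Proof. exact: (oliftM isOqKi). Qed.
Lemma actKiZ c x : actKi (c *: x) = c *: actKi x.
Proof. exact: (oliftZ isOqKi). Qed.

Fact tri_val p e k : (efun (tri p e k) (0, 1)).1 = e.
Proof. by rewrite /= mulr0 mulr1 add0r. Qed.

Fact tri_lift (f : Oq -> M2) :
  (exists e, f oa = tri (qh *: oa) e (qh^-1 *: oa)) ->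
  (exists e, f ob = tri (qh *: ob) e (qh^-1 *: ob)) ->
  (exists e, f oc = tri (qh^-1 *: oc) e (qh *: oc)) ->
  (exists e, f od = tri (qh^-1 *: od) e (qh *: od)) ->
  f 1 = 1 -> (forall x y, f (x + y) = f x + f y) ->
  (forall x y, f (x * y) = f x * f y) -> (forall c x, f (c *: x) = c *: f x) ->
  forall x, f x = tri (actKi x) (efun (f x) (0, 1)).1 (actK x).
Proof.
move=> fa fb fc fd f1 fD fM fZ.
have H x : (exists e, f x = tri (actKi x) e (actK x)) ->
    f x = tri (actKi x) (efun (f x) (0, 1)).1 (actK x).
  by case=> e ->; rewrite tri_val.
elim/Oq_ind => [|||||x y Hx Hy|x y Hx Hy|c x Hx]; apply: H.
- by rewrite actKa actKia.
- by rewrite actKb actKib.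
- by rewrite actKc actKic.
- by rewrite actKd actKid.
- by exists 0; rewrite actK1 actKi1 f1 tri1.
- by rewrite fD Hx Hy actKD actKiD triD; eexists.
- by rewrite fM Hx Hy actKM actKiM triM; eexists.
- by rewrite fZ Hx actKZ actKiZ triZ; eexists.
Qed.

Lemma triEE x : triE x = tri (actKi x) (actE x) (actK x).
Proof.
have h := isOq_E; apply: tri_lift.
- by eexists; exact: (olifta h).
- by eexists; exact: (oliftb h).
- by eexists; exact: (oliftc h).
- by eexists; exact: (oliftd h).
- exact: (olift1 h).
- exact: (oliftD h).
- exact: (oliftM h).
- exact: (oliftZ h).
Qed.
Lemma triFE x : triF x = tri (actKi x) (actF x) (actK x).
Proof.
have h := isOq_F; apply: tri_lift.
- by eexists; exact: (olifta h).
- by eexists; exact: (oliftb h).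
- by eexists; exact: (oliftc h).
- by eexists; exact: (oliftd h).
- exact: (olift1 h).
- exact: (oliftD h).
- exact: (oliftM h).
- exact: (oliftZ h).
Qed.

Lemma actEa : actE oa = 0.
Proof. by rewrite /actE [triE _](olifta isOq_E) tri_val. Qed.
Lemma actEb : actE ob = 0.
Proof. by rewrite /actE [triE _](oliftb isOq_E) tri_val. Qed.
Lemma actEc : actE oc = oa.
Proof. by rewrite /actE [triE _](oliftc isOq_E) tri_val. Qed.
Lemma actEd : actE od = ob.
Proof. by rewrite /actE [triE _](oliftd isOq_E) tri_val. Qed.
Lemma actE1 : actE 1 = 0.
Proof. by rewrite /actE [triE _](olift1 isOq_E) tri1 tri_val. Qed.
Lemma actED x y : actE (x + y) = actE x + actE y.
Proof. by rewrite {1}/actE (oliftD isOq_E : forall x y, triE (x + y) = triE x + triE y) !triEE triD tri_val. Qed.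
Lemma actEM x y : actE (x * y) = actE x * actK y + actKi x * actE y.
Proof.
by rewrite {1}/actE (oliftM isOq_E : forall x y, triE (x * y) = triE x * triE y) !triEE triM tri_val addrC.
Qed.
Lemma actEZ c x : actE (c *: x) = c *: actE x.
Proof. by rewrite {1}/actE (oliftZ isOq_E : forall c x, triE (c *: x) = c *: triE x) !triEE triZ tri_val. Qed.
Lemma actFa : actF oa = oc.
Proof. by rewrite /actF [triF _](olifta isOq_F) tri_val. Qed.
Lemma actFb : actF ob = od.
Proof. by rewrite /actF [triF _](oliftb isOq_F) tri_val. Qed.
Lemma actFc : actF oc = 0.
Proof. by rewrite /actF [triF _](oliftc isOq_F) tri_val. Qed.
Lemma actFd : actF od = 0.
Proof. by rewrite /actF [triF _](oliftd isOq_F) tri_val. Qed.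
Lemma actF1 : actF 1 = 0.
Proof. by rewrite /actF [triF _](olift1 isOq_F) tri1 tri_val. Qed.
Lemma actFD x y : actF (x + y) = actF x + actF y.
Proof. by rewrite {1}/actF (oliftD isOq_F : forall x y, triF (x + y) = triF x + triF y) !triFE triD tri_val. Qed.
Lemma actFM x y : actF (x * y) = actF x * actK y + actKi x * actF y.
Proof.
by rewrite {1}/actF (oliftM isOq_F : forall x y, triF (x * y) = triF x * triF y) !triFE triM tri_val addrC.
Qed.
Lemma actFZ c x : actF (c *: x) = c *: actF x.
Proof. by rewrite {1}/actF (oliftZ isOq_F : forall c x, triF (c *: x) = c *: triF x) !triFE triZ tri_val. Qed.

Lemma actK0 : actK 0 = 0. Proof. by have := actKZ 0 0; rewrite !scale0r. Qed.
Lemma actKi0 : actKi 0 = 0. Proof. by have := actKiZ 0 0; rewrite !scale0r. Qed.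
Lemma actE0 : actE 0 = 0. Proof. by have := actEZ 0 0; rewrite !scale0r. Qed.
Lemma actF0 : actF 0 = 0. Proof. by have := actFZ 0 0; rewrite !scale0r. Qed.

Lemma actKKi x : actKi (actK x) = x.
Proof.
elim/Oq_ind: x => [||||||x y Hx Hy|c x Hx].
- by rewrite actKa actKiZ actKia scalerA hVh scale1r.
- by rewrite actKb actKiZ actKib scalerA hVh scale1r.
- by rewrite actKc actKiZ actKic scalerA hhV scale1r.
- by rewrite actKd actKiZ actKid scalerA hhV scale1r.
- by rewrite actK1 actKi1.
- by move=> x y Hx Hy; rewrite actKD actKiD Hx Hy.
- by rewrite actKM actKiM Hx Hy.
- by rewrite actKZ actKiZ Hx.
Qed.
Lemma actKiK x : actK (actKi x) = x.
Proof.
elim/Oq_ind: x => [||||||x y Hx Hy|c x Hx].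
- by rewrite actKia actKZ actKa scalerA hhV scale1r.
- by rewrite actKib actKZ actKb scalerA hhV scale1r.
- by rewrite actKic actKZ actKc scalerA hVh scale1r.
- by rewrite actKid actKZ actKd scalerA hVh scale1r.
- by rewrite actKi1 actK1.
- by move=> x y Hx Hy; rewrite actKiD actKD Hx Hy.
- by rewrite actKiM actKM Hx Hy.
- by rewrite actKiZ actKZ Hx.
Qed.

Fact hhq : qh * qh = qC. Proof. exact: qhalf2. Qed.
Fact hhqV : qh^-1 * qh^-1 = qC^-1. Proof. by rewrite -invfM qhalf2. Qed.

Lemma act_KEKi x : actKi (actE (actK x)) = qC *: actE x.
Proof.
elim/Oq_ind: x => [||||||x y Hx Hy|c x Hx].
- by rewrite actKa actEZ actEa !scaler0 actKi0.
- by rewrite actKb actEZ actEb !scaler0 actKi0.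
- by rewrite actKc actEZ actEc actKiZ actKia scalerA hhq.
- by rewrite actKd actEZ actEd actKiZ actKib scalerA hhq.
- by rewrite actK1 actE1 actKi0 scaler0.
- by move=> x y Hx Hy; rewrite actKD !actED actKiD Hx Hy scalerDr.
- rewrite actKM !actEM actKiD !actKiM Hx Hy !actKKi scalerDr.
  by rewrite -scalerAl -scalerAr.
- by rewrite actKZ !actEZ actKiZ Hx !scalerA mulrC.
Qed.
Lemma act_KFKi x : actKi (actF (actK x)) = qC^-1 *: actF x.
Proof.
elim/Oq_ind: x => [||||||x y Hx Hy|c x Hx].
- by rewrite actKa actFZ actFa actKiZ actKic scalerA hhqV.
- by rewrite actKb actFZ actFb actKiZ actKid scalerA hhqV.
- by rewrite actKc actFZ actFc !scaler0 actKi0.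
- by rewrite actKd actFZ actFd !scaler0 actKi0.
- by rewrite actK1 actF1 actKi0 scaler0.
- by move=> x y Hx Hy; rewrite actKD !actFD actKiD Hx Hy scalerDr.
- rewrite actKM !actFM actKiD !actKiM Hx Hy !actKKi scalerDr.
  by rewrite -scalerAl -scalerAr.
- by rewrite actKZ !actFZ actKiZ Hx !scalerA mulrC.
Qed.
Lemma act_EK x : actE (actK x) = qC *: actK (actE x).
Proof. by rewrite -actKZ -act_KEKi actKiK. Qed.
Lemma act_FK x : actF (actK x) = qC^-1 *: actK (actF x).
Proof. by rewrite -actKZ -act_KFKi actKiK. Qed.
Lemma act_EKi x : actE (actKi x) = qC^-1 *: actKi (actE x).
Proof.
rewrite -{2}[x]actKiK act_EK actKiZ actKKi scalerA mulVf ?scale1r //.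
exact: qC_neq0.
Qed.
Lemma act_FKi x : actF (actKi x) = qC *: actKi (actF x).
Proof.
rewrite -{2}[x]actKiK act_FK actKiZ actKKi scalerA mulfV ?scale1r //.
exact: qC_neq0.
Qed.

Lemma act_EF x : actF (actE x) - actE (actF x) =
  lam^-1 *: (actK (actK x) - actKi (actKi x)).
Proof.
have L0 := lam_neq0 q.
have L0' : lam^-1 * lam = 1 by rewrite mulVf.
elim/Oq_ind: x => [||||||x y Hx Hy|c x Hx].
- rewrite actEa actF0 actFa actEc actKa actKZ actKa actKia actKiZ actKia.
  rewrite !scalerA -scalerBl sub0r hhq hhqV scalerA -[qC^-1 - qC]opprB.
  by rewrite mulrN L0' scaleN1r.
- rewrite actEb actF0 actFb actEd actKb actKZ actKb actKib actKiZ actKib.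
  rewrite !scalerA -scalerBl sub0r hhq hhqV scalerA -[qC^-1 - qC]opprB.
  by rewrite mulrN L0' scaleN1r.
- rewrite actEc actFa actFc actE0 actKc actKZ actKc actKic actKiZ actKic.
  by rewrite !scalerA -scalerBl subr0 hhq hhqV scalerA L0' scale1r.
- rewrite actEd actFb actFd actE0 actKd actKZ actKd actKid actKiZ actKid.
  by rewrite !scalerA -scalerBl subr0 hhq hhqV scalerA L0' scale1r.
- by rewrite actE1 actF1 actF0 actE0 !actK1 !actKi1 !subrr scaler0.
- move=> x y Hx Hy; rewrite !(actED, actFD, actKD, actKiD) !opprD.
  by rewrite addrACA Hx Hy -scalerDr addrACA.
- rewrite !(actEM, actFM, actED, actFD, actKM, actKiM).
  rewrite !(act_EK, act_FK, act_EKi, act_FKi) -?scalerAl -?scalerAr.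
  rewrite [LHS]sum4B -mulrBl -mulrBr Hx Hy -scalerAl -scalerAr -scalerDr.
  by rewrite mulrBl mulrBr addrA subrK.
- by rewrite !(actEZ, actFZ, actKZ, actKiZ) -!scalerBr Hx !scalerA mulrC.
Qed.

Fact O1_neq0 : 1 != 0 :> Oq. Proof. exact: oner_neq0. Qed.
Local Notation End := (endoAlg O1_neq0).

Fact act_linear (f : Oq -> Oq) : (forall x y, f (x + y) = f x + f y) ->
  (forall c x, f (c *: x) = c *: f x) -> linear f.
Proof. by move=> fD fZ c x y; rewrite fD fZ. Qed.

Definition opE : twop idfun End := Endo (act_linear actED actEZ).
Definition opF : twop idfun End := Endo (act_linear actFD actFZ).
Definition opK : twop idfun End := Endo (act_linear actKD actKZ).
Definition opKi : twop idfun End := Endo (act_linear actKiD actKiZ).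

Lemma isUq_act : isUq q opE opF opK opKi.
Proof.
split; apply: endoP => x.
- exact: actKKi.
- exact: actKiK.
- exact: act_KEKi.
- exact: act_KFKi.
- exact: act_EF.
Qed.

(* [act x f] is x <| f. A right action is an algebra morphism from U_q(su_2) to
   the opposite of the endomorphism algebra. *)
Definition act (x : Oq) (f : Uq q) : Oq := efun (ulift opE opF opK opKi f) x.

Lemma act_uE x : act x (uE q) = actE x.
Proof. by rewrite /act (uliftE isUq_act). Qed.
Lemma act_uF x : act x (uF q) = actF x.
Proof. by rewrite /act (uliftF isUq_act). Qed.
Lemma act_uK x : act x (uK q) = actK x.
Proof. by rewrite /act (uliftK isUq_act). Qed.
Lemma act_uKi x : act x (uKi q) = actKi x.
Proof. by rewrite /act (uliftKi isUq_act). Qed.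
Lemma act1 x : act x 1 = x.
Proof. by rewrite /act (ulift1 isUq_act). Qed.
Lemma actM x f g : act x (f * g) = act (act x f) g.
Proof. by rewrite /act (uliftM isUq_act). Qed.
Lemma actDr x f g : act x (f + g) = act x f + act x g.
Proof. by rewrite /act (uliftD isUq_act). Qed.
Lemma actZr x c f : act x (c *: f) = c *: act x f.
Proof. by rewrite /act (uliftZ isUq_act). Qed.
Lemma actDl x y f : act (x + y) f = act x f + act y f.
Proof. exact: efunD. Qed.
Lemma actZl c x f : act (c *: x) f = c *: act x f.
Proof. exact: efunZ. Qed.
End Oq.

Section Cross.
Variables (R : rcfType) (q : qparam R).
Local Notation C := R[i].
Local Notation qC := (qC q).
Local Notation U := (Uq q).
Local Notation O := (Oq q).
Local Notation K := (uK q).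
Local Notation Ki := (uKi q).
Local Notation UU := (tensAlg (Uq_pres q) (Uq_pres q)).
Local Notation "x ⊗ y" := (@tpure _ (Uq_pres q) (Uq_pres q) x y) (at level 40).

Lemma Delta1 : Delta (1 : U) = 1 ⊗ 1. Proof. exact: (ulift1 (isUq_Delta q)). Qed.
Lemma DeltaD (f g : U) : Delta (f + g) = Delta f + Delta g.
Proof. exact: (uliftD (isUq_Delta q)). Qed.
Lemma DeltaM (f g : U) : Delta (f * g) = Delta f * Delta g.
Proof. exact: (uliftM (isUq_Delta q)). Qed.
Lemma DeltaZ c (f : U) : Delta (c *: f) = c *: Delta f.
Proof. exact: (uliftZ (isUq_Delta q)). Qed.
Lemma DeltaE : Delta (uE q) = uE q ⊗ K + Ki ⊗ uE q.
Proof. exact: (uliftE (isUq_Delta q)). Qed.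
Lemma DeltaF : Delta (uF q) = uF q ⊗ K + Ki ⊗ uF q.
Proof. exact: (uliftF (isUq_Delta q)). Qed.
Lemma DeltaK : Delta K = K ⊗ K. Proof. exact: (uliftK (isUq_Delta q)). Qed.
Lemma DeltaKi : Delta Ki = Ki ⊗ Ki. Proof. exact: (uliftKi (isUq_Delta q)). Qed.

Definition cross : Type := tensor U O.
HB.instance Definition _ := GRing.Lmodule.on cross.

(* (g (x) x)(f (x) y) = g f_(1) (x) (x <| f_(2)) y *)
Definition crossm (g : U) (x : O) (f : U) (y : O) : tensor U O :=
  tlift (fun f1 f2 => pure (g * f1) (act x f2 * y)) (Delta f : tensor U U).
Definition crossMul : cross -> cross -> cross := tmul crossm.

Fact crossm_in g x y :
  balanced (fun f1 f2 : U => pure (g * f1) (act x f2 * y) : tensor U O).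
Proof.
split=> *.
- by rewrite mulrDr pureDl.
- by rewrite actDr mulrDl pureDr.
- by rewrite actZr -scalerAr -scalerAl pureZl pureZr.
Qed.
Fact crossm_inZ g x y (c : C) (f1 f2 : U) :
  pure (g * (c *: f1)) (act x f2 * y) = c *: pure (g * f1) (act x f2 * y) :> tensor U O.
Proof. by rewrite -scalerAr pureZl. Qed.

Fact crossm_bal g x : balanced (crossm g x).
Proof.
split=> *; rewrite /crossm.
- rewrite DeltaD; exact: (tliftD (crossm_in _ _ _)).
- rewrite /tlift -big_split /=; apply: eq_bigr => p _.
  by rewrite mulrDr pureDr.
- rewrite DeltaZ [LHS](tliftZ _ (crossm_in _ _ _)); last first.
    by move=> *; exact: crossm_inZ.
  rewrite /tlift scaler_sumr; apply: eq_bigr => p _.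
  by rewrite -scalerAr pureZr.
Qed.
Fact crossm_bal' f y : balanced (fun g x => crossm g x f y).
Proof.
split=> *; rewrite /crossm /tlift -?big_split /=; apply: eq_bigr => p _.
- by rewrite mulrDl pureDl.
- by rewrite actDl mulrDl pureDr.
- by rewrite actZl -!scalerAl pureZl pureZr.
Qed.
Fact crossmZ c g x f y : crossm g x (c *: f) y = c *: crossm g x f y.
Proof.
rewrite /crossm DeltaZ [LHS](tliftZ _ (crossm_in _ _ _)) //.
by move=> *; exact: crossm_inZ.
Qed.
Fact crossmZ' c g x f y : crossm (c *: g) x f y = c *: crossm g x f y.
Proof.
rewrite /crossm /tlift scaler_sumr; apply: eq_bigr => p _.
by rewrite -scalerAl pureZl.
Qed.

Lemma crossMul_pure g x f y :
  crossMul (pure g x) (pure f y) =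
  \sum_(p <- tseq (Delta f : tensor U U)) pure (g * p.1) (act x p.2 * y).
Proof. by apply: tmul_pure; [exact: crossm_bal|exact: crossm_bal']. Qed.
Lemma crossMul_pureE g x f y : crossMul (pure g x) (pure f y) = crossm g x f y.
Proof. exact: crossMul_pure. Qed.
Lemma crossMulDl : left_distributive crossMul +%R.
Proof. by move=> x y z; apply: tmulDl; exact: crossm_bal'. Qed.
Lemma crossMulDr : right_distributive crossMul +%R.
Proof. by move=> x y z; apply: tmulDr; exact: crossm_bal. Qed.
Lemma crossMul0l x : crossMul 0 x = 0.
Proof. by apply: tmul0l; exact: crossm_bal'. Qed.
Lemma crossMul0r x : crossMul x 0 = 0.
Proof. by apply: tmul0r; exact: crossm_bal. Qed.
Lemma crossMulZl c x y : crossMul (c *: x) y = c *: crossMul x y.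
Proof. by apply: tmulZl; [exact: crossm_bal'|exact: crossmZ']. Qed.
Lemma crossMulZr c x y : crossMul x (c *: y) = c *: crossMul x y.
Proof. by apply: tmulZr; [exact: crossm_bal|exact: crossmZ]. Qed.

Definition crossR_O (z : O) (t : cross) : cross := tlift (fun f y => pure f (y * z)) t.
Fact crossR_O_bal z : balanced (fun (f : U) (y : O) => pure f (y * z) : cross).
Proof.
split=> *; first by rewrite pureDl.
  by rewrite mulrDl pureDr.
by rewrite -scalerAl pureZl pureZr.
Qed.
Fact crossR_O_pure z f y : crossR_O z (pure f y) = pure f (y * z).
Proof. exact: (tlift_pure (crossR_O_bal z)). Qed.
Fact crossR_OD z s t : crossR_O z (s + t) = crossR_O z s + crossR_O z t.
Proof. exact: (tliftD (crossR_O_bal z)). Qed.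
Fact crossR_O0 z : crossR_O z 0 = 0. Proof. exact: (tlift0 (crossR_O_bal z)). Qed.
Fact crossR_O_sum z (I : Type) (r : seq I) (G : I -> cross) :
  crossR_O z (\sum_(i <- r) G i) = \sum_(i <- r) crossR_O z (G i).
Proof.
elim: r => [|i r IH]; first by rewrite !big_nil crossR_O0.
by rewrite !big_cons crossR_OD IH.
Qed.
Fact mul_crossR_O z s t : crossMul s (crossR_O z t) = crossR_O z (crossMul s t).
Proof.
elim/tensor_ind: t => [f y||t t' Ht Ht'].
- elim/tensor_ind: s => [g x||s s' Hs Hs'].
  + rewrite crossR_O_pure !crossMul_pure crossR_O_sum; apply: eq_bigr => p _.
    by rewrite crossR_O_pure mulrA.
  + by rewrite !crossMul0l crossR_O0.
  + by rewrite !crossMulDl crossR_OD Hs Hs'.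
- by rewrite crossR_O0 !crossMul0r crossR_O0.
- by rewrite crossR_OD !crossMulDr crossR_OD Ht Ht'.
Qed.
Fact mul_pure_crossR_O e z t : crossMul t (pure e z) = crossR_O z (crossMul t (pure e 1)).
Proof. by rewrite -mul_crossR_O crossR_O_pure mul1r. Qed.

Definition crossR_U f y (w : UU) : cross :=
  tlift (fun e1 e2 : U => pure (f * e1) (act y e2 * 1)) w.
Fact crossR_U_pure f y e1 e2 : crossR_U f y (e1 ⊗ e2) = pure (f * e1) (act y e2).
Proof. by rewrite [LHS](tlift_pure (crossm_in _ _ _)) mulr1. Qed.
Fact crossR_UD f y v w : crossR_U f y (v + w) = crossR_U f y v + crossR_U f y w.
Proof. exact: (tliftD (crossm_in _ _ _)). Qed.
Fact crossR_U0 f y : crossR_U f y 0 = 0.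
Proof. exact: (tlift0 (crossm_in _ _ _)). Qed.
Fact mul_crossR_U f y e : crossMul (pure f y) (pure e 1) = crossR_U f y (Delta e).
Proof. exact: crossMul_pure. Qed.
Fact mul_e0 e : crossMul 0 (pure e 1) = 0. Proof. exact: crossMul0l. Qed.
Fact mul1r_cross t : crossMul t (pure 1 1) = t.
Proof.
elim/tensor_ind: t => [f y||t t' Ht Ht'].
- by rewrite mul_crossR_U Delta1 crossR_U_pure act1 mulr1.
- exact: crossMul0l.
- by rewrite crossMulDl Ht Ht'.
Qed.
Fact mul_eM e e' t :
  crossMul t (pure (e * e') 1) = crossMul (crossMul t (pure e 1)) (pure e' 1).
Proof.
elim/tensor_ind: t => [f y||t t' Ht Ht']; last 2 first.
- by rewrite !crossMul0l.
- by rewrite !crossMulDl Ht Ht'.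
rewrite !mul_crossR_U DeltaM.
elim/tensor_ind: (Delta e : tensor U U) => [e1 e2||v v' Hv Hv']; last 2 first.
- by rewrite mul0r !crossR_U0 crossMul0l.
- by rewrite mulrDl !crossR_UD crossMulDl Hv Hv'.
rewrite crossR_U_pure mul_crossR_U.
elim/tensor_ind: (Delta e' : tensor U U) => [d1 d2||v v' Hv Hv']; last 2 first.
- by rewrite mulr0 !crossR_U0.
- by rewrite mulrDr !crossR_UD Hv Hv'.
by rewrite [_ * _]tpureM !crossR_U_pure mulrA actM.
Qed.

Definition crossLR g x y (w : UU) : cross :=
  tlift (fun e1 e2 : U => pure (g * e1) (act x e2 * y)) w.
Fact crossLR_pure g x y e1 e2 : crossLR g x y (e1 ⊗ e2) = pure (g * e1) (act x e2 * y).
Proof. exact: (tlift_pure (crossm_in _ _ _)). Qed.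
Fact crossLRD g x y v w : crossLR g x y (v + w) = crossLR g x y v + crossLR g x y w.
Proof. exact: (tliftD (crossm_in _ _ _)). Qed.
Fact crossLR0 g x y : crossLR g x y 0 = 0.
Proof. exact: (tlift0 (crossm_in _ _ _)). Qed.
Fact mul_crossLR g x f y : crossMul (pure g x) (pure f y) = crossLR g x y (Delta f).
Proof. exact: crossMul_pure. Qed.

Fact assoc_grouplike k : Delta k = k ⊗ k ->
  (forall x y : O, act (x * y) k = act x k * act y k) ->
  forall s t, crossMul (crossMul s t) (pure k 1) = crossMul s (crossMul t (pure k 1)).
Proof.
move=> Dk kM s t.
elim/tensor_ind: s => [g x||s s' Hs Hs']; last 2 first.
- by rewrite !crossMul0l.
- by rewrite !crossMulDl Hs Hs'.
elim/tensor_ind: t => [f y||t t' Ht Ht']; last 2 first.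
- by rewrite !(crossMul0r, crossMul0l).
- by rewrite !(crossMulDr, crossMulDl) Ht Ht'.
rewrite mul_crossR_U Dk crossR_U_pure !mul_crossLR DeltaM Dk.
elim/tensor_ind: (Delta f : tensor U U) => [e1 e2||v v' Hv Hv']; last 2 first.
- by rewrite mul0r !crossLR0 crossMul0l.
- by rewrite mulrDl !crossLRD crossMulDl Hv Hv'.
by rewrite [_ * _]tpureM !crossLR_pure mul_crossR_U Dk crossR_U_pure kM actM mulrA.
Qed.

Fact assoc_primitive e : Delta e = e ⊗ K + Ki ⊗ e ->
  (forall x y : O, act (x * y) e = act x e * act y K + act x Ki * act y e) ->
  forall s t, crossMul (crossMul s t) (pure e 1) = crossMul s (crossMul t (pure e 1)).
Proof.
move=> De eM s t.
elim/tensor_ind: s => [g x||s s' Hs Hs']; last 2 first.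
- by rewrite !crossMul0l.
- by rewrite !crossMulDl Hs Hs'.
elim/tensor_ind: t => [f y||t t' Ht Ht']; last 2 first.
- by rewrite !(crossMul0r, crossMul0l).
- by rewrite !(crossMulDr, crossMulDl) Ht Ht'.
rewrite mul_crossR_U De crossR_UD !crossR_U_pure crossMulDr !mul_crossLR !DeltaM De DeltaKi.
elim/tensor_ind: (Delta f : tensor U U) => [e1 e2||v v' Hv Hv']; last 2 first.
- by rewrite !mul0r !crossLR0 crossMul0l addr0.
- by rewrite !mulrDl !crossLRD crossMulDl Hv Hv' addrACA.
rewrite -[pure e1 e2]/(e1 ⊗ e2) mulrDr crossLRD !tpureM !crossLR_pure mul_crossR_U De crossR_UD !crossR_U_pure.
by rewrite eM !act_uK actKM !actM !act_uK !mulrA pureDr addrA.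
Qed.

Fact assoc_e e s t :
  crossMul (crossMul s t) (pure e 1) = crossMul s (crossMul t (pure e 1)).
Proof.
elim/Uq_ind: e s t => [|||||e e' He He'|e e' He He'|c e He] s t.
- apply: assoc_primitive; first exact: DeltaE.
  by move=> x y; rewrite !(act_uE, act_uK, act_uKi) actEM.
- apply: assoc_primitive; first exact: DeltaF.
  by move=> x y; rewrite !(act_uF, act_uK, act_uKi) actFM.
- apply: assoc_grouplike; first exact: DeltaK.
  by move=> x y; rewrite !act_uK actKM.
- apply: assoc_grouplike; first exact: DeltaKi.
  by move=> x y; rewrite !act_uKi actKiM.
- by rewrite !mul1r_cross.
- by rewrite pureDl !crossMulDr He He'.
- by rewrite !mul_eM He He'.
- by rewrite pureZl !crossMulZr He.
Qed.

Lemma crossMulA : associative crossMul.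
Proof.
move=> s t u; elim/tensor_ind: u => [e z||u u' Hu Hu'].
- by rewrite (mul_pure_crossR_O e z t) mul_crossR_O -assoc_e -mul_pure_crossR_O.
- by rewrite !crossMul0r.
- by rewrite !crossMulDr Hu Hu'.
Qed.

Lemma crossMulU f f' : crossMul (pure f 1) (pure f' 1) = pure (f * f') 1.
Proof.
elim/Uq_ind: f' f => [||||||e e' He He'|c e He] f.
- rewrite mul_crossR_U DeltaE crossR_UD !crossR_U_pure act_uK actK1 act_uE actE1.
  by rewrite pure0r addr0.
- rewrite mul_crossR_U DeltaF crossR_UD !crossR_U_pure act_uK actK1 act_uF actF1.
  by rewrite pure0r addr0.
- by rewrite mul_crossR_U DeltaK crossR_U_pure act_uK actK1.
- by rewrite mul_crossR_U DeltaKi crossR_U_pure act_uKi actKi1.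
- by rewrite mul1r_cross mulr1.
- by move=> e' He He' f'; rewrite pureDl crossMulDr mulrDr pureDl He He'.
- by rewrite mul_eM He He' mulrA.
- by rewrite pureZl crossMulZr He -scalerAr pureZl.
Qed.

Lemma crossMul1l : left_id (pure 1 1) crossMul.
Proof.
elim/tensor_ind=> [f y||t t' Ht Ht'].
- by rewrite mul_pure_crossR_O crossMulU mul1r crossR_O_pure mul1r.
- exact: crossMul0r.
- by rewrite crossMulDr Ht Ht'.
Qed.

HB.instance Definition _ := GRing.Zmodule_isNzRing.Build cross
  crossMulA crossMul1l mul1r_cross crossMulDl crossMulDr
  (pure11_neq0 (Uq_pres q) (Oq_pres q)).
HB.instance Definition _ := GRing.Lmodule_isLalgebra.Build C cross
  (fun c x y => esym (crossMulZl c x y)).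
HB.instance Definition _ := GRing.Lalgebra_isAlgebra.Build C cross
  (fun c x y => esym (crossMulZr c x y)).

Definition inU (f : U) : cross := pure f 1.
Definition inO (x : O) : cross := pure 1 x.

Lemma inUM f g : inU (f * g) = inU f * inU g.
Proof. by rewrite [RHS]crossMulU. Qed.
Lemma inUD f g : inU (f + g) = inU f + inU g. Proof. exact: pureDl. Qed.
Lemma inUZ c f : inU (c *: f) = c *: inU f. Proof. exact: pureZl. Qed.
Lemma inU1 : inU 1 = 1. Proof. by []. Qed.
Lemma inOD x y : inO (x + y) = inO x + inO y. Proof. exact: pureDr. Qed.
Lemma inOZ c x : inO (c *: x) = c *: inO x. Proof. exact: pureZr. Qed.
Lemma inO1 : inO 1 = 1. Proof. by []. Qed.
Lemma mul_inO f x y : (pure f x : cross) * inO y = pure f (x * y).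
Proof. by rewrite [LHS]mul_pure_crossR_O [crossMul _ _]mul1r_cross crossR_O_pure. Qed.
Lemma inOM x y : inO (x * y) = inO x * inO y.
Proof. by rewrite mul_inO. Qed.
Lemma pure_inUO f x : pure f x = inU f * inO x :> cross.
Proof. by rewrite mul_inO mul1r. Qed.
(* x f = f_(1) (x <| f_(2)). *)
Lemma cross_rel x f :
  inO x * inU f = \sum_(p <- tseq (Delta f : tensor U U)) inU p.1 * inO (act x p.2).
Proof.
rewrite [LHS]crossMul_pure; apply: eq_bigr => p _.
by rewrite -pure_inUO mul1r mulr1.
Qed.
Lemma inOU_crossR_U x f : inO x * inU f = crossR_U 1 x (Delta f).
Proof. exact: mul_crossR_U. Qed.
Lemma inOK x : inO x * inU K = inU K * inO (actK x).
Proof. by rewrite inOU_crossR_U DeltaK crossR_U_pure mul1r act_uK pure_inUO. Qed.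
Lemma inOKi x : inO x * inU Ki = inU Ki * inO (actKi x).
Proof. by rewrite inOU_crossR_U DeltaKi crossR_U_pure mul1r act_uKi pure_inUO. Qed.
Lemma inOE x : inO x * inU (uE q) = inU (uE q) * inO (actK x) + inU Ki * inO (actE x).
Proof.
by rewrite inOU_crossR_U DeltaE crossR_UD !crossR_U_pure !mul1r act_uK act_uE !pure_inUO.
Qed.
Lemma inOF x : inO x * inU (uF q) = inU (uF q) * inO (actK x) + inU Ki * inO (actF x).
Proof.
by rewrite inOU_crossR_U DeltaF crossR_UD !crossR_U_pure !mul1r act_uK act_uF !pure_inUO.
Qed.

(* (f (x) x)^* = f^*_(1) (x) (x^* <| f^*_(2)) *)

Definition crossstar (t : cross) : cross :=
  tlift (fun (f : U) (x : O) =>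
    \sum_(p <- tseq (Delta (star f) : tensor U U)) (pure p.1 (act (star x) p.2) : cross)) t.

Fact crossstar_in (f : U) (x : O) :
  \sum_(p <- tseq (Delta (star f) : tensor U U)) (pure p.1 (act (star x) p.2) : cross) =
  inO (star x) * inU (star f).
Proof. by rewrite cross_rel; apply: eq_bigr => p _; rewrite pure_inUO. Qed.

Fact crossstar_bal : balanced (fun (f : U) (x : O) =>
  \sum_(p <- tseq (Delta (star f) : tensor U U)) (pure p.1 (act (star x) p.2) : cross)).
Proof.
split=> *; rewrite !crossstar_in ?starD ?inUD ?inOD ?mulrDl ?mulrDr //.
by rewrite !starZ inUZ inOZ -scalerAl -scalerAr.
Qed.
Lemma crossstar_pure f x : crossstar (pure f x) = inO (star x) * inU (star f).
Proof. by rewrite /crossstar (tlift_pure crossstar_bal) crossstar_in. Qed.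
Lemma crossstar0 : crossstar 0 = 0. Proof. exact: (tlift0 crossstar_bal). Qed.
Lemma crossstarD : {morph crossstar : x y / x + y}.
Proof. by move=> x y; exact: (tliftD crossstar_bal). Qed.
Lemma crossstarZ c t : crossstar (c *: t) = c^* *: crossstar t.
Proof.
elim/tensor_ind: t => [f x||t t' Ht Ht'].
- by rewrite -pureZl !crossstar_pure starZ inUZ scalerAr.
- by rewrite scaler0 crossstar0 scaler0.
- by rewrite scalerDr !crossstarD Ht Ht' scalerDr.
Qed.
Lemma crossstar_inO x : crossstar (inO x) = inO (star x).
Proof. by rewrite crossstar_pure [star (1 : U)]ustar1 inU1 mulr1. Qed.
Fact crossstar_lU f t : crossstar (inU f * t) = crossstar t * inU (star f).
Proof.
elim/tensor_ind: t => [g x||t t' Ht Ht'].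
- rewrite [pure g x]pure_inUO mulrA -inUM -!pure_inUO !crossstar_pure starM inUM.
  by rewrite mulrA.
- by rewrite mulr0 crossstar0 mul0r.
- by rewrite mulrDr !crossstarD Ht Ht' mulrDl.
Qed.
Fact crossstar_rO t z : crossstar (t * inO z) = inO (star z) * crossstar t.
Proof.
elim/tensor_ind: t => [g x||t t' Ht Ht'].
- by rewrite mul_inO !crossstar_pure starM inOM mulrA.
- by rewrite mul0r crossstar0 mulr0.
- by rewrite mulrDl !crossstarD Ht Ht' mulrDr.
Qed.

Lemma star_actK (x : O) : star (actK x) = actKi (star x).
Proof.
have hc := qhalf_conj q; have hvc := conjVC (qhalf q); rewrite hc in hvc.
change (ostar (actK x) = actKi (ostar x)).
elim/Oq_ind: x => [||||||x y Hx Hy|c x Hx].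
- by rewrite actKa ostarZ hvc ostara actKid.
- by rewrite actKb ostarZ hvc ostarb actKiZ actKic !scalerA mulrC.
- by rewrite actKc ostarZ hc ostarc actKiZ actKib !scalerA mulrC.
- by rewrite actKd ostarZ hc ostard actKia.
- by rewrite actK1 ostar1 actKi1.
- by move=> x y Hx Hy; rewrite actKD !ostarD Hx Hy actKiD.
- by rewrite actKM !ostarM Hx Hy actKiM.
- by rewrite actKZ !ostarZ Hx actKiZ.
Qed.
Lemma star_actKi (x : O) : star (actKi x) = actK (star x).
Proof. by rewrite -{2}[x]actKiK star_actK actKiK. Qed.
Lemma star_actE (x : O) : star (actE x) = (- qC) *: actF (star x).
Proof.
have Q0 := qC_neq0 q.
change (ostar (actE x) = (- qC) *: actF (ostar x)).
elim/Oq_ind: x => [||||||x y Hx Hy|c x Hx].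
- by rewrite actEa ostara actFd scaler0 ostar0.
- rewrite actEb ostarb actFZ actFc !scaler0.
  by rewrite ostar0.
- by rewrite actEc ostarc ostara actFZ actFb scalerA qqV scale1r.
- by rewrite actEd ostard ostarb actFa.
- by rewrite actE1 ostar1 actF1 scaler0 ostar0.
- by move=> x y Hx Hy; rewrite actED !ostarD Hx Hy actFD scalerDr.
- rewrite actEM ostarD !ostarM Hx Hy actFM.
  rewrite [ostar (actK y)]star_actK [ostar (actKi x)]star_actKi.
  by rewrite scalerDr -scalerAl -scalerAr addrC; congr (_ + _).
- by rewrite actEZ !ostarZ Hx actFZ !scalerA mulrC.
Qed.
Lemma star_actF (x : O) : star (actF x) = (- qC^-1) *: actE (star x).
Proof.
have := star_actE (star x); rewrite starK => /(congr1 star).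
rewrite starK starZ conjNqC => ->; rewrite scalerA.
by rewrite [_ * _]qVq scale1r.
Qed.

Fact crossstar_rU f t : crossstar (t * inU f) = inU (star f) * crossstar t.
Proof.
have Q0 := qC_neq0 q.
have gen g : (forall x, crossstar (inO x * inU g) = inU (star g) * inO (star x)) ->
    forall t, crossstar (t * inU g) = inU (star g) * crossstar t.
  move=> H; elim/tensor_ind => [h x||s s' Hs Hs'].
  - rewrite [pure h x]pure_inUO -mulrA !crossstar_lU H crossstar_inO.
    by rewrite mulrA.
  - by rewrite mul0r crossstar0 mulr0.
  - by rewrite mulrDl !crossstarD Hs Hs' mulrDr.
elim/Uq_ind: f t => [||||||f g Hf Hg|c f Hf].
- apply: gen => x.
  rewrite inOE crossstarD !crossstar_lU !crossstar_inO.
  rewrite star_actK star_actE inOZ -scalerAl.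
  rewrite [star (uE q)]ustarE [star Ki]ustarKi inOF inOKi actKiK.
  rewrite act_FKi inOZ -scalerAr -addrA -scalerDl subrr scale0r.
  by rewrite addr0.
- apply: gen => x.
  rewrite inOF crossstarD !crossstar_lU !crossstar_inO.
  rewrite star_actK star_actF inOZ -scalerAl.
  rewrite [star (uF q)]ustarF [star Ki]ustarKi inOE inOKi actKiK.
  rewrite act_EKi inOZ -scalerAr -addrA -scalerDl subrr scale0r.
  by rewrite addr0.
- apply: gen => x; rewrite inOK crossstar_lU crossstar_inO.
  by rewrite star_actK [star K]ustarK inOK actKiK.
- apply: gen => x; rewrite inOKi crossstar_lU crossstar_inO.
  by rewrite star_actKi [star Ki]ustarKi inOKi actKKi.
- by move=> t; rewrite [star (1 : U)]ustar1 inU1 mulr1 mul1r.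
- by move=> f g Hf Hg t; rewrite starD !inUD mulrDr mulrDl crossstarD Hf Hg.
- by move=> t; rewrite starM !inUM mulrA Hg Hf mulrA.
- by move=> t; rewrite starZ !inUZ -scalerAr -scalerAl crossstarZ Hf.
Qed.

Lemma crossstarM s t : crossstar (s * t) = crossstar t * crossstar s.
Proof.
elim/tensor_ind: t => [f x||t t' Ht Ht'].
- rewrite [pure f x]pure_inUO mulrA crossstar_rO crossstar_rU.
  by rewrite -pure_inUO crossstar_pure mulrA.
- by rewrite mulr0 crossstar0 mul0r.
- by rewrite mulrDr !crossstarD Ht Ht' mulrDl.
Qed.
Lemma crossstarK : involutive crossstar.
Proof.
elim/tensor_ind => [f x||t t' Ht Ht'].
- by rewrite crossstar_pure crossstar_rU crossstar_inO !starK -pure_inUO.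
- by rewrite !crossstar0.
- by rewrite !crossstarD Ht Ht'.
Qed.
HB.instance Definition _ := Algebra_isStar.Build C cross
  crossstarK crossstarD crossstarZ crossstarM.
End Cross.

Section Leibniz.
Variables (R : rcfType) (q : qparam R).
Local Notation U := (Uq q).
Local Notation O := (Oq q).
Local Notation UU := (tensAlg (Uq_pres q) (Uq_pres q)).

Fact leib_bal (x y : O) : balanced (fun f1 f2 : U => act x f1 * act y f2).
Proof.
split=> *; rewrite ?actDr ?mulrDl ?mulrDr //.
by rewrite !actZr -scalerAl -scalerAr.
Qed.
Definition leib (x y : O) (w : UU) : O := tlift (fun f1 f2 : U => act x f1 * act y f2) w.
Fact leib_pure x y f1 f2 : leib x y (tpure f1 f2) = act x f1 * act y f2.
Proof. exact: (tlift_pure (leib_bal x y)). Qed.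
Fact leibD x y v w : leib x y (v + w) = leib x y v + leib x y w.
Proof. exact: (tliftD (leib_bal x y)). Qed.
Fact leib0 x y : leib x y 0 = 0. Proof. exact: (tlift0 (leib_bal x y)). Qed.
Fact leibZ x y c w : leib x y (c *: w) = c *: leib x y w.
Proof.
apply: tliftZ; first exact: leib_bal.
by move=> f1 f2; rewrite actZr -scalerAl.
Qed.

Fact act0l (f : U) : act (0 : O) f = 0. Proof. exact: efun0. Qed.

Fact leib_mul (x y : O) (f : U) : act (x * y) f = leib x y (Delta f).
Proof.
elim/Uq_ind: f x y => [||||||f g Hf Hg|c f Hf] x y.
- by rewrite DeltaE leibD !leib_pure !(act_uE, act_uK, act_uKi) actEM.
- by rewrite DeltaF leibD !leib_pure !(act_uF, act_uK, act_uKi) actFM.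
- by rewrite DeltaK leib_pure !act_uK actKM.
- by rewrite DeltaKi leib_pure !act_uKi actKiM.
- by rewrite Delta1 leib_pure !act1.
- by move=> Hx Hy u v; rewrite DeltaD leibD actDr Hx Hy.
- rewrite actM DeltaM Hf.
  elim/tensor_ind: (Delta f : tensor U U) => [f1 f2||v v' Hv Hv']; last 2 first.
  + by rewrite mul0r !leib0 [LHS]act0l.
  + by rewrite mulrDl !leibD actDl Hv Hv'.
  rewrite -[pure f1 f2]/(tpure f1 f2) leib_pure Hg.
  elim/tensor_ind: (Delta g : tensor U U) => [g1 g2||v v' Hv Hv']; last 2 first.
  + by rewrite mulr0 !leib0.
  + by rewrite mulrDr !leibD Hv Hv'.
  by rewrite -[pure g1 g2]/(tpure g1 g2) tpureM !leib_pure !actM.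
- by rewrite DeltaZ leibZ actZr Hf.
Qed.

Lemma actMl (x y : O) (f : U) :
  act (x * y) f =
  \sum_(p <- tseq (Delta f : tensor U U)) act x p.1 * act y p.2.
Proof. exact: leib_mul. Qed.

Lemma act1l (f : U) : act (1 : O) f = eps f *: 1.
Proof.
have h := isUq_eps q.
elim/Uq_ind: f => [||||||f g Hf Hg|c f Hf].
- by rewrite act_uE actE1 [eps _](uliftE h) scale0r.
- by rewrite act_uF actF1 [eps _](uliftF h) scale0r.
- by rewrite act_uK actK1 [eps _](uliftK h) scale1r.
- by rewrite act_uKi actKi1 [eps _](uliftKi h) scale1r.
- by rewrite act1 [eps _](ulift1 h) scale1r.
- by move=> f g Hf Hg; rewrite actDr [eps _](uliftD h) Hf Hg -scalerDl.
- by rewrite actM [eps _](uliftM h) Hf actZl Hg scalerA.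
- by rewrite actZr [eps _](uliftZ h) Hf scalerA.
Qed.
End Leibniz.

Import numFieldNormedType.Exports.
Local Open Scope classical_set_scope.

(* The inner product is linear in its first argument. *)
HB.mixin Record CompleteNormedModule_isHilbert (R : realType) H
    of CompleteNormedModule R[i] H := {
  dot : H -> H -> R[i];
  dotDl : forall x y z, dot (x + y) z = dot x z + dot y z;
  dotZl : forall c x y, dot (c *: x) y = c * dot x y;
  dotC : forall x y, dot x y = (dot y x)^*;
  dotE : forall x, dot x x = `|x| ^+ 2
}.
#[short(type="hilbertType")]
HB.structure Definition Hilbert (R : realType) :=
  {H of CompleteNormedModule R[i] H & CompleteNormedModule_isHilbert R H}.

Definition lin_span (K : pzRingType) (V : lmodType K) (S : set V) : set V :=
  [set v | exists s : seq (K * V),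
     (forall p, p \in s -> S p.2) /\ v = \sum_(p <- s) p.1 *: p.2].

Definition orthonormal_basis (R : realType) (H : hilbertType R) (I : eqType)
    (e : I -> H) : Prop :=
  (forall i j, dot (e i) (e j) = (i == j)%:R) /\ dense (lin_span (range e)).

(* Families of operators on a common domain [rdom]; the values of [rop] outside
   of [rdom] are irrelevant. *)
Record opRep (R : realType) (X : Type) (H : hilbertType R) := OpRep {
  rdom : set H;
  rop :> X -> H -> H
}.
Arguments OpRep {R X H}.

Record star_rep (R : realType) (X : starAlgType R[i]) (H : hilbertType R)
    (rho : opRep X H) : Prop := StarRep {
  star_rep_dom0 : rdom rho 0;
  star_rep_domL : forall c u v, rdom rho u -> rdom rho v -> rdom rho (c *: u + v);
  star_rep_dense : dense (rdom rho);
  star_rep_stable : forall x u, rdom rho u -> rdom rho (rho x u);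
  star_rep_linear : forall x c u v, rdom rho u -> rdom rho v ->
    rho x (c *: u + v) = c *: rho x u + rho x v;
  star_rep1 : forall u, rdom rho u -> rho 1 u = u;
  star_repD : forall x y u, rdom rho u -> rho (x + y) u = rho x u + rho y u;
  star_repZ : forall c x u, rdom rho u -> rho (c *: x) u = c *: rho x u;
  star_repM : forall x y u, rdom rho u -> rho (x * y) u = rho x (rho y u);
  star_rep_adj : forall x u v, rdom rho u -> rdom rho v ->
    dot (rho x u) v = dot u (rho (star x) v)
}.

(* Unbounded operators are represented by their graphs; the graph of the closure
   is the closure of the graph in H x H. *)
Definition op_graph (R : realType) (X : Type) (H : hilbertType R)
    (rho : opRep X H) (x : X) : set (H * H) :=
  [set p | rdom rho p.1 /\ p.2 = rho x p.1].

Definition rep_closure (R : realType) (X : Type) (H : hilbertType R)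
    (rho : opRep X H) : opRep X H :=
  OpRep [set u | forall x, exists w, closure (op_graph rho x) (u, w)]
        (fun x u => xget 0 [set w | closure (op_graph rho x) (u, w)]).

Definition unitary_equiv (R : realType) (X : Type) (H1 H2 : hilbertType R)
    (rho1 : opRep X H1) (rho2 : opRep X H2) : Prop :=
  exists W : H1 -> H2,
    [/\ linear W, (forall u v, dot (W u) (W v) = dot u v),
        range W = [set: H2], W @` rdom rho1 = rdom rho2 &
        forall x u, rdom rho1 u -> rho2 x (W u) = W (rho1 x u)].

Section Heisenberg.
Variables (R : realType) (q : qparam R).

Definition haar (h : Oq q -> R[i]) : Prop :=
  [/\ (forall c x y, h (c *: x + y) = c * h x + h y), h 1 = 1 &
      forall x f, h (act x f) = eps f * h x].

Definition is_GNS (h : Oq q -> R[i]) (H : hilbertType R)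
    (pih : opRep (Oq q) H) (vh : H) : Prop :=
  [/\ star_rep pih, rdom pih vh, rdom pih = range (fun x => pih x vh) &
      forall x, h x = dot (pih x vh) vh].

(* [rho] is the Heisenberg representation, realized on the GNS space of the
   invariant functional. *)
Definition heisenberg (H : hilbertType R) (rho : opRep (cross q) H) : Prop :=
  exists (h : Oq q -> R[i]) (pih : opRep (Oq q) H) (vh : H)
         (pit : opRep (cross q) H),
    [/\ haar h, is_GNS h pih vh,
        [/\ star_rep pit, rdom pit = rdom pih,
            (forall x u, rdom pih u -> pit (inO x) u = pih x u) &
            forall f x, pit (inU f) (pih x vh) = pih (act x (antipodeV f)) vh] &
        rho = rep_closure pit].
End Heisenberg.

Section I11.
Variables (R : realType) (q : qparam R) (H : hilbertType R).
Variable eta : nat * nat * int -> H.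
Local Notation C := R[i].
Local Notation qC := (qC q).
Local Notation lam := (lam q).
(* q ^ (m / 2) *)
Local Notation qh m := (qhalf q ^ m%R).

Definition lamn (n : nat) : C := (Num.sqrt (1 - (qval q) ^+ (2 * n)))%:C%C.

(* The truncation of n - 1 and k - 1 at 0 is harmless, since [lamn 0 = 0]. *)
Definition I11_E (i : nat * nat * int) : H :=
  let: (n, k, l) := i in
  (qh (- (n%:Z - l + 1)) * lamn k.+1 * lam^-1) *: eta (n, k.+1, l) +
  (qh (- (n%:Z + 2 * k%:Z + l + 1)) * lamn n * lam^-1) *: eta (n.-1, k, l + 1).
Definition I11_F (i : nat * nat * int) : H :=
  let: (n, k, l) := i in
  (qh (- (n%:Z - l + 1)) * lamn k * lam^-1) *: eta (n, k.-1, l) +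
  (qh (- (n%:Z + 2 * k%:Z + l + 1)) * lamn n.+1 * lam^-1) *: eta (n.+1, k, l - 1).
Definition I11_K (i : nat * nat * int) : H :=
  let: (n, k, l) := i in qh (- n%:Z + 2 * k%:Z + l) *: eta i.
Definition I11_Ki (i : nat * nat * int) : H :=
  let: (n, k, l) := i in qh (- (- n%:Z + 2 * k%:Z + l)) *: eta i.

(* The graph of the linear operator with domain Lin{eta_nkl} that maps eta_i to
   [f i]. *)
Definition basis_op (f : nat * nat * int -> H) : set (H * H) :=
  lin_span (range (fun i => (eta i, f i))).

(* The representation of O(SU_q(2)) by bounded operators on H given by the
   formulas for a, b, c, d. *)
Record I11_bounded (rho : Oq q -> H -> H) : Prop := I11Bounded {
  I11_linear : forall x, linear (rho x);
  I11_bound : forall x, exists M : C, forall u, `|rho x u| <= M * `|u|;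
  I11_1 : forall u, rho 1 u = u;
  I11_D : forall x y u, rho (x + y) u = rho x u + rho y u;
  I11_Z : forall c x u, rho (c *: x) u = c *: rho x u;
  I11_M : forall x y u, rho (x * y) u = rho x (rho y u);
  I11_a : forall n k l, rho (oa q) (eta (n, k, l)) = lamn n *: eta (n.-1, k, l);
  I11_d : forall n k l, rho (od q) (eta (n, k, l)) = lamn n.+1 *: eta (n.+1, k, l);
  I11_b : forall n k l, rho (ob q) (eta (n, k, l)) = qC ^+ n.+1 *: eta (n, k, l + 1);
  I11_c : forall n k l, rho (oc q) (eta (n, k, l)) = - (qC ^+ n) *: eta (n, k, l - 1)
}.

Definition v0 : H :=
  limn (series (fun n : nat => (- qC) ^+ n *: eta (n, n, - n%:Z))).

Record extends_I11 (rho : Oq q -> H -> H) (D : set H) (pi : cross q -> H -> H)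
    : Prop := ExtendsI11 {
  ext_E : forall u, D u -> closure (basis_op I11_E) (u, pi (inU (uE q)) u);
  ext_F : forall u, D u -> closure (basis_op I11_F) (u, pi (inU (uF q)) u);
  ext_K : forall u, D u -> closure (basis_op I11_K) (u, pi (inU (uK q)) u);
  ext_Ki : forall u, D u -> closure (basis_op I11_Ki) (u, pi (inU (uKi q)) u);
  ext_O : forall x u, D u -> pi (inO x) u = rho x u
}.
End I11.

(* Main.v *)
(** The vector [v0] behaves like the constant function 1: it is annihilated by
   the closures of E and F and fixed by that of K.  Indeed [E v0] and [F v0]
   telescope formally; the partial sums stay bounded and pairwise orthogonal, so
   their Cesaro means tend to 0.  The cross relations then give
   [(x v0, (x <| S^-1(f)) v0)] in the graph of the closure of each generator f.
   Since E and F are formally adjoint, these closures are graphs of operators,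
   and [f (x v0) = (x <| S^-1(f)) v0] defines the representation and determines
   it.  Adjointness also makes [x |-> <x v0, v0>] invariant under the action, so
   it is a multiple of the Haar functional, whence [x v0 |-> |v0| x v_h] is
   isometric and intertwines the two representations.  Density of the orbit of
   [v0] holds because [b c] is diagonal with eigenvalues [-q^(2n+1)], so that its
   powers isolate the terms of the series [v0] one after the other. *)
Require Import Defs.
From HB Require Import structures.
From mathcomp Require Import all_boot all_order all_algebra complex.
From mathcomp Require Import all_classical all_reals all_analysis.
From mathcomp Require Import ring.
Set Implicit Arguments.
Unset Strict Implicit.
Unset Printing Implicit Defensive.
Import Order.TTheory GRing.Theory Num.Theory numFieldNormedType.Exports.
Local Open Scope classical_set_scope.
Local Open Scope ring_scope.

(** * Invariant functionals on O(SU_q(2)) *)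

(** The cross relations turn [E x] into [(x <| K^-1) E - q^-1 (x <| E) K^-1]. Multiplying
    approximations of [v0] by [x] therefore gives a limit in the graph of [E] only if they converge
    in the graphs of [E] and [K^-1] simultaneously. This is why closures are taken of sets of
    triples [(u, f u, K^-1 u)]. On such triples each [x] acts by a continuous linear map, and
    stability under it has to be computed only for [a], [b], [c], [d] on basis vectors. The
    constants [-q^-1] for [E] and [-q] for [F] in these maps are the factors by which [S^-1]
    multiplies the two generators.

    It is not known beforehand that [x v0] determines [x]. The formula for [f (x v0)] is
    nevertheless meaningful, because a closed graph that belongs to an operator contains no pair
    [(0, w)] with [w] nonzero.

    The Haar functional enters only through its uniqueness: two invariant functionals that agree at
    [1] are equal. This is proved on spanning monomials, and their linear independence never comes
    up. *)

Section OqMonomials.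
Variables (R : rcfType) (q : qparam R).
Local Notation C := R[i].
Local Notation Q := (qC q).
Local Notation h := (qhalf q).
Local Notation a := (oa q).
Local Notation b := (ob q).
Local Notation c := (oc q).
Local Notation d := (od q).
Implicit Types x y : Oq q.

Lemma qcommX (A : algType C) (x y : A) (s : C) n :
  x * y = s *: (y * x) -> x * y ^+ n = s ^+ n *: (y ^+ n * x).
Proof.
move=> xy; elim: n => [|n IH]; first by rewrite !expr0 mul1r mulr1 scale1r.
by rewrite [in LHS]exprSr mulrA IH -scalerAl -mulrA xy -scalerAr scalerA mulrA -!exprSr.
Qed.

Lemma qhalf_gt0 : 0 < h.
Proof. by rewrite /qhalf ltcR sqrtr_gt0 qval_gt0. Qed.
Lemma qC_gt0 : 0 < Q.
Proof. by rewrite /qC ltcR qval_gt0. Qed.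

Lemma od_ob : d * b = Q^-1 *: (b * d).
Proof. by rewrite (isOq_bd (oP q)) scalerA mulVf ?qC_neq0 // scale1r. Qed.
Lemma od_oc : d * c = Q^-1 *: (c * d).
Proof. by rewrite (isOq_cd (oP q)) scalerA mulVf ?qC_neq0 // scale1r. Qed.
Lemma oa_od : a * d = 1 + Q *: (b * c).
Proof. by have /eqP := isOq_det (oP q); rewrite subr_eq => /eqP. Qed.
Lemma od_oa : d * a = 1 + Q^-1 *: (b * c).
Proof.
have -> : d * a = a * d - lam q *: (b * c) by rewrite -(isOq_ad_da (oP q)) subKr.
rewrite oa_od -addrA -scalerBl; congr (_ + _ *: _).
by rewrite /lam opprB addrC subrK.
Qed.
Lemma ob_oc_expr j k : b ^+ j * c ^+ k * (b * c) = b ^+ j.+1 * c ^+ k.+1.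
Proof.
have bc : GRing.comm b c := isOq_bc (oP q).
rewrite -mulrA [c ^+ k * _]mulrA -(commrX k bc) -mulrA -exprSr !mulrA.
by rewrite -exprSr.
Qed.

Definition monA j k i : Oq q := b ^+ j * c ^+ k * a ^+ i.
Definition monD j k i : Oq q := b ^+ j * c ^+ k * d ^+ i.

Lemma oa_bc j k : a * (b ^+ j * c ^+ k) = Q ^+ (j + k) *: (b ^+ j * c ^+ k * a).
Proof.
rewrite mulrA (qcommX _ (isOq_ab (oP q))) -scalerAl -[_ * a * _]mulrA.
by rewrite (qcommX _ (isOq_ac (oP q))) -scalerAr scalerA exprD mulrA.
Qed.
Lemma od_bc j k : d * (b ^+ j * c ^+ k) = Q^-1 ^+ (j + k) *: (b ^+ j * c ^+ k * d).
Proof.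
by rewrite mulrA (qcommX _ od_ob) -scalerAl -[_ * d * _]mulrA (qcommX _ od_oc) -scalerAr
  scalerA exprD mulrA.
Qed.

Section Span.
Variable g : Oq q -> C.
Hypothesis gL : forall s x y, g (s *: x + y) = s * g x + g y.
Lemma lfun_0 : g 0 = 0.
Proof. by have := gL (-1) 0 0; rewrite scaler0 addr0 mulN1r addNr. Qed.
Lemma lfun_D x y : g (x + y) = g x + g y.
Proof. by rewrite -[x]scale1r gL mul1r scale1r. Qed.
Lemma lfun_Z s x : g (s *: x) = s * g x.
Proof. by rewrite -[s *: x]addr0 gL lfun_0 addr0. Qed.
End Span.

(** The span of the monomials contains [1] and is stable under left multiplication by each
    generator, since [ad] and [da] are [1] plus a multiple of [bc]. Testing with functionals avoids
    explicit linear combinations. *)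
Lemma monomials_span x (g : Oq q -> C) :
  (forall s x y, g (s *: x + y) = s * g x + g y) ->
  (forall j k i, g (monA j k i) = 0) -> (forall j k i, g (monD j k i) = 0) ->
  g x = 0.
Proof.
move: g.
(* [S y] expresses that [y] lies in the span of the monomials. [gen] below reduces stability under
   [z] to monomials by applying [S y] to the functional [y |-> g (z * y)]. *)
pose S y := forall g : Oq q -> C,
  (forall s x y, g (s *: x + y) = s * g x + g y) ->
  (forall j k i, g (monA j k i) = 0) -> (forall j k i, g (monD j k i) = 0) ->
  g y = 0.
have S1 : S 1.
  by move=> g _ gA _; have := gA 0%N 0%N 0%N; rewrite /monA !expr0 !mulr1.
have gen z : (forall g : Oq q -> C,
    (forall s x y, g (s *: x + y) = s * g x + g y) ->
    (forall j k i, g (monA j k i) = 0) -> (forall j k i, g (monD j k i) = 0) ->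
    (forall j k i, g (z * monA j k i) = 0) /\
    (forall j k i, g (z * monD j k i) = 0)) -> forall y, S y -> S (z * y).
  move=> H y Sy g gL gA gD; have [gA' gD'] := H g gL gA gD.
  apply: (Sy (fun y => g (z * y))) => // s u v.
  by rewrite mulrDr -scalerAr gL.
suff H : forall y, S y -> S (x * y) by move=> g; have := H 1 S1; rewrite mulr1; apply.
elim/Oq_ind: x => [||||||x y Hx Hy|s x Hx].
- apply: gen => g gL gA gD; split=> j k i; rewrite /monA /monD.
  + by rewrite mulrA oa_bc -scalerAl -[_ * a * _]mulrA -exprS (lfun_Z gL) [g _]gA mulr0.
  + rewrite mulrA oa_bc -scalerAl -[_ * a * _]mulrA (lfun_Z gL).
    case: i => [|i]; first by rewrite expr0 mulr1 -[a]expr1 [g _]gA mulr0.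
    rewrite exprS [a * _]mulrA oa_od mulrDl mul1r mulrDr -scalerAl -scalerAr.
    by rewrite mulrA ob_oc_expr (lfun_D gL) (lfun_Z gL) !gD mulr0 addr0 mulr0.
- by apply: gen => g gL gA gD; split=> j k i; rewrite !mulrA -exprS;
    [exact: gA|exact: gD].
- have cb j k : c * (b ^+ j * c ^+ k) = b ^+ j * c ^+ k.+1.
    have bc : GRing.comm c b := esym (isOq_bc (oP q)).
    by rewrite mulrA (commrX j bc) -mulrA -exprS.
  by apply: gen => g gL gA gD; split=> j k i; rewrite mulrA cb;
    [exact: gA|exact: gD].
- apply: gen => g gL gA gD; split=> j k i; rewrite /monA /monD.
  + rewrite mulrA od_bc -scalerAl -[_ * d * _]mulrA (lfun_Z gL).
    case: i => [|i]; first by rewrite expr0 mulr1 -[d]expr1 [g _]gD mulr0.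
    rewrite exprS [d * _]mulrA od_oa mulrDl mul1r mulrDr -scalerAl -scalerAr.
    by rewrite mulrA ob_oc_expr (lfun_D gL) (lfun_Z gL) !gA mulr0 addr0 mulr0.
  + by rewrite mulrA od_bc -scalerAl -[_ * d * _]mulrA -exprS (lfun_Z gL) [g _]gD mulr0.
- by move=> y; rewrite mul1r.
- move=> x y Hx Hy z Sz g gL gA gD.
  by rewrite mulrDl (lfun_D gL) Hx // Hy // addr0.
- by move=> z Sz; rewrite -mulrA; apply/Hx/Hy.
- by move=> z Sz g gL gA gD; rewrite -scalerAl (lfun_Z gL) Hx // mulr0.
Qed.

Lemma actKX x n : actK (x ^+ n) = actK x ^+ n.
Proof. by elim: n => [|n IH]; rewrite ?expr0 ?actK1 // !exprS actKM IH. Qed.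
Lemma actKiX x n : actKi (x ^+ n) = actKi x ^+ n.
Proof. by elim: n => [|n IH]; rewrite ?expr0 ?actKi1 // !exprS actKiM IH. Qed.
Lemma actEX0 x n : actE x = 0 -> actE (x ^+ n) = 0.
Proof.
move=> x0; elim: n => [|n IH]; rewrite ?expr0 ?actE1 // exprS actEM IH x0.
by rewrite mul0r mulr0 addr0.
Qed.
Lemma actFX0 x n : actF x = 0 -> actF (x ^+ n) = 0.
Proof.
move=> x0; elim: n => [|n IH]; rewrite ?expr0 ?actF1 // exprS actFM IH x0.
by rewrite mul0r mulr0 addr0.
Qed.

(** The coefficient is a power of [q^(1/2)] times the q-integer [[n+1]]. Its recursion only adds
    positive numbers, and positivity is all that later divisions require. *)
Lemma actE_oc_expr n : exists2 e : C, 0 < e & actE (c ^+ n.+1) = e *: (c ^+ n * a).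
Proof.
elim: n => [|n [e e0 IH]].
  by exists 1; rewrite ?ltr01 // expr1 actEc expr0 mul1r scale1r.
pose s := e * h * Q + h^-1 ^+ n.+1; exists s; first last.
  rewrite exprSr actEM IH actKc actEc actKiX actKic exprZn -!scalerAl -!scalerAr.
  rewrite scalerA -mulrA (isOq_ac (oP q)) -scalerAr scalerA mulrA -exprSr.
  by rewrite -scalerDl.
have h0 := qhalf_gt0; have Q0 := qC_gt0.
by rewrite /s addr_gt0 ?mulr_gt0 ?exprn_gt0 ?invr_gt0.
Qed.

Lemma actF_ob_expr n : exists2 e : C, 0 < e & actF (b ^+ n.+1) = e *: (b ^+ n * d).
Proof.
elim: n => [|n [e e0 IH]].
  by exists 1; rewrite ?ltr01 // expr1 actFb expr0 mul1r scale1r.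
pose s := e * h^-1 * Q^-1 + h ^+ n.+1; exists s; first last.
  rewrite exprSr actFM IH actKb actFb actKiX actKib exprZn -!scalerAl -!scalerAr.
  rewrite scalerA -mulrA od_ob -scalerAr scalerA mulrA -exprSr.
  by rewrite -scalerDl.
have h0 := qhalf_gt0; have Q0 := qC_gt0.
by rewrite /s addr_gt0 ?mulr_gt0 ?exprn_gt0 ?invr_gt0.
Qed.

Lemma actE_bc j k : exists2 e : C, 0 < e &
  actE (b ^+ j * c ^+ k.+1) = e *: (b ^+ j * c ^+ k * a).
Proof.
have [e e0 ce] := actE_oc_expr k; exists (h ^+ j * e).
  by rewrite mulr_gt0 ?exprn_gt0 ?qhalf_gt0.
rewrite actEM (actEX0 _ (actEb q)) mul0r add0r ce actKiX actKib exprZn.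
by rewrite -scalerAl -scalerAr scalerA mulrA.
Qed.

(* Every monomial containing [a] lies in the image of E and every monomial
   containing [d] lies in the image of F; the powers of [bc] are related by
   [actE (b ^+ j * c ^+ j.+1 * d)]. *)
Lemma invariant_functional_eq0 (g : Oq q -> C) :
  (forall s x y, g (s *: x + y) = s * g x + g y) ->
  (forall x, g (actE x) = 0) -> (forall x, g (actF x) = 0) ->
  (forall x, g (actK x) = g x) -> g 1 = 0 -> forall x, g x = 0.
Proof.
move=> gL gE gF gK g1 x.
have h0 := qhalf_gt0; have Q0 := qC_gt0.
have gZ0 s y : s != 0 -> g (s *: y) = 0 -> g y = 0.
  by move=> s0 /eqP; rewrite (lfun_Z gL) mulf_eq0 (negPf s0) => /eqP.
have gA j k i : g (monA j k i.+1) = 0.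
  have [e e0 be] := actE_bc j k.
  have := gE (b ^+ j * c ^+ k.+1 * a ^+ i).
  rewrite actEM be (actEX0 _ (actEa q)) mulr0 addr0 actKX actKa exprZn.
  rewrite -scalerAl -scalerAr scalerA -[_ * a * _]mulrA -exprS => /gZ0; apply.
  by rewrite gt_eqF // mulr_gt0 ?exprn_gt0 ?invr_gt0.
have gD j k i : g (monD j k i.+1) = 0.
  have [e e0 be] := actF_ob_expr j.
  (* [F] kills [c] and [d], so only the power of [b] contributes; the [d] that it produces is then
     moved to the right past [c ^+ k]. *)
  have := gF (b ^+ j.+1 * (c ^+ k * d ^+ i)).
  rewrite !actFM be (actFX0 _ (actFc q)) (actFX0 _ (actFd q)).
  rewrite mul0r mulr0 addr0 mulr0 addr0 actKM !actKX actKc actKd !exprZn.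
  rewrite -!scalerAl -!scalerAr !scalerA -[b ^+ j * d * _]mulrA.
  rewrite [d * _]mulrA (qcommX _ od_oc) -scalerAl -scalerAr scalerA.
  rewrite -[_ * d * _]mulrA -exprS [_ ^+ j * _]mulrA.
  by move=> /gZ0; apply; rewrite gt_eqF // !mulr_gt0 ?exprn_gt0 ?invr_gt0.
have gbb j : g (b ^+ j * c ^+ j) = 0.
  elim: j => [|j IH]; first by rewrite !expr0 mulr1.
  have [e e0 be] := actE_bc j j.
  (* After [ad = 1 + q bc] this is a combination of [b^j c^j] and [b^(j+1) c^(j+1)] whose second
     coefficient is positive, so vanishing passes from [j] to [j.+1]. *)
  have := gE (b ^+ j * c ^+ j.+1 * d).
  rewrite actEM be actEd actKd actKiM !actKiX actKib actKic !exprZn.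
  rewrite -?scalerAl -?scalerAr -?scalerAl ?scalerA -[_ * a * d]mulrA oa_od mulrDr mulr1.
  rewrite -scalerAr ob_oc_expr scalerDr.
  have -> : b ^+ j * c ^+ j.+1 * b = b ^+ j.+1 * c ^+ j.+1.
    have cb : GRing.comm b c := isOq_bc (oP q).
    by rewrite -mulrA -(commrX j.+1 cb) mulrA -exprSr.
  rewrite scalerA -addrA -scalerDl gL IH mulr0 add0r => /gZ0; apply.
  by rewrite gt_eqF // addr_gt0 // !mulr_gt0 ?exprn_gt0 ?invr_gt0.
have gb j k : g (b ^+ j * c ^+ k) = 0.
  have [->|jk] := eqVneq j k; first exact: gbb.
  (* [K] multiplies this monomial by [q^((k-j)/2)], which differs from [1] when [j] and [k]
     differ. *)
  have /eqP := gK (b ^+ j * c ^+ k).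
  rewrite actKM !actKX actKb actKc !exprZn -scalerAl -scalerAr scalerA (lfun_Z gL).
  rewrite -subr_eq0 -[X in _ - X]mul1r -mulrBl mulf_eq0 => /orP[|/eqP //].
  rewrite subr_eq0 exprVn => /eqP /(congr1 ( *%R (h ^+ j))).
  rewrite mulrA mulfV ?expf_neq0 ?gt_eqF // mul1r mulr1 => kj.
  have h1 : h < 1.
    by rewrite /qhalf -[1]/(1%:C%C) ltcR -sqrtr1 ltr_sqrt ?ltr01 // qval_lt1.
  have : h != 1 by rewrite lt_eqF.
  by move=> /(ieexprIn h0)/(_ _ _ kj) kj'; rewrite kj' eqxx in jk.
apply: monomials_span => // j k [|i] //; by rewrite /monA /monD expr0 mulr1.
Qed.
End OqMonomials.

(** * The action of the cross product algebra on O(SU_q(2)) *)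

Section CrossAction.
Variables (R : rcfType) (q : qparam R).
Local Notation U := (Uq q).
Local Notation O := (Oq q).

(* The Heisenberg representation, with [y] in place of [y v_h]. *)
Definition crossact (t : cross q) (y : O) : O :=
  tlift (fun (f : U) (x : O) => act (x * y) (antipodeV f)) t.

Lemma crossact_bal y : balanced (fun (f : U) (x : O) => act (x * y) (antipodeV f)).
Proof.
split=> *.
- by rewrite antipodeVD actDr.
- by rewrite mulrDl actDl.
- by rewrite antipodeVZ actZr -scalerAl actZl.
Qed.
Lemma crossact_pure f x y : crossact (pure f x) y = act (x * y) (antipodeV f).
Proof. exact: (tlift_pure (crossact_bal y)). Qed.
Lemma crossactD s t y : crossact (s + t) y = crossact s y + crossact t y.
Proof. exact: (tliftD (crossact_bal y)). Qed.
Lemma crossact0 y : crossact 0 y = 0.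
Proof. exact: (tlift0 (crossact_bal y)). Qed.
Lemma crossactZ s t y : crossact (s *: t) y = s *: crossact t y.
Proof.
apply: tliftZ; first exact: crossact_bal.
by move=> f x; rewrite antipodeVZ actZr.
Qed.
Lemma crossactL t s x y : crossact t (s *: x + y) = s *: crossact t x + crossact t y.
Proof.
elim/tensor_ind: t => [f z||t t' Ht Ht'].
- by rewrite !crossact_pure mulrDr -scalerAr actDl actZl.
- by rewrite !crossact0 scaler0 addr0.
- by rewrite !crossactD Ht Ht' scalerDr addrACA.
Qed.

Lemma crossact0r t : crossact t 0 = 0.
Proof. by have := crossactL t (-1) 0 0; rewrite scaler0 addr0 scaleN1r addNr. Qed.

Lemma crossact_inU f y : crossact (inU f) y = act y (antipodeV f).
Proof. by rewrite crossact_pure mul1r. Qed.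
Lemma crossact_inO x y : crossact (inO x) y = x * y.
Proof. by rewrite crossact_pure antipodeV1 act1. Qed.
Lemma crossact1 y : crossact 1 y = y.
Proof. by rewrite -[1]/(inO 1) crossact_inO mul1r. Qed.

Lemma antipodeV_uE : antipodeV (uE q) = (- (qC q)^-1) *: uE q.
Proof. by rewrite [antipodeV _](uliftE (isUq_antipode q (qVq q))). Qed.
Lemma antipodeV_uF : antipodeV (uF q) = (- qC q) *: uF q.
Proof. by rewrite [antipodeV _](uliftF (isUq_antipode q (qVq q))). Qed.
Lemma antipodeV_uK : antipodeV (uK q) = uKi q.
Proof. by rewrite [antipodeV _](uliftK (isUq_antipode q (qVq q))). Qed.
Lemma antipodeV_uKi : antipodeV (uKi q) = uK q.
Proof. by rewrite [antipodeV _](uliftKi (isUq_antipode q (qVq q))). Qed.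

Lemma crossact_uE y : crossact (inU (uE q)) y = (- (qC q)^-1) *: actE y.
Proof. by rewrite crossact_inU antipodeV_uE actZr act_uE. Qed.
Lemma crossact_uF y : crossact (inU (uF q)) y = (- qC q) *: actF y.
Proof. by rewrite crossact_inU antipodeV_uF actZr act_uF. Qed.
Lemma crossact_uK y : crossact (inU (uK q)) y = actKi y.
Proof. by rewrite crossact_inU antipodeV_uK act_uKi. Qed.
Lemma crossact_uKi y : crossact (inU (uKi q)) y = actK y.
Proof. by rewrite crossact_inU antipodeV_uKi act_uK. Qed.

Lemma crossact_lU f t y : crossact (inU f * t) y = crossact (inU f) (crossact t y).
Proof.
elim/tensor_ind: t => [g x||t t' Ht Ht'].
- rewrite [pure g x]pure_inUO mulrA -inUM -!pure_inUO crossact_inU !crossact_pure.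
  by rewrite antipodeVM actM.
- by rewrite mulr0 !crossact0 crossact_inU act0l.
- by rewrite mulrDr !crossactD Ht Ht' !crossact_inU actDl.
Qed.

Lemma crossact_rO t x y : crossact (t * inO x) y = crossact t (x * y).
Proof.
elim/tensor_ind: t => [g z||t t' Ht Ht'].
- by rewrite mul_inO !crossact_pure mulrA.
- by rewrite mul0r !crossact0.
- by rewrite mulrDl !crossactD Ht Ht'.
Qed.

(** Here the cross relations meet the action. For [E] and [F], the term with [x <| f] coming from
    the cross relation cancels the one coming from the Leibniz rule; the factor in [S^-1(f)] is
    exactly what makes this happen. *)
Lemma crossact_rU t f y : crossact (t * inU f) y = crossact t (crossact (inU f) y).
Proof.
have Q0 := qC_neq0 q.
have gen g : (forall x y, crossact (inO x * inU g) y = x * crossact (inU g) y) ->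
    forall t y, crossact (t * inU g) y = crossact t (crossact (inU g) y).
  move=> H t' y'; elim/tensor_ind: t' => [g' x||s s' Hs Hs'].
  - rewrite [pure g' x]pure_inUO -mulrA !crossact_lU H.
    by rewrite crossact_inO.
  - by rewrite mul0r !crossact0.
  - by rewrite mulrDl !crossactD Hs Hs'.
elim/Uq_ind: f t y => [||||||f g Hf Hg|s f Hf].
- apply: gen => x y; rewrite inOE crossactD !crossact_lU !crossact_inO.
  rewrite !crossact_uE crossact_uKi actEM act_EK actKKi actKM -scalerAl scalerDr.
  rewrite scalerA mulNr mulVf // scaleN1r addrAC addNr add0r.
  by rewrite scalerAr.
- apply: gen => x y; rewrite inOF crossactD !crossact_lU !crossact_inO.
  rewrite !crossact_uF crossact_uKi actFM act_FK actKKi actKM -scalerAl scalerDr.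
  rewrite scalerA mulNr mulfV // scaleN1r addrAC addNr add0r.
  by rewrite scalerAr.
- apply: gen => x y; rewrite inOK crossact_lU !crossact_uK crossact_inO.
  by rewrite actKiM actKKi.
- apply: gen => x y; rewrite inOKi crossact_lU !crossact_uKi crossact_inO.
  by rewrite actKM actKiK.
- by move=> t y; rewrite mulr1 crossact1.
- move=> f g Hf Hg t y; rewrite inUD mulrDr !crossactD Hf Hg.
  by rewrite -[crossact t _]scale1r -crossactL scale1r.
- by move=> t y; rewrite inUM mulrA Hg Hf -crossact_lU.
- move=> t y; rewrite inUZ -scalerAr !crossactZ Hf.
  have := crossactL t s (crossact (inU f) y) 0.
  by rewrite crossact0r !addr0.
Qed.

Lemma crossactM s t y : crossact (s * t) y = crossact s (crossact t y).
Proof.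
elim/tensor_ind: t y => [f x||t t' Ht Ht'] y.
- by rewrite [pure f x]pure_inUO mulrA !crossact_rO crossact_rU.
- by rewrite mulr0 !crossact0 crossact0r.
- by rewrite mulrDr !crossactD Ht Ht' -[crossact s _]scale1r -crossactL scale1r.
Qed.
End CrossAction.

(** * Closures in Hilbert spaces *)

Section Closure.

Lemma closure_image (T U : topologicalType) (f : T -> U) (A : set T) (B : set U) :
  continuous f -> (forall x, A x -> B (f x)) ->
  forall x, closure A x -> closure B (f x).
Proof.
move=> fc AB x Ax V /fc /Ax [y [Ay Vy]].
by exists (f y); split => //; apply: AB.
Qed.

Lemma pair_continuous (T U V : topologicalType) (f : T -> U) (g : T -> V) :
  continuous f -> continuous g -> continuous (fun x => (f x, g x)).
Proof. by move=> fc gc x; exact: (cvg_pair (fc x) (gc x)). Qed.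

Lemma denseP (T : topologicalType) (A : set T) :
  dense A <-> forall x, closure A x.
Proof.
split=> [dA x|cA O [x Ox] oO].
  rewrite closureEonbhs => B C BA [oC Cx].
  by have [y [Cy Ay]] := dA C (ex_intro _ x Cx) oC; exists y; split=> //; apply: BA.
by have [y [Ay Oy]] := cA x O (open_nbhs_nbhs (conj oO Ox)); exists y.
Qed.

Lemma eq_closure (T : topologicalType) (K : numFieldType) (V : normedModType K)
    (f g : T -> V) (A : set T) :
  continuous f -> continuous g -> (forall x, A x -> f x = g x) ->
  forall x, closure A x -> f x = g x.
Proof.
move=> fc gc fg x Ax.
have kc : continuous (fun x => f x - g x).
  by move=> y; apply: cvgB; [exact: fc|exact: gc].
have : closure [set (0 : V)] (f x - g x).
  by apply: (closure_image kc) Ax => y /fg ->; rewrite subrr.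
have -> : closure [set (0 : V)] = [set 0].
  apply/esym/closure_id/accessible_closed_set1/hausdorff_accessible.
  exact: norm_hausdorff.
by move=> /eqP; rewrite subr_eq0 => /eqP.
Qed.

Variables (K : numFieldType) (V : normedModType K).

Lemma closure_linear (A : set V) :
  (forall c u v, A u -> A v -> A (c *: u + v)) ->
  forall c u v, closure A u -> closure A v -> closure A (c *: u + v).
Proof.
move=> AL c u v Au Av.
have H w : A w -> closure A (c *: u + w).
  move=> Aw; apply: (closure_image (f := fun u => c *: u + w)) Au.
    by move=> x; apply: cvgD; [apply: cvgZ; [exact: cvg_cst|exact: cvg_id]|exact: cvg_cst].
  by move=> x Ax; apply: AL.
have : closure (closure A) (c *: u + v).
  apply: (closure_image (f := fun w => c *: u + w)) Av => //.
  by move=> x; apply: cvgD; [exact: cvg_cst|exact: cvg_id].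
by have [/(_ (@closed_closure _ A)) <- _] := closure_id (closure A).
Qed.

Lemma closure_normP (A : set V) u :
  closure A u <-> forall e : K, 0 < e -> exists2 v, A v & `|u - v| < e.
Proof.
split=> [Au e e0|H B].
  have [v [Av]] := Au _ (nbhsx_ballx u _ e0).
  by rewrite -ball_normE /=; exists v.
rewrite -nbhs_ballE => -[e /= e0 eB]; have [v Av uv] := H e e0.
by exists v; split=> //; apply: eB; rewrite -ball_normE.
Qed.

Lemma linear_bounded_cts (W : normedModType K) (f : V -> W) M :
  linear f -> (forall u, `|f u| <= M * `|u|) -> continuous f.
Proof.
move=> fL fM u.
have M1 : 0 < `|M| + 1 by rewrite ltr_wpDl ?ltr01.
apply/cvgrPdist_lt => e e0; near=> v.
have -> : f u - f v = f (u - v).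
  by rewrite -[u - v]addrC -[- v]scaleN1r fL scaleN1r addrC.
apply: (le_lt_trans (fM _)).
have -> : M * `|u - v| = `|M| * `|u - v|.
  rewrite -[in RHS](normr_id (u - v)) -normrM ger0_norm //.
  exact: le_trans (normr_ge0 _) (fM _).
apply: (@le_lt_trans _ _ ((`|M| + 1) * `|u - v|)).
  by rewrite ler_wpM2r // lerDl.
rewrite mulrC -ltr_pdivlMr //.
near: v; apply: cvgr_dist_lt => //; first exact: divr_gt0.
Unshelve. all: by end_near. Qed.

(** This is the polarization formula with free constants. It gives continuity of the inner product
    from that of the norm, without the Cauchy-Schwarz inequality. *)
Lemma polarization_continuous (c i : K) (v w : V) :
  continuous (fun u : V => c * (`|u + v| ^+ 2 - `|u - v| ^+ 2 +
    i * `|u + w| ^+ 2 - i * `|u - w| ^+ 2) : K^o).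
Proof.
have sq t : continuous (fun u : V => `|u + t| ^+ 2 : K^o).
  move=> u; have nc : `|x + t| @[x --> u] --> `|u + t|.
    by apply: cvg_norm; apply: cvgD; [exact: cvg_id|exact: cvg_cst].
  by apply: cvgM.
move=> u; apply: cvgM; first exact: cvg_cst.
apply: cvgB; last by apply: cvgM; [exact: cvg_cst|exact: sq].
apply: cvgD; last by apply: cvgM; [exact: cvg_cst|exact: sq].
by apply: cvgB; exact: sq.
Qed.

Lemma eq_norm_closure (T : topologicalType) (W : normedModType K)
    (f : T -> V) (g : T -> W) (A : set T) :
  continuous f -> continuous g -> (forall x, A x -> `|f x| = `|g x|) ->
  forall x, closure A x -> `|f x| = `|g x|.
Proof.
move=> fc gc; apply: (@eq_closure _ _ K^o (fun x => `|f x|) (fun x => `|g x|)).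
- by move=> x; apply: cvg_norm; exact: fc.
- by move=> x; apply: cvg_norm; exact: gc.
Qed.

End Closure.

Section ComplexNorm.
Variable R : realType.
Local Notation C := R[i].

(** In the partial order of [R[i]] a positive element is real, so every epsilon can be taken in
    [R]. *)
Lemma posC (e : C) : 0 < e -> exists2 r : R, 0 < r & e = r%:C%C.
Proof.
case: e => x y; rewrite ltcE /= => /andP[/eqP y0 x0].
by exists x => //; rewrite y0.
Qed.

Variables (V : completeNormedModType C).

Lemma cvg_le_real (u : nat -> V) (l : V) (r : nat -> R) :
  r @ \oo --> 0 -> (forall n, `|l - u n| <= (r n)%:C%C) -> u @ \oo --> l.
Proof.
move=> r0 ru; apply/cvgrPdist_lt => _ /posC [e e0 ->].
have /cvgr0Pnorm_lt/(_ e e0) := r0; apply: filterS => n rn.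
apply: (le_lt_trans (ru n)); rewrite ltcR; exact: le_lt_trans (ler_norm _) rn.
Qed.

Lemma cvg_norm_le (u : nat -> V) (l : V) (B : C) :
  u @ \oo --> l -> (forall n, `|u n| <= B) -> `|l| <= B.
Proof.
move=> ul uB; apply/ler_addgt0Pr => e e0.
have /cvgrPdist_lt/(_ e e0)[N _ /(_ N (leqnn N)) /= lN] := ul.
rewrite -[l](subrK (u N)) addrC; apply: le_trans (ler_normD _ _) _.
by apply: lerD => //; exact: ltW.
Qed.

Lemma series_dist_geometric (u : nat -> V) (M r : R) n m :
  0 <= r -> r < 1 -> (forall n, `|u n| <= (M * r ^+ n)%:C%C) ->
  `|series u (n + m)%N - series u n| <= (M * r ^+ n * (1 - r)^-1)%:C%C.
Proof.
move=> r0 r1 ur.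
have M0 : 0 <= M.
  by have := le_trans (normr_ge0 _) (ur 0%N); rewrite expr0 mulr1 lecR.
have d0 : 0 < 1 - r by rewrite subr_gt0.
(* The bound is sharpened to the exact finite geometric sum, since the stated one does not pass
   through an induction on [m]. *)
suff : `|series u (n + m)%N - series u n| <=
    (M * (r ^+ n - r ^+ (n + m)) * (1 - r)^-1)%:C%C.
  move/le_trans; apply; rewrite lecR ler_wpM2r ?invr_ge0 ?(ltW d0) //.
  by rewrite ler_wpM2l // gerBl exprn_ge0.
elim: m => [|m IH]; first by rewrite addn0 !subrr normr0 mulr0 mul0r.
rewrite addnS seriesSr addrAC.
apply: (le_trans (ler_normD _ _)).
apply: (le_trans (lerD IH (ur _))).
rewrite -rmorphD lecR le_eqVlt; apply/orP; left; apply/eqP.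
have dn : 1 - r != 0 by rewrite gt_eqF.
by rewrite exprS; field.
Qed.

Lemma series_geometric_cvg (u : nat -> V) (M r : R) :
  0 <= r -> r < 1 -> (forall n, `|u n| <= (M * r ^+ n)%:C%C) ->
  series u @ \oo --> limn (series u) /\
  forall n, `|limn (series u) - series u n| <= (M * r ^+ n * (1 - r)^-1)%:C%C.
Proof.
move=> r0 r1 ur.
have cv0 : (fun n => M * r ^+ n * (1 - r)^-1) @ \oo --> (0 : R).
  have := @cvg_geometric R (M * (1 - r)^-1) r.
  rewrite ger0_norm // => /(_ r1); apply: cvg_trans.
  by apply: near_eq_cvg; near=> n; rewrite /geometric /= mulrAC.
have cvS : cvgn (series u).
  apply/cauchy_cvgP/cauchy_exP => _ /posC [e e0 ->].
  have /cvgr0Pnorm_lt/(_ e e0) [N _ HN] := cv0.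
  exists (series u N), N => // m /= Nm; rewrite -ball_normE /= distrC.
  rewrite -(subnKC Nm); apply: le_lt_trans (series_dist_geometric _ _ r0 r1 ur) _.
  by rewrite ltcR; apply: le_lt_trans (ler_norm _) (HN N _) => /=.
split=> // n; apply/ler_addgt0Pr => e e0.
have /cvgrPdist_lt/(_ e e0) [N _ HN] := cvS.
have := HN (n + N)%N (leq_addl _ _) => /= HNn.
rewrite -[_ - _](subrKA (series u (n + N)%N)) addrC.
apply: (le_trans (ler_normD _ _)); apply: lerD; last exact: ltW.
exact: series_dist_geometric.
Unshelve. all: by end_near. Qed.
End ComplexNorm.

Section HilbertSpace.
Variables (R : realType) (H : hilbertType R).
Local Notation C := R[i].
Implicit Types u v w : H.

Lemma dot0l u : dot 0 u = 0 :> C.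
Proof. by rewrite -(scale0r 0) dotZl mul0r. Qed.
Lemma dotDr u v w : dot u (v + w) = dot u v + dot u w :> C.
Proof. by rewrite [dot u v]dotC [dot u w]dotC dotC dotDl rmorphD. Qed.
Lemma dotZr c u v : dot u (c *: v) = c^* * dot u v :> C.
Proof. by rewrite [dot u v]dotC dotC dotZl rmorphM. Qed.
Lemma dot0r u : dot u 0 = 0 :> C.
Proof. by rewrite dotC dot0l conjC0. Qed.
Lemma dotNl u v : dot (- u) v = - dot u v :> C.
Proof. by rewrite -scaleN1r dotZl mulN1r. Qed.
Lemma dotNr u v : dot u (- v) = - dot u v :> C.
Proof. by rewrite -scaleN1r dotZr rmorphN1 mulN1r. Qed.
Lemma dot_suml (I : Type) (s : seq I) (f : I -> H) v :
  dot (\sum_(i <- s) f i) v = \sum_(i <- s) dot (f i) v :> C.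
Proof.
elim: s => [|i s IH]; first by rewrite !big_nil dot0l.
by rewrite !big_cons dotDl IH.
Qed.

Lemma dot_eq0 u : dot u u = 0 :> C -> u = 0.
Proof. by rewrite dotE => /eqP; rewrite sqrf_eq0 normr_eq0 => /eqP. Qed.

Lemma polarization u v : 4 * dot u v =
  `|u + v| ^+ 2 - `|u - v| ^+ 2 +
  'i * `|u + 'i *: v| ^+ 2 - 'i * `|u - 'i *: v| ^+ 2 :> C.
Proof.
have i2 : 'i * 'i = - 1 :> C by rewrite -expr2 sqrCi.
rewrite -!dotE !(dotDl, dotDr, dotNl, dotNr, dotZl, dotZr) conjCi.
move: 'i i2 (dot u u) (dot u v) (dot v u) (dot v v) => i i2 x y z t.
apply/eqP; rewrite -subr_eq0; apply/eqP.
transitivity ((i * i + 1) * (2 * y - 2 * z)); first by ring.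
by rewrite i2 addNr mul0r.
Qed.

Lemma dot_continuousl v : continuous (fun u => dot u v : C^o).
Proof.
have -> : (fun u => dot u v) = fun u => 4^-1 * (`|u + v| ^+ 2 - `|u - v| ^+ 2 +
    'i * `|u + 'i *: v| ^+ 2 - 'i * `|u - 'i *: v| ^+ 2) :> C^o.
  by apply/funext => u; rewrite -polarization mulKf // pnatr_eq0.
exact: polarization_continuous.
Qed.

Lemma dense_dot_eq0 (D : set H) w :
  dense D -> (forall v, D v -> dot w v = 0 :> C) -> w = 0.
Proof.
move=> /denseP dD wD; apply: dot_eq0.
apply: (@eq_closure _ _ C^o (fun u => dot u w) (fun=> 0) _ _ _ _ _ (dD w)).
- exact: dot_continuousl.
- exact: cst_continuous.
- by move=> v Dv /=; rewrite dotC wD // conjC0.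
Qed.

Lemma dense_dot_inj (D : set H) w w' :
  dense D -> (forall v, D v -> dot w v = dot w' v :> C) -> w = w'.
Proof.
move=> dD ww; apply/eqP; rewrite -subr_eq0; apply/eqP/(dense_dot_eq0 dD) => v Dv.
by rewrite dotDl dotNl ww // subrr.
Qed.

(** The pairs adjoint to a fixed [(b, a)] form a closed set. Both adjointness and single-valuedness
    of closed graphs are derived from this. *)
Lemma closure_dot (G : set (H * H)) a b : (forall p, G p -> dot p.2 a = dot p.1 b :> C) ->
  forall p, closure G p -> dot p.2 a = dot p.1 b :> C.
Proof.
apply: (@eq_closure _ _ C^o (fun p => dot p.2 a) (fun p => dot p.1 b)) => p.
  apply: (cvg_comp snd (fun u => dot u a : C^o)); first exact: cvg_snd.
  exact: dot_continuousl.
apply: (cvg_comp fst (fun u => dot u b : C^o)); first exact: cvg_fst.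
exact: dot_continuousl.
Qed.

End HilbertSpace.

(** * Closability and extension of isometries *)

Section StarRepClosure.
Variables (R : realType) (X : starAlgType R[i]) (H : hilbertType R).
Variables (rho : opRep X H) (rhoP : star_rep rho).

Lemma star_rep_closure_adj x u w v : closure (op_graph rho x) (u, w) -> rdom rho v ->
  dot w v = dot u (rho (star x) v) :> R[i].
Proof.
move=> uw Dv; apply: (closure_dot _ uw) => -[u' w'] /= [/= Du' ->].
exact: star_rep_adj.
Qed.

(** The adjoint is defined on the dense domain, so the operator is closable. Hence the value picked
    by [xget] in [rep_closure] is the only possible one. *)
Lemma star_rep_closure_inj x u w w' :
  closure (op_graph rho x) (u, w) -> closure (op_graph rho x) (u, w') -> w = w'.
Proof.
move=> uw uw'; apply: (dense_dot_inj (star_rep_dense rhoP)) => v Dv.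
by rewrite (star_rep_closure_adj uw Dv) (star_rep_closure_adj uw' Dv).
Qed.
End StarRepClosure.

Section IsometryExtension.
Variables (R : realType) (H1 H2 : hilbertType R).
Local Notation C := R[i].

Lemma isometry_dot (W : H1 -> H2) :
  linear W -> (forall u, `|W u| = `|u|) -> forall u v, dot (W u) (W v) = dot u v :> C.
Proof.
move=> WL WN u v; apply: (@mulfI _ (4 : C)); first by rewrite pnatr_eq0.
have WD x y : W (x + y) = W x + W y by rewrite -[x]scale1r WL !scale1r.
have WZ c x : W (c *: x) = c *: W x.
  have W0 : W 0 = 0 by apply: (addrI (W 0)); rewrite -WD !addr0.
  by rewrite -[c *: x]addr0 WL W0 addr0.
have WN' x : W (- x) = - W x by rewrite -[- x]scaleN1r WZ scaleN1r.
by rewrite !polarization -!WZ -!WN' -!WD !WN.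
Qed.

(** If [p (x n)] converges to [u], then [p' (x n)] is Cauchy because it has the same mutual
    distances; completeness supplies the second coordinate. *)
Lemma isometric_graph_total (X : zmodType) (p : X -> H1) (p' : X -> H2) :
  (forall x y, p (x - y) = p x - p y) -> (forall x y, p' (x - y) = p' x - p' y) ->
  (forall x, `|p' x| = `|p x| :> C) -> dense (range p) ->
  forall u, exists w, closure (range (fun x => (p x, p' x))) (u, w).
Proof.
move=> pB p'B pp' /denseP dp u.
have /choice[x xP] : forall n : nat, exists x, `|u - p x| <= (harmonic n : R)%:C%C :> C.
  move=> n; have e0 : 0 < (harmonic n : R)%:C%C :> C by rewrite ltcR invr_gt0 ltr0n.
  have /closure_normP/(_ _ e0)[_ [x _ <-] ux] := dp u.
  by exists x; exact: ltW.
have cvp : (p \o x) @ \oo --> u by apply: cvg_le_real xP; exact: cvg_harmonic.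
have cv' : cvgn (p' \o x).
  apply/cauchy_cvgP/cauchy_exP => e e0.
  have /cvgrPdist_lt/(_ (e / 2)) := cvp.
  rewrite divr_gt0 // => /(_ isT)[N _ HN].
  exists (p' (x N)), N => // m /= Nm; rewrite -ball_normE /= -p'B pp' pB.
  rewrite -[p (x N)](subrK u) -addrA [e]splitr.
  apply: le_lt_trans (ler_normD _ _) _.
  by rewrite ltrD ?[`|p _ - u|]distrC //; apply: HN => /=.
exists (limn (p' \o x)).
have cvpp : (fun n => (p (x n), p' (x n))) @ \oo --> (u, limn (p' \o x)).
  exact: cvg_pair.
apply: (closed_cvg _ (@closed_closure _ _) _ _ cvpp).
by apply: nearW => n; apply: subset_closure; exists (x n).
Qed.
End IsometryExtension.

(** The graph of [W] is the closure of all [(p x, p' x)]. Equality of norms survives in the closure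
    and makes it single-valued, so [p] may have a kernel. Surjectivity is totality with the roles of
    [p] and [p'] exchanged. *)
Lemma isometry_extension (R : realType) (H1 H2 : hilbertType R)
    (X : lmodType R[i]) (p : X -> H1) (p' : X -> H2) :
  linear p -> linear p' -> (forall x, `|p' x| = `|p x| :> R[i]) ->
  dense (range p) -> dense (range p') ->
  exists W : H1 -> H2, [/\ linear W, forall u, `|W u| = `|u| :> R[i],
    range W = [set: H2] & forall x, W (p x) = p' x].
Proof.
move=> pL p'L pp' dp dp'.
pose G := range (fun x => (p x, p' x)).
have B (V : lmodType R[i]) (f : X -> V) : linear f -> forall x y, f (x - y) = f x - f y.
  by move=> fL x y; rewrite addrC -scaleN1r fL scaleN1r addrC.
have GL : forall c a b, closure G a -> closure G b -> closure G (c *: a + b).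
  apply: closure_linear => c _ _ [x _ <-] [y _ <-].
  by exists (c *: x + y) => //; rewrite pL p'L.
have Gn a : closure G a -> `|a.2| = `|a.1| :> R[i].
  apply: eq_norm_closure a.
  - by move=> a; exact: cvg_snd.
  - by move=> a; exact: cvg_fst.
  - by move=> _ [x _ <-] /=.
have Gu u w w' : closure G (u, w) -> closure G (u, w') -> w = w'.
  move=> uw uw'; have := Gn _ (GL (-1) _ _ uw uw').
  rewrite /= !scaleN1r addNr normr0 => /normr0_eq0; rewrite addrC.
  by move=> /eqP; rewrite subr_eq0 => /eqP.
have /choice[W WP] := isometric_graph_total (B _ _ pL) (B _ _ p'L) pp' dp.
exists W; split.
- move=> c u v; apply: Gu (WP _) _; exact: GL (WP u) (WP v).
- by move=> u; exact: (Gn _ (WP u)).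
- apply/seteqP; split=> // w _.
  have [u uw] := isometric_graph_total (B _ _ p'L) (B _ _ pL)
    (fun x => esym (pp' x)) dp' w.
  exists u => //; apply: Gu (WP _) _.
  have sw : continuous (fun a : H2 * H1 => (a.2, a.1)).
    by move=> a; apply: cvg_pair; [exact: cvg_snd|exact: cvg_fst].
  by apply: (closure_image sw _ uw) => _ [x _ <-]; exists x.
- by move=> x; apply: Gu (WP _) _; apply: subset_closure; exists x.
Qed.

(** * The operators E, F, K on the orbit of [v0] *)

Section LinSpan.
Variables (K : pzRingType) (V : lmodType K) (S : set V).

Lemma lin_span_ind (P : V -> Prop) : P 0 ->
  (forall c u v, P u -> P v -> P (c *: u + v)) -> (forall v, S v -> P v) ->
  forall v, lin_span S v -> P v.
Proof.
move=> P0 PL PS _ [s [sS ->]]; elim: s sS => [|p s IH] sS; first by rewrite big_nil.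
rewrite big_cons; apply: PL; first by apply/PS/sS; rewrite mem_head.
by apply: IH => p' p's; apply: sS; rewrite inE p's orbT.
Qed.

Lemma lin_span_gen v : S v -> lin_span S v.
Proof.
move=> Sv; exists [:: (1, v)]; split; last by rewrite big_seq1 scale1r.
by move=> p; rewrite inE => /eqP ->.
Qed.

Lemma lin_span0 : lin_span S 0.
Proof. by exists [::]; split; rewrite ?big_nil. Qed.

Lemma lin_spanL c u v : lin_span S u -> lin_span S v -> lin_span S (c *: u + v).
Proof.
move=> [s [sS ->]] [t [tS ->]]; exists ([seq (c * p.1, p.2) | p <- s] ++ t); split.
  by move=> p; rewrite mem_cat => /orP[/mapP[p' /sS Sp' ->]|/tS].
rewrite big_cat big_map scaler_sumr; congr (_ + _).
by apply: eq_bigr => p _ /=; rewrite scalerA.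
Qed.
End LinSpan.

Section BasisOperators.
Variables (R : realType) (H : hilbertType R).
Local Notation I := (nat * nat * int)%type.
Variables (eta : I -> H) (heta : orthonormal_basis eta).
Local Notation C := R[i].

Lemma dot_eta i j : dot (eta i) (eta j) = (i == j)%:R :> C.
Proof. by case: heta. Qed.

Lemma norm_eta i : `|eta i| = 1 :> C.
Proof.
have := dot_eta i i; rewrite dotE eqxx => /eqP.
by rewrite sqrp_eq1 ?normr_ge0 // => /eqP.
Qed.

Lemma dot_eta_inj w w' : (forall j, dot w (eta j) = dot w' (eta j) :> C) -> w = w'.
Proof.
move=> ww; apply: (dense_dot_inj heta.2).
apply: (lin_span_ind (P := fun v => dot w v = dot w' v :> C)).
- by rewrite !dot0r.
- by move=> c u v' Hu Hv; rewrite !(dotDr, dotZr) Hu Hv.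
- by move=> _ [j _ <-].
Qed.

(** The relation on basis vectors is carried to the closures one graph at a time: first that of [f]
    against each [eta j], then that of [g]. *)
Lemma basis_op_adj (f g : I -> H) :
  (forall i j, dot (f i) (eta j) = dot (eta i) (g j) :> C) ->
  forall u w u' w', closure (basis_op eta f) (u, w) ->
    closure (basis_op eta g) (u', w') -> dot w u' = dot u w' :> C.
Proof.
move=> fg u w u' w' uw uw'.
have H1 j : dot w (eta j) = dot u (g j) :> C.
  apply: (closure_dot _ uw).
  apply: (lin_span_ind (P := fun p => dot p.2 (eta j) = dot p.1 (g j) :> C)) => /=.
  - by rewrite !dot0l.
  - by move=> c p p' /= Hp Hp'; rewrite !(dotDl, dotZl) Hp Hp'.
  - by move=> _ [i _ <-] /=.
rewrite dotC [RHS]dotC; congr (_^*); apply/esym.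
apply: (closure_dot _ uw').
apply: (lin_span_ind (P := fun p => dot p.2 u = dot p.1 w :> C)) => /=.
- by rewrite !dot0l.
- by move=> c p p' /= Hp Hp'; rewrite !(dotDl, dotZl) Hp Hp'.
- by move=> _ [i _ <-] /=; rewrite dotC [RHS]dotC H1.
Qed.

(** Closability: [g] gives an adjoint on every [eta j], and these have dense span. *)
Lemma basis_op_fun (f g : I -> H) :
  (forall i j, dot (f i) (eta j) = dot (eta i) (g j) :> C) ->
  forall u w w', closure (basis_op eta f) (u, w) ->
    closure (basis_op eta f) (u, w') -> w = w'.
Proof.
move=> fg u w w' uw uw'; apply: dot_eta_inj => j.
have jg : closure (basis_op eta g) (eta j, g j).
  by apply/subset_closure/lin_span_gen; exists j.
by rewrite (basis_op_adj fg uw jg) (basis_op_adj fg uw' jg).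
Qed.

End BasisOperators.

Section I11.
Variables (R : realType) (q : qparam R) (H : hilbertType R).
Variables (eta : nat * nat * int -> H) (heta : orthonormal_basis eta).
Local Notation C := R[i].
Local Notation h := (qhalf q).
Local Notation L := (lam q).
Local Notation ln := (lamn q).
Local Notation fE := (I11_E q eta).
Local Notation fF := (I11_F q eta).
Local Notation fK := (I11_K q eta).
Local Notation fKi := (I11_Ki q eta).

Lemma lamn0 : ln 0 = 0.
Proof. by rewrite /lamn muln0 expr0 subrr sqrtr0. Qed.

Let qval_exp_le1 n : (qval q) ^+ n <= 1.
Proof. by rewrite exprn_ile1 // ltW // ?qval_gt0 ?qval_lt1. Qed.

Lemma lamn_gt0 n : 0 < ln n.+1.
Proof.
rewrite /lamn ltcR sqrtr_gt0 subr_gt0 mulnS addSn.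
by rewrite exprn_ilt1 // ?qval_lt1 // ltW // qval_gt0.
Qed.

Lemma lamn_ge0 n : 0 <= ln n.
Proof. by rewrite /lamn lecR sqrtr_ge0. Qed.

Lemma lamn_le1 n : ln n <= 1.
Proof.
rewrite /lamn -[X in _ <= X]/(1%:C%C) lecR -[X in _ <= X]sqrtr1; apply: ler_wsqrtr.
by rewrite gerBl exprn_ge0 // ltW // qval_gt0.
Qed.

(** Here [q^(2n)] is written through [h ^+ n], the form in which [field] meets it below. *)
Lemma lamn_sqr n : ln n * ln n = 1 - (h ^+ n) ^+ 4.
Proof.
rewrite /lamn -rmorphM -expr2 sqr_sqrtr ?subr_ge0 //.
rewrite rmorphB rmorph1 rmorphXn; congr (1 - _).
change ((qC q) ^+ (2 * n) = (h ^+ n) ^+ 4).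
by rewrite -qhalf2 -expr2 -!exprM mulnA mulnC.
Qed.

Lemma qhalfXz_conj m : (h ^ m)^* = h ^ m.
Proof. by rewrite [LHS]fmorphXz [X in X ^ _]qhalf_conj. Qed.
Lemma lamn_conj n : (ln n)^* = ln n. Proof. exact: real_conj. Qed.
Lemma I11_coef_conj m n : (h ^ m * ln n * L^-1)^* = h ^ m * ln n * L^-1.
Proof.
rewrite [LHS]rmorphM [X in X * _]rmorphM.
rewrite [X in X * _ * _]qhalfXz_conj [X in _ * X * _]lamn_conj.
by rewrite [X in _ * X]conjVC lam_conj.
Qed.

Lemma I11_EF_adj i j : dot (fE i) (eta j) = dot (eta i) (fF j) :> C.
Proof.
move: i j => [[n k] l] [[n' k'] l'].
rewrite /I11_E /I11_F dotDl dotDr !dotZl !dotZr !I11_coef_conj !(dot_eta heta).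
congr (_ + _).
- have [[-> <- ->]|ne] := eqVneq (n, k.+1, l) (n', k', l'); first by rewrite eqxx.
  (* For [k' = 0] the truncated index [k'.-1] might match, but its coefficient contains
     [lamn 0 = 0]. *)
  rewrite mulr0; case: k' ne => [|k'] ne; first by rewrite lamn0 mulr0 !mul0r.
  have [[nn kk ll]|] := eqVneq (n, k, l) (n', k', l'); last by rewrite mulr0.
  by rewrite nn kk ll eqxx in ne.
- case: n => [|n] /=.
    by rewrite lamn0 mulr0 !mul0r [RHS]mulr0.
  have [[-> -> ll]|ne] := eqVneq (n, k, l + 1) (n', k', l').
    rewrite -ll addrK eqxx !mulr1; congr (h ^ (- _) * _ * _).
    by rewrite -addn1 PoszD; ring.
  rewrite mulr0; have [[nn kk ll]|] := eqVneq (n.+1, k, l) (n'.+1, k', l' - 1).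
    by rewrite nn kk ll subrK eqxx in ne.
  by rewrite mulr0.
Qed.

Lemma I11_FE_adj i j : dot (fF i) (eta j) = dot (eta i) (fE j) :> C.
Proof. by rewrite dotC -I11_EF_adj -dotC. Qed.

Lemma I11_K_adj i j : dot (fK i) (eta j) = dot (eta i) (fK j) :> C.
Proof.
move: i j => [[n k] l] [[n' k'] l'].
rewrite /I11_K dotZl dotZr qhalfXz_conj !(dot_eta heta).
by have [[-> -> ->] //|_] := eqVneq (n, k, l) (n', k', l'); rewrite !mulr0.
Qed.
Lemma I11_Ki_adj i j : dot (fKi i) (eta j) = dot (eta i) (fKi j) :> C.
Proof.
move: i j => [[n k] l] [[n' k'] l'].
rewrite /I11_Ki dotZl dotZr qhalfXz_conj !(dot_eta heta).
by have [[-> -> ->] //|_] := eqVneq (n, k, l) (n', k', l'); rewrite !mulr0.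
Qed.
End I11.

(** * The cross relations on basis vectors *)

Section HalfPowers.
Variables (R : realType) (q : qparam R).
Local Notation h := (qhalf q).
Local Notation X n := (h ^+ n).

Let h0 : h != 0 := qhalf_neq0 q.
Lemma qhalfE1 (n : nat) l : h ^ (- (n%:Z - l + 1)) = (X n)^-1 * h ^ l * h^-1.
Proof. by rewrite -invr_expz !expfzDr // -invr_expz !invfM invrK expr1z. Qed.
Let mul2z_expz (k : nat) : h ^ (2 * k%:Z) = X k ^+ 2.
Proof. by rewrite -[2 * _]/(Posz 2 * Posz k) -PoszM mulnC -exprM. Qed.
Lemma qhalfE2 (n k : nat) l :
  h ^ (- (n%:Z + 2 * k%:Z + l + 1)) = (X n)^-1 * (X k)^-1 ^+ 2 * (h ^ l)^-1 * h^-1.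
Proof.
by rewrite -invr_expz !expfzDr // mul2z_expz !invfM expr1z.
Qed.
Lemma qhalfE3 (n k : nat) l :
  h ^ (- n%:Z + 2 * k%:Z + l) = (X n)^-1 * X k ^+ 2 * h ^ l.
Proof. by rewrite !expfzDr // -invr_expz mul2z_expz. Qed.
Lemma qhalfE4 (n k : nat) l :
  h ^ (- (- n%:Z + 2 * k%:Z + l)) = X n * (X k)^-1 ^+ 2 * (h ^ l)^-1.
Proof. by rewrite -invr_expz qhalfE3 !invfM invrK. Qed.
Lemma qhalfDl1 l : h ^ (l + 1) = h ^ l * h.
Proof. by rewrite expfzDr // expr1z. Qed.
Lemma qhalfBl1 l : h ^ (l - 1) = h ^ l * h^-1.
Proof. by rewrite expfzDr. Qed.
(** Normal form for the coefficients: integer exponents are split so that [h], [h ^+ n], [h ^+ k]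
    and [h ^ l] become independent atoms for [field]. *)
Definition qhalf_expE :=
  (qhalfE1, qhalfE2, qhalfE3, qhalfE4, qhalfDl1, qhalfBl1).
End HalfPowers.

Section Stability.
Variables (R : realType) (q : qparam R) (H : hilbertType R).
Variables (eta : nat * nat * int -> H).
Variables (rho : Oq q -> H -> H) (hrho : I11_bounded eta rho).
Local Notation C := R[i].
Local Notation Q := (qC q).
Local Notation h := (qhalf q).
Local Notation L := (lam q).
Local Notation ln := (lamn q).
Local Notation fE := (I11_E q eta).
Local Notation fF := (I11_F q eta).
Local Notation fKi := (I11_Ki q eta).

Lemma rhoDr x u v : rho x (u + v) = rho x u + rho x v.
Proof. by rewrite -[u]scale1r (I11_linear hrho) !scale1r. Qed.
Lemma rho0r x : rho x 0 = 0.
Proof. by apply: (addrI (rho x 0)); rewrite -rhoDr !addr0. Qed.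
Lemma rhoZr x c u : rho x (c *: u) = c *: rho x u.
Proof. by rewrite -[c *: u]addr0 (I11_linear hrho) rho0r addr0. Qed.
Lemma rho0l u : rho 0 u = 0.
Proof. by rewrite -(scale0r 0) (I11_Z hrho) scale0r. Qed.

(* Compatibility on a basis vector with the cross relations
   K^-1 z = (z <| K) K^-1 and f z = (z <| K^-1) f + s (z <| delta) K^-1. *)
Definition basis_stable (f : nat * nat * int -> H) (delta : Oq q -> Oq q) (s : C)
    (z : Oq q) := forall i, exists j c,
  [/\ rho z (eta i) = c *: eta j, rho (actK z) (fKi i) = c *: fKi j &
      rho (actKi z) (f i) + s *: rho (delta z) (fKi i) = c *: f j].

Let Q2 : Q = h * h. Proof. by rewrite qhalf2. Qed.
Let h0 : h != 0 := qhalf_neq0 q.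
Let L0 : L != 0 := lam_neq0 q.
Let X0 n : h ^+ n != 0. Proof. by rewrite expf_neq0. Qed.
Let Y0 l : h ^ l != 0. Proof. by rewrite expfz_neq0. Qed.
Let LE : L = h * h - (h * h)^-1. Proof. by rewrite qhalf2. Qed.
Let Q4 : (h * h) * (h * h) - 1 != 0.
Proof.
have : L * (h * h) != 0 by rewrite !mulf_neq0.
by rewrite LE mulrBl mulVf ?mulf_neq0.
Qed.
Let QX n : Q ^+ n = (h ^+ n) ^+ 2.
Proof. by rewrite Q2 -expr2 exprAC. Qed.

Lemma basis_stable_E_a : basis_stable fE (@actE R q) (- Q^-1) (oa q).
Proof.
move=> [[n k] l]; exists (n.-1, k, l), (ln n);
rewrite actKa actKia actEa rho0l scaler0 addr0.
rewrite !(I11_Z hrho) /I11_E /I11_Ki !rhoDr !rhoZr !(I11_a hrho).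
case: n => [|n] /=; first by rewrite lamn0 !(mulr0, mul0r, scale0r, scaler0, addr0).
rewrite !(scalerA, scalerDr) !qhalf_expE !exprS.
split=> //; first by congr (_ *: _); field; rewrite ?h0 ?X0 ?Y0.
by congr (_ *: _ + _ *: _); field; rewrite ?h0 ?X0 ?Y0 ?L0.
Qed.

Lemma basis_stable_E_b : basis_stable fE (@actE R q) (- Q^-1) (ob q).
Proof.
move=> [[n k] l]; exists (n, k, l + 1), (Q ^+ n.+1);
rewrite actKb actKib actEb rho0l scaler0 addr0.
rewrite !(I11_Z hrho) /I11_E /I11_Ki !rhoDr !rhoZr !(I11_b hrho).
rewrite !(scalerA, scalerDr) !qhalf_expE !QX.
split=> //; first by rewrite !exprS; congr (_ *: _); field; rewrite ?h0 ?X0 ?Y0.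
case: n => [|n] /=; rewrite !exprS.
  rewrite lamn0 !(mulr0, mul0r, scale0r, addr0).
  by congr (_ *: _); field; rewrite ?h0 ?X0 ?Y0 ?L0.
by congr (_ *: _ + _ *: _); field; rewrite ?h0 ?X0 ?Y0 ?L0.
Qed.

Lemma basis_stable_E_c : basis_stable fE (@actE R q) (- Q^-1) (oc q).
Proof.
move=> [[n k] l]; exists (n, k, l - 1), (- Q ^+ n); rewrite actKc actKic actEc.
rewrite !(I11_Z hrho) /I11_E /I11_Ki !rhoDr !rhoZr !(I11_c hrho) (I11_a hrho).
rewrite subrK addrK.
rewrite !(scalerA, scalerDr) !qhalf_expE !QX.
split=> //; first by congr (_ *: _); field; rewrite ?h0 ?X0 ?Y0.
(* Since [c <| E = a], the [delta] term lies on the same basis vector as the second term of [E], and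
   the two are merged. *)
rewrite -addrA -scalerDl; congr (_ *: _ + _ *: _).
  by field; rewrite ?h0 ?X0 ?Y0 ?L0.
case: n => [|n] /=; first by rewrite lamn0 !(mulr0, mul0r, addr0).
(* The [delta] term carries no factor [1 / lambda], so lambda must be expanded in [h]; [Q4] is its
   nonvanishing after clearing denominators. *)
rewrite Q2 LE !exprS; field.
by rewrite ?h0 ?X0 ?Y0 ?Q4.
Qed.

Lemma basis_stable_E_d : basis_stable fE (@actE R q) (- Q^-1) (od q).
Proof.
move=> [[n k] l]; exists (n.+1, k, l), (ln n.+1); rewrite actKd actKid actEd.
rewrite !(I11_Z hrho) /I11_E /I11_Ki !rhoDr !rhoZr !(I11_d hrho) (I11_b hrho) /=.
have s1 := lamn_sqr q n.+1; have s0 := lamn_sqr q n.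
(* For [n = 0] the index [n.-1.+1] is [1] instead of [0], but [lamn 0] removes the term; otherwise
   the product of the two factors is [lambda_n^2 = 1 - q^(2n)]. *)
have -> x : (x * ln n / L) *: (ln n.-1.+1 *: eta (n.-1.+1, k, l + 1)) =
    (x / L * (1 - (h ^+ n) ^+ 4)) *: eta (n, k, l + 1).
  case: n s0 {s1} => [|n] s0 /=.
    by rewrite lamn0 expr0 expr1n subrr !(mulr0, mul0r, scale0r).
  by rewrite scalerA -s0; congr (_ *: _); field.
rewrite !(scalerA, scalerDr) !qhalf_expE !QX.
split=> //; first by rewrite !exprS; congr (_ *: _); field; rewrite ?h0 ?X0 ?Y0.
rewrite -addrA; congr (_ *: _ + _).
  by rewrite !exprS; field; rewrite ?h0 ?X0 ?Y0 ?L0.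
rewrite -scalerDl; congr (_ *: _); set D := (X in _ = X).
have -> : D = ((h ^+ n.+1)^-1 * (h ^+ k)^-1 ^+ 2 * (h ^ l)^-1 * h^-1 * L^-1 *
    (1 - (h ^+ n.+1) ^+ 4)) by rewrite /D -s1; field; rewrite ?h0 ?X0 ?Y0 ?L0.
rewrite Q2 LE !exprS; field.
by rewrite ?h0 ?X0 ?Y0 ?Q4.
Qed.

Lemma basis_stable_F_d : basis_stable fF (@actF R q) (- Q) (od q).
Proof.
move=> [[n k] l]; exists (n.+1, k, l), (ln n.+1);
rewrite actKd actKid actFd rho0l scaler0 addr0.
rewrite !(I11_Z hrho) /I11_F /I11_Ki !rhoDr !rhoZr !(I11_d hrho).
rewrite !(scalerA, scalerDr) !qhalf_expE !exprS.
split=> //; first by congr (_ *: _); field; rewrite ?h0 ?X0 ?Y0.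
by congr (_ *: _ + _ *: _); field; rewrite ?h0 ?X0 ?Y0 ?L0.
Qed.

Lemma basis_stable_F_c : basis_stable fF (@actF R q) (- Q) (oc q).
Proof.
move=> [[n k] l]; exists (n, k, l - 1), (- Q ^+ n);
rewrite actKc actKic actFc rho0l scaler0 addr0.
rewrite !(I11_Z hrho) /I11_F /I11_Ki !rhoDr !rhoZr !(I11_c hrho).
rewrite !(scalerA, scalerDr) !qhalf_expE !QX.
split=> //; first by congr (_ *: _); field; rewrite ?h0 ?X0 ?Y0.
by congr (_ *: _ + _ *: _); rewrite ?exprS; field; rewrite ?h0 ?X0 ?Y0 ?L0.
Qed.

Lemma basis_stable_F_b : basis_stable fF (@actF R q) (- Q) (ob q).
Proof.
move=> [[n k] l]; exists (n, k, l + 1), (Q ^+ n.+1); rewrite actKb actKib actFb.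
rewrite !(I11_Z hrho) /I11_F /I11_Ki !rhoDr !rhoZr !(I11_b hrho) (I11_d hrho).
rewrite subrK addrK.
rewrite !(scalerA, scalerDr) !qhalf_expE !QX.
split=> //; first by rewrite !exprS; congr (_ *: _); field; rewrite ?h0 ?X0 ?Y0.
rewrite -addrA -scalerDl; congr (_ *: _ + _ *: _); rewrite !exprS.
  by field; rewrite ?h0 ?X0 ?Y0 ?L0.
rewrite Q2 LE; field.
by rewrite ?h0 ?X0 ?Y0 ?Q4.
Qed.

Lemma basis_stable_F_a : basis_stable fF (@actF R q) (- Q) (oa q).
Proof.
move=> [[n k] l]; exists (n.-1, k, l), (ln n); rewrite actKa actKia actFa.
rewrite !(I11_Z hrho) /I11_F /I11_Ki !rhoDr !rhoZr !(I11_a hrho) (I11_c hrho) /=.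
rewrite !(scalerA, scalerDr) !qhalf_expE !QX.
(* For [n = 0] the target is zero: lowering by [a] the vector [eta (1, k, l - 1)] that [F] produces
   has to cancel the term of [a <| F = c]. *)
case: n => [|n] /=.
  rewrite lamn0 !(mulr0, mul0r, scale0r, add0r); split=> //.
  have s1 := lamn_sqr q 1; rewrite expr1 in s1.
  rewrite -scalerDl -[RHS](scale0r (eta (0%N, k, l - 1))); congr (_ *: _).
  set A := (X in X + _).
  have -> : A = h * ((h ^+ k)^-1 ^+ 2 * (h ^ l)^-1 * h^-1) * L^-1 * (1 - h ^+ 4).
    by rewrite /A -s1 expr0; field; rewrite ?h0 ?X0 ?Y0 ?L0.
  rewrite Q2 LE !expr0; field.
  by rewrite ?h0 ?X0 ?Y0 ?Q4.
have s1 := lamn_sqr q n.+2; have s0 := lamn_sqr q n.+1.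
split=> //; first by rewrite !exprS; congr (_ *: _); field; rewrite ?h0 ?X0 ?Y0.
rewrite -addrA -scalerDl; congr (_ *: _ + _ *: _).
  by rewrite !exprS; field; rewrite ?h0 ?X0 ?Y0 ?L0.
set A := (X in X + _ = _); set D := (X in _ = X).
have -> : A = h * ((h ^+ n.+1)^-1 * (h ^+ k)^-1 ^+ 2 * (h ^ l)^-1 * h^-1) * L^-1 *
    (1 - (h ^+ n.+2) ^+ 4) by rewrite /A -s1; field; rewrite ?h0 ?X0 ?Y0 ?L0.
have -> : D = (h ^+ n)^-1 * (h ^+ k)^-1 ^+ 2 * (h ^ l)^-1 * h^-1 * L^-1 *
    (1 - (h ^+ n.+1) ^+ 4) by rewrite /D -s0; field; rewrite ?h0 ?X0 ?Y0 ?L0.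
rewrite Q2 LE !exprS; field.
by rewrite ?h0 ?X0 ?Y0 ?Q4.
Qed.
End Stability.

(** * Cesaro means, and [v0] in the closed graphs *)

Section Cesaro.
Variables (R : realType) (H : hilbertType R).
Local Notation C := R[i].

Lemma sum_orthogonal_le (g : nat -> H) (B : R) N :
  (forall m n, m != n -> dot (g m) (g n) = 0 :> C) -> (forall n, `|g n| <= B%:C%C :> C) ->
  `|\sum_(n < N) g n| ^+ 2 <= (B ^+ 2 * N%:R)%:C%C :> C.
Proof.
move=> gg gB; elim: N => [|N IH].
  by rewrite big_ord0 normr0 expr0n mulr0 lexx.
have gN : dot (\sum_(i < N) g i) (g N) = 0 :> C.
  by rewrite dot_suml big1 // => i _; rewrite gg // ltn_eqF.
rewrite big_ord_recr /= -dotE dotDl !dotDr gN [dot (g N) _]dotC gN.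
rewrite conjC0 addr0 add0r !dotE -[in N.+1%:R]addn1 natrD mulrDr mulr1.
rewrite [X in _ <= X]rmorphD; apply: lerD => //.
rewrite [X in _ <= X]rmorphXn; apply: lerXn2r; rewrite ?nnegrE //.
exact: le_trans (gB N).
Qed.

(* The sequence [g n] need not converge, only its Cesaro means do. *)
Lemma closure_cesaro (A : set (H * H * H)) (S g : nat -> H) (v : H) (M r B : R) :
  (forall c x y, A x -> A y -> A (c *: x + y)) -> (forall n, A (S n, g n, S n)) ->
  0 <= r -> r < 1 -> (forall n, `|v - S n| <= (M * r ^+ n)%:C%C :> C) ->
  (forall m n, m != n -> dot (g m) (g n) = 0 :> C) -> (forall n, `|g n| <= B%:C%C :> C) ->
  closure A (v, 0, v).
Proof.
move=> AL AS r0 r1 Sv gg gB.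
have B0 : 0 <= B by have := le_trans (normr_ge0 _) (gB 0%N); rewrite lecR.
pose c N : C := N.+1%:R^-1.
have c0 N : 0 <= c N by rewrite invr_ge0 ler0n.
have cE N : c N = (harmonic N : R)%:C%C by rewrite /c fmorphV rmorph_nat.
pose T N := c N *: \sum_(n < N.+1) (S n, g n, S n).
have A0 : A 0 by have := AL (-1) _ _ (AS 0%N) (AS 0%N); rewrite scaleN1r addNr.
have AT N : A (T N).
  rewrite -[T N]addr0; apply: (AL) => //.
  by elim/big_ind: _ => // x y Ax Ay; rewrite -[x]scale1r; apply: AL.
have T1 N : (T N).1.1 = c N *: \sum_(n < N.+1) S n.
  by congr (_ *: _); elim/big_rec2: _ => // i x y _ <-.
have T2 N : (T N).1.2 = c N *: \sum_(n < N.+1) g n.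
  by congr (_ *: _); elim/big_rec2: _ => // i x y _ <-.
have T3 N : (T N).2 = c N *: \sum_(n < N.+1) S n.
  by congr (_ *: _); elim/big_rec2: _ => // i x y _ <-.
pose mean (f : nat -> H) N : H := c N *: \sum_(n < N.+1) f n.
have TE : T = fun N => (mean S N, mean g N, mean S N).
  apply/funext => N; move: (T1 N) (T2 N) (T3 N).
  by case: (T N) => [[x y] z] /= -> -> ->.
have cvS : (fun N => c N *: \sum_(n < N.+1) S n) @ \oo --> v.
  apply: (@cvg_le_real _ _ _ _ (fun N => harmonic N * (M * (1 - r)^-1))).
    rewrite -(mul0r (M * (1 - r)^-1)); apply: cvgM; [exact: cvg_harmonic|exact: cvg_cst].
  move=> N.
  have -> : v - c N *: \sum_(n < N.+1) S n = c N *: \sum_(n < N.+1) (v - S n).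
    rewrite sumrB scalerBr sumr_const card_ord -scaler_nat scalerA.
    by rewrite [c N * _]mulVf ?pnatr_eq0 // scale1r.
  rewrite normrZ (ger0_norm (c0 N)) cE rmorphM; apply: ler_wpM2l; first by rewrite -cE.
  apply: (le_trans (ler_norm_sum _ _ _)).
  apply: (@le_trans _ _ (\sum_(n < N.+1) (M * r ^+ n)%:C%C)); first exact: ler_sum.
  rewrite -rmorph_sum lecR -mulr_sumr.
  have M0 : 0 <= M.
    by have := le_trans (normr_ge0 _) (Sv 0%N); rewrite expr0 mulr1 lecR.
  apply: ler_wpM2l => //; rewrite -[(1 - r)^-1]mul1r ler_pdivlMr ?subr_gt0 //.
  have := subrX1 r N.+1; rewrite -[\sum_(i < _) _]/(\sum_(i < N.+1) r ^+ i) => e.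
  rewrite mulrC -[1 - r]opprB mulNr -e opprB gerBl exprn_ge0 //.
have cvg0 : (fun N => c N *: \sum_(n < N.+1) g n) @ \oo --> (0 : H).
  (* By orthogonality the sum of [N+1] terms has norm at most [B sqrt(N+1)], hence their mean at
     most [B / sqrt(N+1)]. *)
  apply: (@cvg_le_real _ _ _ _ (fun N => B * Num.sqrt (harmonic N))).
    rewrite -(mulr0 B) -sqrtr0; apply: cvgM; first exact: cvg_cst.
    by apply: continuous_cvg; [exact: sqrt_continuous|exact: cvg_harmonic].
  move=> N; rewrite sub0r normrN normrZ (ger0_norm (c0 N)).
  have B1 : 0 <= (B * Num.sqrt (harmonic N))%:C%C :> C.
    by rewrite lecR mulr_ge0 ?sqrtr_ge0.
  have G0 : 0 <= c N * `|\sum_(n < N.+1) g n| by rewrite mulr_ge0.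
  rewrite -(@ler_pXn2r _ 2) ?nnegrE //.
  rewrite exprMn -rmorphXn exprMn sqr_sqrtr ?invr_ge0 ?ler0n //.
  apply: (@le_trans _ _ (c N ^+ 2 * (B ^+ 2 * N.+1%:R)%:C%C)).
    by apply: ler_wpM2l; [exact: exprn_ge0|exact: sum_orthogonal_le].
  rewrite cE -rmorphXn -rmorphM lecR /harmonic le_eqVlt; apply/orP; left; apply/eqP.
  by rewrite /= mulrCA [_^-1 ^+ 2]expr2 -[_^-1 * _ * _]mulrA mulVf ?pnatr_eq0 // mulr1.
have cvT : (fun N => (mean S N, mean g N, mean S N)) @ \oo --> (v, 0 : H, v).
  exact: cvg_pair (cvg_pair cvS cvg0) cvS.
rewrite -TE in cvT.
apply: (closed_cvg _ (@closed_closure _ _) _ _ cvT).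
by apply: nearW => N; apply: subset_closure.
Qed.
End Cesaro.

Section ClosedOperators.
Variables (R : realType) (q : qparam R) (H : hilbertType R).
Variables (eta : nat * nat * int -> H) (heta : orthonormal_basis eta).
Variables (rho : Oq q -> H -> H) (hrho : I11_bounded eta rho).
Local Notation C := R[i].
Local Notation Q := (qC q).
Local Notation h := (qhalf q).
Local Notation L := (lam q).
Local Notation ln := (lamn q).
Local Notation fE := (I11_E q eta).
Local Notation fF := (I11_F q eta).
Local Notation fK := (I11_K q eta).
Local Notation fKi := (I11_Ki q eta).
Local Notation v := (v0 q eta).

Lemma rho_continuous x : continuous (rho x).
Proof.
have [M rM] := I11_bound hrho x.
exact: linear_bounded_cts (I11_linear hrho x) rM.
Qed.

Section Twisted.
Variables (f : nat * nat * int -> H) (delta : Oq q -> Oq q) (s : C).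
Hypothesis delta1 : delta 1 = 0.
Hypothesis deltaD : forall x y, delta (x + y) = delta x + delta y.
Hypothesis deltaZ : forall c x, delta (c *: x) = c *: delta x.
Hypothesis deltaM : forall x y, delta (x * y) = delta x * actK y + actKi x * delta y.
Hypothesis stable_a : basis_stable eta rho f delta s (oa q).
Hypothesis stable_b : basis_stable eta rho f delta s (ob q).
Hypothesis stable_c : basis_stable eta rho f delta s (oc q).
Hypothesis stable_d : basis_stable eta rho f delta s (od q).

Definition joint_graph : set (H * H * H) :=
  lin_span (range (fun i => (eta i, f i, fKi i))).

(** For [p = (u, f u, K^-1 u)] this is the triple of [x u] as predicted by the cross relations. *)
Definition twisted (x : Oq q) (p : H * H * H) : H * H * H :=
  (rho x p.1.1, rho (actKi x) p.1.2 + s *: rho (delta x) p.2, rho (actK x) p.2).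

Let twistedL x c p p' : twisted x (c *: p + p') = c *: twisted x p + twisted x p'.
Proof.
rewrite /twisted /= !(I11_linear hrho); congr (_, _, _) => /=.
by rewrite !scalerDr !scalerA [c * s]mulrC addrACA.
Qed.

Let twisted_continuous x : continuous (twisted x).
Proof.
have c12 : continuous (fun p : H * H * H => p.1.2).
  by move=> p; apply: (cvg_comp fst snd); [exact: cvg_fst|exact: cvg_snd].
have c11 : continuous (fun p : H * H * H => p.1.1).
  by move=> p; apply: (cvg_comp fst fst); [exact: cvg_fst|exact: cvg_fst].
have c2 : continuous (fun p : H * H * H => p.2) by move=> p; exact: cvg_snd.
have rc y (g : H * H * H -> H) : continuous g -> continuous (fun p => rho y (g p)).
  by move=> gc p; apply: (cvg_comp g (rho y)); [exact: gc|exact: rho_continuous].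
apply: pair_continuous; last exact: rc.
apply: pair_continuous; first exact: rc.
move=> p; apply: cvgD; first exact: rc.
by apply: cvgZ; [exact: cvg_cst|exact: rc].
Qed.

Let jointL : forall c p p',
  closure joint_graph p -> closure joint_graph p' -> closure joint_graph (c *: p + p').
Proof. by apply: closure_linear => c p p'; apply: lin_spanL. Qed.

Let joint0 : closure joint_graph 0.
Proof. exact/subset_closure/lin_span0. Qed.

Let twisted_gen z : basis_stable eta rho f delta s z ->
  forall p, closure joint_graph p -> closure joint_graph (twisted z p).
Proof.
move=> zP; apply: closure_image; first exact: twisted_continuous.
apply: (lin_span_ind (P := fun p => joint_graph (twisted z p))).
- rewrite /twisted /= !(rho0r hrho) scaler0 addr0; exact: lin_span0.
- by move=> c p p' Hp Hp'; rewrite twistedL; apply: lin_spanL.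
- move=> _ [i _ <-]; have [j [c [e1 e2 e3]]] := zP i.
  rewrite /twisted /= e1 e2 e3.
  rewrite -[(_, _, _)]/(c *: (eta j, f j, fKi j)) -[_ *: _]addr0.
  by apply: lin_spanL; [apply: lin_span_gen; exists j|exact: lin_span0].
Qed.

(** The Leibniz rule [deltaM] says precisely that [twisted (x * y)] is [twisted x] after
    [twisted y], so the four generators suffice. *)
Lemma twisted_stable x p :
  closure joint_graph p -> closure joint_graph (twisted x p).
Proof.
elim/Oq_ind: x p => [||||||x y Hx Hy|c x Hx].
- exact: twisted_gen stable_a.
- exact: twisted_gen stable_b.
- exact: twisted_gen stable_c.
- exact: twisted_gen stable_d.
- move=> [[u w] w'] Hp.
  by rewrite /twisted /= delta1 actK1 actKi1 !(I11_1 hrho) (rho0l hrho) scaler0 addr0.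
- move=> x y Hx Hy p Hp; rewrite -[twisted _ _](_ : 1 *: twisted x p + twisted y p = _).
    by apply: jointL; [exact: Hx|exact: Hy].
  rewrite scale1r /twisted deltaD actKD actKiD !(I11_D hrho) scalerDr.
  by congr (_, _, _) => /=; rewrite addrACA.
- move=> p Hp; have := Hx _ (Hy _ Hp).
  rewrite /twisted /= deltaM actKM actKiM (I11_D hrho) !(I11_M hrho).
  rewrite (rhoDr hrho) (rhoZr hrho) scalerDr.
  by rewrite -addrA [s *: rho (actKi x) _ + _]addrC.
- move=> p Hp; rewrite -[twisted _ _]addr0 [twisted _ _](_ : _ = c *: twisted x p).
    by apply: jointL => //; exact: Hx.
  rewrite /twisted deltaZ actKZ actKiZ !(I11_Z hrho).
  by congr (_, _, _) => /=; rewrite scalerDr !scalerA [s * c]mulrC.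
Qed.

Hypothesis joint_v : closure joint_graph (v, 0, v).

(** At the triple [(v, 0, v)], which stands for [f v0 = 0] and [K^-1 v0 = v0], only the [delta] term
    of [twisted] survives. *)
Lemma closure_basis_op_delta x :
  closure (basis_op eta f) (rho x v, s *: rho (delta x) v).
Proof.
have := twisted_stable (x := x) joint_v; rewrite /twisted /= (rho0r hrho) add0r.
apply: (closure_image (f := fun p : H * H * H => (p.1.1, p.1.2))).
  apply: pair_continuous => p; apply: (cvg_comp fst); do ?exact: cvg_fst.
  exact: cvg_snd.
apply: (lin_span_ind (P := fun p : H * H * H => basis_op eta f (p.1.1, p.1.2))).
- exact: lin_span0.
- by move=> c p p' Hp Hp'; exact: lin_spanL Hp Hp'.
- by move=> _ [i _ <-]; apply: lin_span_gen; exists i.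
Qed.

Lemma closure_basis_op_Ki x : closure (basis_op eta fKi) (rho x v, rho (actK x) v).
Proof.
have := twisted_stable (x := x) joint_v; rewrite /twisted /= (rho0r hrho) add0r.
apply: (closure_image (f := fun p : H * H * H => (p.1.1, p.2))).
  apply: pair_continuous => p; last exact: cvg_snd.
  by apply: (cvg_comp fst); exact: cvg_fst.
apply: (lin_span_ind (P := fun p : H * H * H => basis_op eta fKi (p.1.1, p.2))).
- exact: lin_span0.
- by move=> c p p' Hp Hp'; exact: lin_spanL Hp Hp'.
- by move=> _ [i _ <-]; apply: lin_span_gen; exists i.
Qed.
End Twisted.

Local Notation u n := ((- Q) ^+ n *: eta (n, n, - n%:Z)).

Lemma v0_series : series (fun n => u n) @ \oo --> v /\
  forall n, `|v - series (fun n => u n) n| <= ((1 - qval q)^-1 * (qval q) ^+ n)%:C%C :> C.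
Proof.
have q0 := ltW (qval_gt0 q); have q1 := qval_lt1 q.
have un n : `|u n| <= (1 * (qval q) ^+ n)%:C%C :> C.
  rewrite normrZ (norm_eta heta) mulr1 normrX normrN mul1r rmorphXn.
  by rewrite ger0_norm // ltW // qC_gt0.
have [cv dist] := series_geometric_cvg q0 q1 un; split=> // n.
by apply: le_trans (dist n) _; rewrite lecR mul1r mulrC.
Qed.

(* [f v0] telescopes, but its partial sums do not tend to 0. *)
Lemma v0_joint (f : nat * nat * int -> H) (j : nat -> nat * nat * int) :
  let g n := ((-1) ^+ n * h^-1 * ln n.+1 * L^-1) *: eta (j n) in
  injective j ->
  (forall n, (- Q) ^+ n *: f (n, n, - n%:Z) = g n - (if n is m.+1 then g m else 0)) ->
  closure (joint_graph f) (v, 0, v).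
Proof.
move=> g jinj fg.
have fE N : \sum_(n < N.+1) (- Q) ^+ n *: f (n : nat, n : nat, - (n : nat)%:Z) = g N.
  elim: N => [|N IH]; first by rewrite big_ord1 fg subr0.
  by rewrite big_ord_recr /= IH fg addrC subrK.
have [_ dist] := v0_series.
have q0 := ltW (qval_gt0 q); have q1 := qval_lt1 q.
(* With [N+1] summands, [f] maps the partial sum to the single boundary term [g N]; this shift puts
   the extra factor [q] into the error constant. *)
pose S N := series (fun n => u n) N.+1.
pose B : R := complex.Re (h^-1 * `|L^-1|).
have BE : B%:C%C = h^-1 * `|L^-1|.
  apply: RRe_real; apply: ger0_real.
  by rewrite mulr_ge0 // invr_ge0 ltW // qhalf_gt0.
apply: (@closure_cesaro _ _ _ S g v ((1 - qval q)^-1 * qval q) (qval q) B) => //.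
- by move=> c x y; apply: lin_spanL.
- move=> N; rewrite /S /series /= big_mkord -fE.
  elim: N.+1 => [|{}N IH]; first by rewrite !big_ord0; exact: lin_span0.
  rewrite !big_ord_recr /= ![_ + _ *: _]addrC.
  (* The exponent [-n + 2n - n] vanishes, so [K^-1] fixes every summand and the third coordinate
     repeats the first. *)
  have Ki_eta : fKi (N, N, - N%:Z) = eta (N, N, - N%:Z).
    rewrite /I11_Ki; have -> : - (- N%:Z + 2 * N%:Z + - N%:Z) = 0 by ring.
    by rewrite expr0z scale1r.
  rewrite -{2}Ki_eta.
  have iN : joint_graph f (eta (N, N, - N%:Z), f (N, N, - N%:Z), fKi (N, N, - N%:Z)).
    by apply: lin_span_gen; exists (N, N, - N%:Z).
  exact (lin_spanL ((- Q) ^+ N) iN IH).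
- by move=> N; rewrite -mulrA -exprS; exact: dist.
- move=> m n mn; rewrite /g dotZl dotZr (dot_eta heta) (inj_eq jinj) (negPf mn).
  by rewrite !mulr0.
- move=> n; rewrite /g normrZ (norm_eta heta) mulr1 !normrM normrX normrN1 expr1n mul1r.
  rewrite BE ger0_norm ?invr_ge0 ?(ltW (qhalf_gt0 q)) //.
  apply: ler_wpM2r => //; rewrite ger0_norm ?lamn_ge0 //.
  by rewrite -[leRHS]mulr1 ler_wpM2l ?lamn_le1 // invr_ge0 ltW // qhalf_gt0.
Qed.

Let h0 : h != 0 := qhalf_neq0 q.
Let L0 : L != 0 := lam_neq0 q.
Let X0 n : h ^+ n != 0. Proof. by rewrite expf_neq0. Qed.
Let NQX n : (- Q) ^+ n = (-1) ^+ n * (h ^+ n) ^+ 2.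
Proof. by rewrite -[- Q]mulN1r exprMn -[in LHS]qhalf2 [in LHS]exprMn. Qed.

(** The factor [q^n] of the series is cancelled by the growth of the coefficients of [E], so the
    boundary terms do not decay. They come from the term of [E] that raises [k]; for [F] it is the
    one that raises [n]. *)
Lemma v0_joint_E : closure (joint_graph fE) (v, 0, v).
Proof.
apply: (@v0_joint _ (fun n => (n, n.+1, - n%:Z))) => [m n [] //|n].
rewrite /I11_E scalerDr !scalerA qhalfE1 qhalfE2 -!invr_expz !invrK NQX.
rewrite -[h ^ n%:Z]/(h ^+ n).
congr (_ + _); first by congr (_ *: _); field; rewrite ?h0 ?X0 ?L0.
case: n => [|n] /=; first by rewrite lamn0 !(mulr0, mul0r) scale0r oppr0.
have -> : - n.+1%:Z + 1 = - n%:Z by rewrite -addn1 PoszD opprD subrK.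
rewrite -scaleNr; congr (_ *: _); rewrite !exprS.
by field; rewrite ?h0 ?X0 ?L0.
Qed.

Lemma v0_joint_F : closure (joint_graph fF) (v, 0, v).
Proof.
apply: (@v0_joint _ (fun n => (n.+1, n, - n.+1%:Z))) => [m n [] //|n].
rewrite /I11_F scalerDr !scalerA qhalfE1 qhalfE2 -!invr_expz !invrK NQX.
rewrite -[h ^ n%:Z]/(h ^+ n) addrC.
congr (_ + _).
  have -> : - n%:Z - 1 = - n.+1%:Z by rewrite -addn1 PoszD opprD.
  by congr (_ *: _); field; rewrite ?h0 ?X0 ?L0.
case: n => [|n] /=; first by rewrite lamn0 !(mulr0, mul0r) scale0r oppr0.
rewrite -scaleNr; congr (_ *: _); rewrite !exprS.
by field; rewrite ?h0 ?X0 ?L0.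
Qed.

Lemma closure_E x : closure (basis_op eta fE) (rho x v, - Q^-1 *: rho (actE x) v).
Proof.
apply: closure_basis_op_delta v0_joint_E _.
- exact: actE1.
- exact: actED.
- exact: actEZ.
- exact: actEM.
- exact: basis_stable_E_a.
- exact: basis_stable_E_b.
- exact: basis_stable_E_c.
- exact: basis_stable_E_d.
Qed.

Lemma closure_F x : closure (basis_op eta fF) (rho x v, - Q *: rho (actF x) v).
Proof.
apply: closure_basis_op_delta v0_joint_F _.
- exact: actF1.
- exact: actFD.
- exact: actFZ.
- exact: actFM.
- exact: basis_stable_F_a.
- exact: basis_stable_F_b.
- exact: basis_stable_F_c.
- exact: basis_stable_F_d.
Qed.

Lemma closure_Ki x : closure (basis_op eta fKi) (rho x v, rho (actK x) v).
Proof.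
apply: closure_basis_op_Ki v0_joint_E _.
- exact: actE1.
- exact: actED.
- exact: actEZ.
- exact: actEM.
- exact: basis_stable_E_a.
- exact: basis_stable_E_b.
- exact: basis_stable_E_c.
- exact: basis_stable_E_d.
Qed.

(** The graphs of [K] and [K^-1] are transposes of each other, so this is [closure_Ki] at
    [x <| K^-1] with the coordinates exchanged. *)
Lemma closure_K x : closure (basis_op eta fK) (rho x v, rho (actKi x) v).
Proof.
have := @closure_Ki (actKi x); rewrite actKiK.
apply: (closure_image (f := fun p : H * H => (p.2, p.1))).
  by apply: pair_continuous => p; [exact: cvg_snd|exact: cvg_fst].
apply: (lin_span_ind (P := fun p : H * H => basis_op eta fK (p.2, p.1))).
- exact: lin_span0.
- by move=> c p p' Hp Hp'; exact (lin_spanL c Hp Hp').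
- move=> _ [[[n k] l] _ <-] /=.
  set c := h ^ _.
  have cK : c *: fK (n, k, l) = eta (n, k, l).
    by rewrite /I11_K scalerA /c -invr_expz mulVf ?scale1r // expfz_neq0.
  have iK : basis_op eta fK (eta (n, k, l), fK (n, k, l)).
    by apply: lin_span_gen; exists (n, k, l).
  have := lin_spanL c iK (lin_span0 _); rewrite addr0.
  by rewrite -[c *: (_, _)]/(c *: eta (n, k, l), c *: fK (n, k, l)) cK.
Qed.
End ClosedOperators.

(** * Density of the orbit *)

Section Density.
Variables (R : realType) (q : qparam R) (H : hilbertType R).
Variables (eta : nat * nat * int -> H) (heta : orthonormal_basis eta).
Variables (rho : Oq q -> H -> H) (hrho : I11_bounded eta rho).
Local Notation C := R[i].
Local Notation Q := (qC q).
Local Notation v := (v0 q eta).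
Local Notation u n := ((- Q) ^+ n *: eta (n, n, - n%:Z)).
Local Notation D := (range (fun x : Oq q => rho x v)).

Let DL c w w' : D w -> D w' -> D (c *: w + w').
Proof.
by move=> [x _ <-] [y _ <-]; exists (c *: x + y); rewrite // (I11_D hrho) (I11_Z hrho).
Qed.
Let DcL : forall c w w', closure D w -> closure D w' -> closure D (c *: w + w').
Proof. exact: closure_linear DL. Qed.
Let Dc0 : closure D 0.
Proof. by apply: subset_closure; exists 0; rewrite // (rho0l hrho). Qed.
Let DcZ c w : closure D w -> closure D (c *: w).
Proof. by move=> Dw; rewrite -[_ *: _]addr0; apply: DcL. Qed.
Let Dc_rho x w : closure D w -> closure D (rho x w).
Proof.
apply: closure_image; first exact: (rho_continuous hrho).
by move=> _ [y _ <-]; exists (x * y); rewrite // (I11_M hrho).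
Qed.

Let q0 : 0 < qval q := qval_gt0 q.
Let q1 : qval q < 1 := qval_lt1 q.
Let Q0 : Q != 0 := qC_neq0 q.

(* [b c] is diagonal with eigenvalues -q^(2n+1) of strictly decreasing modulus,
   so the powers of [- q^-(2n+1) b c] isolate the leading term of a tail of
   [v0]. *)
Let isolate n N : Oq q := ((- (Q ^+ (2 * n).+1)^-1) *: (ob q * oc q)) ^+ N.

Lemma isolate_u n m N :
  rho (isolate n N) (u (n + m)%N) = (Q ^+ (2 * m)) ^+ N *: u (n + m)%N.
Proof.
have bcE k l p : rho (ob q * oc q) (eta (k, p, l)) = - Q ^+ (2 * k).+1 *: eta (k, p, l).
  rewrite (I11_M hrho) (I11_c hrho) (rhoZr hrho) (I11_b hrho) subrK scalerA.
  by rewrite mulNr -exprD addnS mul2n addnn.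
elim: N => [|N IH]; first by rewrite /isolate !expr0 scale1r (I11_1 hrho).
rewrite /isolate exprS (I11_M hrho) IH !(rhoZr hrho) (I11_Z hrho) bcE.
rewrite !scalerA; congr (_ *: _).
have -> : Q ^+ (2 * (n + m)).+1 = Q ^+ (2 * n).+1 * Q ^+ (2 * m) by rewrite -exprD mulnDr.
have {IH} : Q ^+ (2 * n).+1 != 0 by rewrite expf_neq0.
rewrite [_ ^+ N.+1]exprS; move: (Q ^+ (2 * n).+1) (Q ^+ (2 * m)) => x y x0.
by move: (y ^+ N) ((- Q) ^+ (n + m)) => z t; field.
Qed.

Let normQ k : `|Q ^+ k| = (qval q ^+ k)%:C%C.
Proof. by rewrite normrX ger0_norm ?(ltW (qC_gt0 q)) // /qC -rmorphXn. Qed.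

(** On the terms after the [m]-th the normalized [bc] has eigenvalues of modulus at most [q^2]; the
    decay of the terms themselves sums to [1 / (1 - q)]. *)
Lemma isolate_tail m N :
  `|rho (isolate m N) (v - series (fun k => u k) m.+1)| <=
     (((qval q) ^+ 2) ^+ N * (1 - qval q)^-1)%:C%C :> C.
Proof.
have [cv _] := v0_series q heta.
have cw : (fun k => rho (isolate m N) (series (fun k => u k) (k + m.+1)%N -
    series (fun k => u k) m.+1)) @ \oo -->
    rho (isolate m N) (v - series (fun k => u k) m.+1).
  apply: continuous_cvg; first exact: (rho_continuous hrho).
  by apply: cvgB; [rewrite cvg_shiftn|exact: cvg_cst].
apply: (cvg_norm_le cw) => k.
pose w k := rho (isolate m N) (u (m.+1 + k)%N).
have wk j : `|w j| <= (((qval q) ^+ 2) ^+ N * (qval q) ^+ j)%:C%C :> C.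
  rewrite /w addSnnS isolate_u normrZ normrZ (norm_eta heta) mulr1.
  rewrite [X in _ <= X]rmorphM; apply: ler_pM => //.
    rewrite -exprM normQ lecR -exprM ler_wiXn2l ?(ltW q0) ?(ltW q1) //.
    by rewrite mulnS mulnDl leq_addr.
  rewrite normrX normrN -normrX normQ lecR ler_wiXn2l ?(ltW q0) ?(ltW q1) //.
  by rewrite addnS -addSn leq_addl.
have -> : rho (isolate m N) (series (fun k => u k) (k + m.+1)%N -
    series (fun k => u k) m.+1) = series w (0 + k)%N - series w 0%N.
  elim: k => [|k IH]; first by rewrite add0n !subrr (rho0r hrho).
  rewrite addSn [series _ (k + _).+1]seriesSr addrAC (rhoDr hrho) IH.
  rewrite [in RHS]add0n [in RHS]seriesSr [in RHS]addrAC add0n /w.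
  by rewrite [(k + _)%N]addnC.
have := series_dist_geometric 0%N k (ltW q0) q1 wk.
by rewrite expr0 mulr1.
Qed.

(** The two claims are proved together: the tail yields its leading term as the limit of
    [isolate n N], and subtracting that term gives the next tail. *)
Lemma tail_closure n : closure D (v - series (fun k => u k) n) /\ closure D (u n).
Proof.
suff uD m : closure D (v - series (fun k => u k) m) -> closure D (u m).
  suff tD : closure D (v - series (fun k => u k) n) by split=> //; exact: uD.
  elim: n => [|n IH].
    rewrite /series /= big_geq // subr0; apply: subset_closure; exists 1 => //.
    by rewrite (I11_1 hrho).
  rewrite seriesSr opprD addrA -[- (_ *: _)]scaleN1r addrC; apply: DcL => //; exact: uD.
move=> Dm.
pose w N := rho (isolate m N) (v - series (fun k => u k) m).
have wD N : closure D (w N) by exact: Dc_rho.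
suff cw : w @ \oo --> u m.
  by apply: (closed_cvg _ (@closed_closure _ _) _ _ cw); apply: nearW => N; exact: wD.
apply: (@cvg_le_real _ _ _ _ (fun N => ((qval q) ^+ 2) ^+ N * (1 - qval q)^-1)).
  rewrite -(mul0r (1 - qval q)^-1); apply: cvgM; last exact: cvg_cst.
  by apply: cvg_expr; rewrite ger0_norm ?exprn_ge0 ?(ltW q0) // exprn_ilt1 // ltW.
move=> N.
have wE : v - series (fun k => u k) m = u m + (v - series (fun k => u k) m.+1).
  rewrite -[LHS](subrK (u m)) addrC; congr (_ + _).
  by rewrite seriesSr opprD addrA.
have := isolate_u m 0 N; rewrite addn0 muln0 expr0 expr1n scale1r => uE.
rewrite /w wE (rhoDr hrho) uE opprD addrA subrr add0r normrN.
exact: isolate_tail.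
Qed.

(** The generators move only [n] and [l], never [k]; every [k] is reached because the series [v0]
    contains a vector [eta (k, k, -k)]. *)
Lemma eta_closure i : closure D (eta i).
Proof.
have unscale c w : c != 0 -> closure D (c *: w) -> closure D w.
  by move=> c0 /(@DcZ c^-1 _); rewrite scalerA mulVf // scale1r.
have diag n : closure D (eta (n, n, - n%:Z)).
  have [_ ] := tail_closure n; apply: unscale.
  by rewrite expf_neq0 // oppr_eq0.
have up n k l : closure D (eta (n, k, l)) -> closure D (eta (n, k, l + 1)).
  move=> /(@Dc_rho (ob q) _); rewrite (I11_b hrho); apply: unscale.
  by rewrite expf_neq0.
have down n k l : closure D (eta (n, k, l)) -> closure D (eta (n, k, l - 1)).
  move=> /(@Dc_rho (oc q) _); rewrite (I11_c hrho); apply: unscale.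
  by rewrite oppr_eq0 expf_neq0.
have shift n k l m : closure D (eta (n, k, l)) -> closure D (eta (n, k, m)).
  move=> Dl; rewrite -[m](addrNK l) addrC; elim/int_rect: (m - l) => [|p IH|p IH].
  - by rewrite addr0.
  - by rewrite -addn1 PoszD addrA; apply: up.
  - by rewrite -addn1 PoszD opprD addrA; apply: down.
have dn n k l : closure D (eta (n, k, l)) -> closure D (eta (n.+1, k, l)).
  move=> /(@Dc_rho (od q) _); rewrite (I11_d hrho); apply: unscale.
  by rewrite gt_eqF // lamn_gt0.
have an n k l : closure D (eta (n.+1, k, l)) -> closure D (eta (n, k, l)).
  move=> /(@Dc_rho (oa q) _); rewrite (I11_a hrho) /=; apply: unscale.
  by rewrite gt_eqF // lamn_gt0.
(* From [(k, k, -k)], [a] lowers the first index to [0], [d] raises it to [n], and [b] or [c]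
   adjusts [l]. *)
case: i => [[n k] l]; apply: (shift _ _ (- k%:Z)).
have := diag k; move: (- k%:Z) => z Dk.
have D0 : closure D (eta (0%N, k, z)).
  by elim: {1}k Dk => // p IH /an.
by elim: n => // n; apply: dn.
Qed.

Lemma dense_orbit : dense D.
Proof.
apply/denseP => w.
suff sub : lin_span (range eta) `<=` closure D.
  have := closure_id (closure D); rewrite (_ : closed (closure D) <-> True); last first.
    by split=> // _; exact: closed_closure.
  case=> /(_ I) -> _; apply: (closureS sub).
  exact: (denseP _).1 heta.2 w.
move=> z; apply: (lin_span_ind (P := fun z => closure D z)) => //.
by move=> _ [i _ <-]; exact: eta_closure.
Qed.
End Density.

(** * The representation on the orbit *)

Section ClosureEquivalence.
Variables (R : realType) (X : starAlgType R[i]).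

Lemma isometry_continuous (H1 H2 : hilbertType R) (W : H1 -> H2) :
  linear W -> (forall u, `|W u| = `|u| :> R[i]) -> continuous W.
Proof.
by move=> WL WN; apply: (linear_bounded_cts (M := 1) WL) => u; rewrite mul1r WN.
Qed.

Lemma closure_op_graph (H1 H2 : hilbertType R) (rho1 : opRep X H1) (rho2 : opRep X H2)
    (W : H1 -> H2) : continuous W -> (forall u, rdom rho1 u -> rdom rho2 (W u)) ->
  (forall x u, rdom rho1 u -> rho2 x (W u) = W (rho1 x u)) ->
  forall x u w, closure (op_graph rho1 x) (u, w) -> closure (op_graph rho2 x) (W u, W w).
Proof.
move=> Wc Wd Wi x u w.
apply: (closure_image (f := fun p : H1 * H1 => (W p.1, W p.2))).
  apply: pair_continuous => p.
    by apply: (cvg_comp fst W); [exact: cvg_fst|exact: Wc].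
  by apply: (cvg_comp snd W); [exact: cvg_snd|exact: Wc].
by move=> [a b] [/= Da /= ->]; split=> /=; [exact: Wd|rewrite Wi].
Qed.

(** [W] and its inverse are continuous, so each maps closed graphs into closed graphs, which matches
    the domains. The values chosen by [xget] correspond because the closed graphs of [rho2] are
    single-valued. *)
Lemma unitary_equiv_closure (H1 H2 : hilbertType R) (rho1 : opRep X H1)
    (rho2 : opRep X H2) (W : H1 -> H2) : star_rep rho2 ->
  linear W -> (forall u, `|W u| = `|u| :> R[i]) -> range W = [set: H2] ->
  W @` rdom rho1 = rdom rho2 ->
  (forall x u, rdom rho1 u -> rho2 x (W u) = W (rho1 x u)) ->
  unitary_equiv (rep_closure rho1) (rep_closure rho2).
Proof.
move=> rho2P WL WN Wr Wd Wi.
have WB u w : W (u - w) = W u - W w by rewrite addrC -scaleN1r WL scaleN1r addrC.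
have Winj : injective W.
  move=> u w uw; apply/eqP; rewrite -subr_eq0 -normr_eq0 -WN WB uw subrr.
  by rewrite normr0.
have /choice[V VP] : forall z, exists u, W u = z.
  move=> z; have : range W z by rewrite Wr.
  by case=> u _ <-; exists u.
have VW u : V (W u) = u by apply: Winj.
have VL : linear V by move=> c x y; apply: Winj; rewrite WL !VP.
have VN z : `|V z| = `|z| :> R[i] by rewrite -WN VP.
have Wd1 u : rdom rho1 u -> rdom rho2 (W u) by move=> Du; rewrite -Wd; exists u.
have fwd := closure_op_graph (isometry_continuous WL WN) Wd1 Wi.
have Vd z : rdom rho2 z -> rdom rho1 (V z) by rewrite -Wd => -[u Du <-]; rewrite VW.
have Vi x z : rdom rho2 z -> rho1 x (V z) = V (rho2 x z).
  by rewrite -Wd => -[u Du <-]; rewrite Wi // !VW.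
have bwd := closure_op_graph (isometry_continuous VL VN) Vd Vi.
exists W; split=> //.
- exact: isometry_dot.
- apply/seteqP; split=> [_ [u Du <-] x|z Dz].
    by have [w uw] := Du x; exists (W w); exact: fwd.
  exists (V z); last exact: VP.
  by move=> x; have [w zw] := Dz x; exists (V w); exact: bwd.
- move=> x u Du /=; have [w uw] := Du x.
  have uw1 := xgetPex 0 (ex_intro (fun w => closure (op_graph rho1 x) (u, w)) w uw).
  have uw2 := fwd _ _ _ uw1.
  have uw3 := xgetPex 0 (ex_intro (fun w => closure (op_graph rho2 x) (W u, w)) _ uw2).
  exact: (star_rep_closure_inj rho2P uw3 uw2).
Qed.
End ClosureEquivalence.

Section OrbitRepresentation.
Variables (R : realType) (q : qparam R) (H : hilbertType R).
Variables (eta : nat * nat * int -> H) (heta : orthonormal_basis eta).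
Variables (rho : Oq q -> H -> H) (hrho : I11_bounded eta rho).
Local Notation C := R[i].
Local Notation Q := (qC q).
Local Notation v := (v0 q eta).
Local Notation D := (range (fun x : Oq q => rho x v)).

Lemma basis_adj (f g : H -> H) : linear f -> linear g -> continuous f -> continuous g ->
  (forall i j, dot (f (eta i)) (eta j) = dot (eta i) (g (eta j)) :> C) ->
  forall u w, dot (f u) w = dot u (g w) :> C.
Proof.
move=> fL gL fc gc fg.
have L0 (k : H -> H) : linear k -> k 0 = 0.
  by move=> kL; have := kL (-1) 0 0; rewrite scaler0 addr0 scaleN1r addNr.
have dc (k : H -> H) w : continuous k -> continuous (fun u => dot (k u) w : C^o).
  move=> kc u; apply: (cvg_comp k (fun u => dot u w : C^o)); first exact: kc.
  exact: dot_continuousl.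
have dense_eta := (denseP _).1 heta.2.
have step1 j u : dot (f u) (eta j) = dot u (g (eta j)) :> C.
  apply: (@eq_closure _ _ C^o _ _ _ (dc f _ fc) (dc id _ (fun x => cvg_id)) _ _
    (dense_eta u)).
  apply: (lin_span_ind (P := fun u => dot (f u) (eta j) = dot u (g (eta j)) :> C)).
  - by rewrite (L0 f) // !dot0l.
  - by move=> c a b Ha Hb; rewrite fL !dotDl !dotZl Ha Hb.
  - by move=> _ [i _ <-].
move=> u w; rewrite dotC [RHS]dotC; congr (_^*).
apply: (@eq_closure _ _ C^o _ _ _ (dc id _ (fun x => cvg_id)) (dc g _ gc) _ _
  (dense_eta w)).
apply: (lin_span_ind (P := fun w => dot w (f u) = dot (g w) u :> C)).
- by rewrite (L0 g) // !dot0l.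
- by move=> c a b Ha Hb; rewrite gL !dotDl !dotZl Ha Hb.
- by move=> _ [i _ <-]; rewrite dotC step1 -dotC.
Qed.

Let Q_conj : Q^* = Q := qC_conj q.

Lemma rho_adj_a u w : dot (rho (oa q) u) w = dot u (rho (od q) w) :> C.
Proof.
apply: basis_adj; try exact: (I11_linear hrho); try exact: (rho_continuous hrho).
move=> [[n k] l] [[n' k'] l'].
rewrite (I11_a hrho) (I11_d hrho) dotZl dotZr !(dot_eta heta) lamn_conj.
case: n => [|n] /=; first by rewrite lamn0 mul0r mulr0.
have [[-> -> ->]|ne] := eqVneq (n, k, l) (n', k', l'); first by rewrite eqxx.
have [[nn kk ll]|] := eqVneq (n.+1, k, l) (n'.+1, k', l'); last by rewrite !mulr0.
by rewrite nn kk ll eqxx in ne.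
Qed.

Lemma rho_adj_b u w : dot (rho (ob q) u) w = dot u (rho ((- Q) *: oc q) w) :> C.
Proof.
apply: basis_adj; try exact: (I11_linear hrho); try exact: (rho_continuous hrho).
move=> [[n k] l] [[n' k'] l'].
rewrite (I11_Z hrho) (I11_b hrho) (I11_c hrho) scalerA mulrNN -exprS.
rewrite dotZl dotZr !(dot_eta heta).
have -> : (Q ^+ n'.+1)^* = Q ^+ n'.+1 by rewrite [LHS]rmorphXn [X in X ^+ _]Q_conj.
have [[-> -> ll]|ne] := eqVneq (n, k, l + 1) (n', k', l').
  by rewrite -ll addrK eqxx.
have [[nn kk ll]|] := eqVneq (n, k, l) (n', k', l' - 1); last by rewrite !mulr0.
by rewrite nn kk ll subrK eqxx in ne.
Qed.

Lemma rho_adj x u w : dot (rho x u) w = dot u (rho (star x) w) :> C.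
Proof.
elim/Oq_ind: x u w => [|||||x y Hx Hy|x y Hx Hy|c x Hx] u w.
- by rewrite rho_adj_a [star _]ostara.
- by rewrite rho_adj_b [star _]ostarb.
- rewrite [star _]ostarc (I11_Z hrho) dotZr conjNqCV [dot u _]dotC rho_adj_b.
  rewrite (I11_Z hrho) dotZr conjNqC rmorphM [X in _ * (X * _)]conjNqC mulrA qVq mul1r.
  exact: dotC.
- by rewrite [star _]ostard dotC -rho_adj_a -dotC.
- by rewrite [star _]ostar1 !(I11_1 hrho).
- by rewrite starD !(I11_D hrho) dotDl dotDr Hx Hy.
- by rewrite starM !(I11_M hrho) Hx Hy.
- by rewrite starZ !(I11_Z hrho) dotZl dotZr conjCK Hx.
Qed.

Let cl0 f : closure (basis_op eta f) (0, 0).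
Proof. exact/subset_closure/lin_span0. Qed.

(** For a generator [f], a nonzero multiple of [(y <| f) v0] is paired with [y v0 = 0] in a closed
    graph that is single-valued and contains [(0, 0)]. Products follow by iteration. *)
Lemma act_kernel f y : rho y v = 0 -> rho (act y f) v = 0.
Proof.
have Q0 := qC_neq0 q.
have Z (c : C) w : c != 0 -> c *: w = 0 :> H -> w = 0.
  by move=> c0 /eqP; rewrite scaler_eq0 (negPf c0) => /eqP.
elim/Uq_ind: f y => [|||||f g Hf Hg|f g Hf Hg|c f Hf] y y0.
- have := closure_E (x := y) heta hrho; rewrite y0 act_uE.
  move/(basis_op_fun heta (I11_EF_adj q heta)) => eq0.
  by move: (eq0 _ (cl0 _)); apply: Z; rewrite oppr_eq0 invr_eq0.
- have := closure_F (x := y) heta hrho; rewrite y0 act_uF.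
  move/(basis_op_fun heta (I11_FE_adj q heta)) => eq0.
  by move: (eq0 _ (cl0 _)); apply: Z; rewrite oppr_eq0.
- have := closure_Ki (x := y) heta hrho; rewrite y0 act_uK.
  move/(basis_op_fun heta (I11_Ki_adj q heta)) => eq0.
  by move: (eq0 _ (cl0 _)).
- have := closure_K (x := y) heta hrho; rewrite y0 act_uKi.
  move/(basis_op_fun heta (I11_K_adj q heta)) => eq0.
  by move: (eq0 _ (cl0 _)).
- by rewrite act1.
- by rewrite actDr (I11_D hrho) Hf // Hg // addr0.
- by rewrite actM; apply/Hg/Hf.
- by rewrite actZr (I11_Z hrho) Hf // scaler0.
Qed.

Lemma crossact_congr t y y' : rho y v = rho y' v ->
  rho (crossact t y) v = rho (crossact t y') v.
Proof.
move=> yy.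
have N0 z : rho z v = 0 -> rho (crossact t z) v = 0.
  move=> z0; elim/tensor_ind: t => [f x||t t' Ht Ht'].
  - by rewrite crossact_pure act_kernel // (I11_M hrho) z0 (rho0r hrho).
  - by rewrite crossact0 (rho0l hrho).
  - by rewrite crossactD (I11_D hrho) Ht Ht' addr0.
have := N0 ((-1) *: y' + y); rewrite crossactL !(I11_D hrho) !(I11_Z hrho) yy.
by rewrite !scaleN1r addNr => /(_ erefl) /eqP; rewrite addrC subr_eq0 => /eqP.
Qed.

(** Some [y] with [y v0 = w] is chosen; by [crossact_congr] the result does not depend on the
    choice. *)
Definition orbit_op (t : cross q) (w : H) : H :=
  rho (crossact t (xget 0 [set y | rho y v = w])) v.

Lemma orbit_opE t y : orbit_op t (rho y v) = rho (crossact t y) v.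
Proof.
apply: crossact_congr.
exact: (xgetPex 0 (ex_intro (fun z => rho z v = rho y v) y erefl)).
Qed.

Lemma star_inU f : star (inU f) = inU (star f) :> cross q.
Proof.
rewrite [LHS]crossstar_pure [star (1 : Oq q)]ostar1.
by rewrite inO1 mul1r.
Qed.

Lemma crossact_adj t x y : dot (rho (crossact t x) v) (rho y v) =
  dot (rho x v) (rho (crossact (star t) y) v) :> C.
Proof.
pose P t := forall x y, dot (rho (crossact t x) v) (rho y v) =
  dot (rho x v) (rho (crossact (star t) y) v) :> C.
have PD s t' : P s -> P t' -> P (s + t').
  move=> Hs Ht x' y'; rewrite starD !crossactD !(I11_D hrho) dotDl dotDr.
  by rewrite Hs Ht.
have PM s t' : P s -> P t' -> P (s * t').
  by move=> Hs Ht x' y'; rewrite starM !crossactM Hs Ht.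
have PZ c t' : P t' -> P (c *: t').
  move=> Ht x' y'; rewrite starZ !crossactZ !(I11_Z hrho) dotZl dotZr conjCK.
  by rewrite Ht.
have PO z : P (inO z).
  move=> x' y'; rewrite [star _]crossstar_inO !crossact_inO !(I11_M hrho).
  exact: rho_adj.
have P0 : P 0 by rewrite -(scale0r (1 : cross q)); exact: PZ (PO 1).
have PU f : P (inU f).
  elim/Uq_ind: f => [||||||f g Hf Hg|c f Hf].
  - move=> x' y'; rewrite star_inU [star _]ustarE crossact_uE crossact_uF !(I11_Z hrho).
    exact: (basis_op_adj (I11_EF_adj q heta)
      (closure_E (x := x') heta hrho) (closure_F (x := y') heta hrho)).
  - move=> x' y'; rewrite star_inU [star _]ustarF crossact_uE crossact_uF !(I11_Z hrho).
    exact: (basis_op_adj (I11_FE_adj q heta)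
      (closure_F (x := x') heta hrho) (closure_E (x := y') heta hrho)).
  - move=> x' y'; rewrite star_inU [star _]ustarK !crossact_uK.
    exact: (basis_op_adj (I11_K_adj q heta)
      (closure_K (x := x') heta hrho) (closure_K (x := y') heta hrho)).
  - move=> x' y'; rewrite star_inU [star _]ustarKi !crossact_uKi.
    exact: (basis_op_adj (I11_Ki_adj q heta)
      (closure_Ki (x := x') heta hrho) (closure_Ki (x := y') heta hrho)).
  - exact: (PO 1).
  - by move=> f g Hf Hg; rewrite inUD; apply: PD.
  - by rewrite inUM; apply: PM.
  - by rewrite inUZ; apply: PZ.
suff : P t by apply.
elim/tensor_ind: t => [f z||t t' Ht Ht'] //; last exact: PD.
by rewrite [pure f z]pure_inUO; apply: PM.
Qed.

Lemma orbit_star_rep : star_rep (OpRep D orbit_op).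
Proof.
have RL c x y : c *: rho x v + rho y v = rho (c *: x + y) v.
  by rewrite (I11_D hrho) (I11_Z hrho).
split=> /=.
- by exists 0; rewrite // (rho0l hrho).
- by move=> c _ _ [x _ <-] [y _ <-]; exists (c *: x + y).
- exact: dense_orbit.
- by move=> t _ [x _ <-]; rewrite orbit_opE; exists (crossact t x).
- by move=> t c _ _ [x _ <-] [y _ <-]; rewrite RL !orbit_opE crossactL RL.
- by move=> _ [x _ <-]; rewrite orbit_opE crossact1.
- by move=> s t _ [x _ <-]; rewrite !orbit_opE crossactD (I11_D hrho).
- by move=> c t _ [x _ <-]; rewrite !orbit_opE crossactZ (I11_Z hrho).
- by move=> s t _ [x _ <-]; rewrite !orbit_opE crossactM.
- by move=> t _ _ [x _ <-] [y _ <-]; rewrite !orbit_opE crossact_adj.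
Qed.

Lemma orbit_extends : extends_I11 eta rho D orbit_op.
Proof.
split.
- move=> _ [x _ <-]; rewrite orbit_opE crossact_uE (I11_Z hrho); exact: closure_E.
- move=> _ [x _ <-]; rewrite orbit_opE crossact_uF (I11_Z hrho); exact: closure_F.
- move=> _ [x _ <-]; rewrite orbit_opE crossact_uK; exact: closure_K.
- move=> _ [x _ <-]; rewrite orbit_opE crossact_uKi; exact: closure_Ki.
- by move=> x _ [y _ <-]; rewrite orbit_opE crossact_inO (I11_M hrho).
Qed.

(** Single-valuedness of the four closed graphs fixes both representations on the generators of the
    cross product algebra; stability of the domain handles products. *)
Lemma extends_unique (D' : set H) (pi pi' : cross q -> H -> H) :
  star_rep (OpRep D' pi) -> extends_I11 eta rho D' pi ->
  star_rep (OpRep D' pi') -> extends_I11 eta rho D' pi' ->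
  forall t u, D' u -> pi' t u = pi t u.
Proof.
move=> sr ex sr' ex'.
pose agree t := forall u, D' u -> pi' t u = pi t u.
have st t u : D' u -> D' (pi t u) by move=> Du; exact: (star_rep_stable sr t).
have PM s t : agree s -> agree t -> agree (s * t).
  move=> Hs Ht u Du; have /= -> := star_repM sr' s t Du.
  have /= -> := star_repM sr s t Du.
  by rewrite Ht // Hs //; exact: st.
have PD s t : agree s -> agree t -> agree (s + t).
  move=> Hs Ht u Du; have /= -> := star_repD sr' s t Du.
  have /= -> := star_repD sr s t Du.
  by rewrite Ht // Hs.
have PZ c t : agree t -> agree (c *: t).
  move=> Ht u Du; have /= -> := star_repZ sr' c t Du.
  have /= -> := star_repZ sr c t Du.
  by rewrite Ht.
have PO x : agree (inO x).
  by move=> u Du; rewrite (ext_O ex x Du) (ext_O ex' x Du).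
have PU f : agree (inU f).
  elim/Uq_ind: f => [u Du|u Du|u Du|u Du||f g Hf Hg|f g Hf Hg|c f Hf].
  - exact: (basis_op_fun heta (I11_EF_adj q heta) (ext_E ex' Du) (ext_E ex Du)).
  - exact: (basis_op_fun heta (I11_FE_adj q heta) (ext_F ex' Du) (ext_F ex Du)).
  - exact: (basis_op_fun heta (I11_K_adj q heta) (ext_K ex' Du) (ext_K ex Du)).
  - exact: (basis_op_fun heta (I11_Ki_adj q heta) (ext_Ki ex' Du) (ext_Ki ex Du)).
  - exact: (PO 1).
  - by rewrite inUD; apply: PD.
  - by rewrite inUM; apply: PM.
  - by rewrite inUZ; apply: PZ.
move=> t; rewrite -/(agree t).
elim/tensor_ind: t => [f x||s t Hs Ht]; last exact: PD.
- rewrite [pure f x]pure_inUO; exact: PM (PU f) (PO x).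
- rewrite -(scale0r (1 : cross q)); exact: PZ (PO 1).
Qed.

Lemma haar_orbit (h : Oq q -> C) : haar h ->
  forall x, dot (rho x v) v = dot v v * h x :> C.
Proof.
move=> [hL h1 hact] x; have Q0 := qC_neq0 q.
have Z (c z : C) : c != 0 -> c * z = 0 -> z = 0.
  by move=> c0 /eqP; rewrite mulf_eq0 (negPf c0) => /eqP.
have hE y : h (actE y) = 0.
  by rewrite -act_uE hact [eps _](uliftE (isUq_eps q)) mul0r.
have hF y : h (actF y) = 0.
  by rewrite -act_uF hact [eps _](uliftF (isUq_eps q)) mul0r.
have hK y : h (actK y) = h y.
  by rewrite -act_uK hact [eps _](uliftK (isUq_eps q)) mul1r.
(* Moved to the other side, a generator acts on [1], where it reduces to its counit. *)
have adj f y : dot (rho (crossact (inU f) y) v) v =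
    dot (rho y v) (rho (crossact (inU (star f)) 1) v) :> C.
  by rewrite -star_inU -crossact_adj (I11_1 hrho).
pose g y : C := dot (rho y v) v - dot v v * h y.
apply/eqP; rewrite -subr_eq0; apply/eqP.
apply: (@invariant_functional_eq0 _ q g) => [c y z|y|y|y|].
- rewrite /g hL (I11_D hrho) (I11_Z hrho) dotDl dotZl; ring.
- rewrite /g hE mulr0 subr0; have := adj (uE q) y.
  rewrite [star _]ustarE crossact_uE crossact_uF actF1 scaler0 (rho0l hrho) dot0r.
  by rewrite (I11_Z hrho) dotZl => /Z; apply; rewrite oppr_eq0 invr_eq0.
- rewrite /g hF mulr0 subr0; have := adj (uF q) y.
  rewrite [star _]ustarF crossact_uE crossact_uF actE1 scaler0 (rho0l hrho) dot0r.
  by rewrite (I11_Z hrho) dotZl => /Z; apply; rewrite oppr_eq0.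
(* [K^-1] is used because it acts through [S^-1(K^-1) = K]. *)
- rewrite /g hK; congr (_ - _); have := adj (uKi q) y.
  by rewrite [star _]ustarKi !crossact_uKi actK1 (I11_1 hrho).
- by rewrite /g h1 (I11_1 hrho) mulr1 subrr.
Qed.

(** If [v0] were zero, its orbit would be [{0}], which is not dense. *)
Lemma v0_neq0 : v != 0.
Proof.
apply/eqP => v00; have /denseP dD := dense_orbit heta hrho.
have := norm_eta heta (0%N, 0%N, 0).
have -> : eta (0%N, 0%N, 0) = 0.
  apply: (@eq_closure _ _ H id (fun=> 0) D _ _ _ _ (dD _)).
  - by move=> x; exact: cvg_id.
  - exact: cst_continuous.
  - by move=> _ [x _ <-]; rewrite v00 (rho0r hrho).
by rewrite normr0 => /esym/eqP; rewrite oner_eq0.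
Qed.

Lemma heisenberg_equiv (Hh : hilbertType R) (pih : opRep (cross q) Hh) :
  heisenberg pih -> unitary_equiv (rep_closure (OpRep D orbit_op)) pih.
Proof.
move=> [h [ph [vh [pit [hh [phP Dvh phD hE] [pitP pitD pitO pitU] ->]]]]].
have Dph x : rdom ph (ph x vh) by rewrite phD; exists x.
pose s : C := `|v|.
have s0 : s != 0 by rewrite normr_eq0 v0_neq0.
pose p' x := ph (s *: x) vh.
have p'E x : p' x = s *: ph x vh by rewrite /p' (star_repZ phP).
have p'L : linear p'.
  move=> c x y; rewrite !p'E (star_repD phP) // (star_repZ phP) //.
  by rewrite scalerDr !scalerA mulrC.
have pN x : `|p' x| = `|rho x v| :> C.
  have sC : s^* = s by apply: geC0_conj; exact: normr_ge0.
  apply/eqP; rewrite -(@eqrXn2 _ 2) // -!dotE p'E dotZl dotZr sC.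
  (* Both squared norms become values at [star x * x] of functionals that [haar_orbit] identifies up
     to the factor [|v0|^2]. *)
  have -> : dot (rho x v) (rho x v) = dot (rho (star x * x) v) v :> C.
    by rewrite (I11_M hrho) [RHS]rho_adj starK.
  rewrite (haar_orbit hh) hE (star_repM phP) // (star_rep_adj phP) // starK !dotE.
  by rewrite mulrA -expr2.
have rp' : range p' = rdom ph.
  rewrite phD; apply/seteqP; split=> _ [x _ <-]; first by exists (s *: x).
  by exists (s^-1 *: x) => //; rewrite /p' scalerA mulfV // scale1r.
have dp' : dense (range p') by rewrite rp'; exact: (star_rep_dense phP).
have pL : linear (fun x => rho x v).
  by move=> c x y; rewrite (I11_D hrho) (I11_Z hrho).
have [W [WL WN Wr WE]] := isometry_extension pL p'L pN (dense_orbit heta hrho) dp'.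
(* [pit] is prescribed separately on [U] and on [O]; the factorization of pure tensors as
   [inU f * inO y] determines it everywhere. *)
have pit_act t x : pit t (ph x vh) = ph (crossact t x) vh.
  elim/tensor_ind: t => [f y||t t' Ht Ht'].
  - rewrite [pure f y]pure_inUO (star_repM pitP) ?pitD // pitO // -(star_repM phP) //.
    by rewrite pitU -pure_inUO crossact_pure.
  - rewrite crossact0 -(scale0r (1 : cross q)) (star_repZ pitP) ?pitD // scale0r.
    by rewrite -(scale0r (0 : Oq q)) (star_repZ phP) // scale0r.
  - by rewrite (star_repD pitP) ?pitD // crossactD (star_repD phP) // Ht Ht'.
apply: (unitary_equiv_closure pitP WL WN Wr) => /=.
- rewrite pitD -rp'; apply/seteqP; split=> [_ [_ [x _ <-] <-]|_ [x _ <-]].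
    by exists x => //; rewrite WE.
  by exists (rho x v); [exists x|rewrite WE].
- move=> t _ [x _ <-]; rewrite orbit_opE !WE /p' pit_act.
  by have := crossactL t s x 0; rewrite crossact0r !addr0 => ->.
Qed.
End OrbitRepresentation.

Theorem theorem6p2 (R : realType) (q : qparam R) (H : hilbertType R)
    (eta : nat * nat * int -> H) (heta : orthonormal_basis eta)
    (rho : Oq q -> H -> H) (hrho : I11_bounded eta rho) :
  let D : set H := range (fun x : Oq q => rho x (v0 q eta)) in
  dense D /\
  exists pi : cross q -> H -> H,
    [/\ star_rep (OpRep D pi), extends_I11 eta rho D pi,
        (forall pi' : cross q -> H -> H,
           star_rep (OpRep D pi') -> extends_I11 eta rho D pi' ->
           forall x u, D u -> pi' x u = pi x u) &
        forall (Hh : hilbertType R) (pih : opRep (cross q) Hh),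
          heisenberg pih -> unitary_equiv (rep_closure (OpRep D pi)) pih].
Proof.
split; first exact: dense_orbit.
have op_rep := orbit_star_rep heta hrho.
have op_ext := orbit_extends heta hrho.
exists (orbit_op eta rho); split=> //.
- by move=> pi' pi'_rep pi'_ext; exact: (extends_unique heta op_rep op_ext).
- exact: heisenberg_equiv.
Qed.
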